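(* Let $\Omega\subset\mathbb{R}^2$ be a compact convex domain with nonempty interior, and let $\widehat\Omega\supset\Omega$ be its minimal model. Then for $\Re(s)>2$, $$s(s-1)Z_\Omega(s)=-F_{\partial\Omega}(s)+H_{\widehat\Omega}(s),\qquad H_{\widehat\Omega}(s):=s(s-1)Z_{\widehat\Omega}(s),$$ where $H_{\widehat\Omega}$ is a holomorphic function of the form $H_{\widehat\Omega}(s)=m_{\widehat\Omega}^{\,s-1}(2l_{\widehat\Omega}s+k_{\widehat\Omega}m_{\widehat\Omega})$ for real numbers $m_{\widehat\Omega},l_{\widehat\Omega}$ and an integer $k_{\widehat\Omega}$ depending only on $\widehat\Omega$.
   Context: For a compact convex $K\subset\mathbb{R}^2$ with nonempty interior: $h_K(u)=\min_{x\in K}\langle u,x\rangle$; $\mathbb{Z}^2_{\mathrm{prim}}$ is the set of nonzero integer vectors with coprime coordinates; $\rho_K(x)=\min_{u\in\mathbb{Z}^2_{\mathrm{prim}}}(\langle u,x\rangle-h_K(u))$ on the interior, extended by $0$ to $\partial K$; $Z_K(s)=\int_K\rho_K(x)^{s-2}dx$. Minimal model: let $m_\Omega=\max\rho_\Omega$, $M_\Omega=\{x:\rho_\Omega(x)=m_\Omega\}$, $\mathcal{E}_\Omega$ the (finite) set of primitive $u$ such that $m_\Omega=\langle u,x\rangle-h_\Omega(u)$ for some $x\in M_\Omega$, and $\widehat\Omega=\bigcap_{u\in\mathcal{E}_\Omega}\{x:\langle u,x\rangle\ge h_\Omega(u)\}$, a rational-slope polygon containing $\Omega$. Boundary series: the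 closure of $\widehat\Omega\setminus\Omega^\circ$ is a finite union (3 to 6 pieces) of $\Gamma$-triangles, i.e. regions bounded by an arc $\Gamma\subset\partial\Omega$ and two straight segments of rational slopes whose primitive direction vectors form a basis of $\mathbb{Z}^2$ (the chord joining the endpoints of $\Gamma$ together with $\Gamma$ bounding a convex region). For each such piece, apply an element of $\mathrm{SL}(2,\mathbb{Z})$ and a translation so that its straight sides lie on the nonnegative coordinate axes and $\Gamma$ is the graph of a convex function $g:[0,r]\to[0,u]$ with $g(0)=u$, $g(r)=0$. For $(a,b)\in\mathbb{Z}^2_{\ge0}\setminus\{0\}$ let $\gamma_{a,b}=\min_{(x,y)\in\Gamma}(ax+by)$ (so $ax+by=\gamma_{a,b}$ is the supporting line of normal $(a,b)$), and for $a,b,c,d\in\mathbb{Z}_{\ge0}$ with $ad-bc=1$ set $f_\Gamma(a,b,c,d)=|\gamma_{a,b}+\gamma_{c,d}-\gamma_{a+c,b+d}|$. Define $F_\Gamma(s)=\sum_{a,b,c,d\ge0,\ ad-bc=1}f_\Gamma(a,b,c,d)^s$ and $F_{\partial\Omega}(s)=\sum_\Gamma F_\Gamma(s)$, the sum over the finitely many $\Gamma$-triangles forming $\widehat\Omega\setminus\Omega^\circ$. *)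

(* Defs.v *)
From HB Require Import structures.
From mathcomp Require Import all_boot all_order all_algebra.
From mathcomp Require Export complex.
From mathcomp Require Export all_classical all_reals all_analysis.

Set Implicit Arguments.
Unset Strict Implicit.
Unset Printing Implicit Defensive.

Import Order.TTheory GRing.Theory Num.Theory numFieldNormedType.Exports.

Local Open Scope classical_set_scope.
Local Open Scope ring_scope.
Local Open Scope complex_scope.

Section ComplexAnalysis.
Variable R : realType.

(* x ^ s for a real x >= 0 and complex s, namely
   exp (s ln x) = x ^ (Re s) (cos (Im s ln x) + i sin (Im s ln x)) for x > 0;
   by convention 0 ^ s = 0 (only used for Re s > 0). *)
Definition cpow (x : R) (s : R[i]) : R[i] :=
  if 0 < x
  then (x `^ complex.Re s)%:C *
       (cos (complex.Im s * ln x) +i* sin (complex.Im s * ln x))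
  else 0.

Definition holomorphic_at (f : R[i] -> R[i]) (s : R[i]) : Prop :=
  derivable (f : R[i]^o -> R[i]^o) s 1.

Definition cintegrable d (T : measurableType d)
    (mu : {measure set T -> \bar R}) (D : set T) (f : T -> R[i]) : Prop :=
  mu.-integrable D (fun x => (complex.Re (f x))%:E) /\
  mu.-integrable D (fun x => (complex.Im (f x))%:E).

Definition cintegral d (T : measurableType d)
    (mu : {measure set T -> \bar R}) (D : set T) (f : T -> R[i]) : R[i] :=
  (\int[mu]_(x in D) complex.Re (f x)) +i* (\int[mu]_(x in D) complex.Im (f x)).

Definition rsum (I : choiceType) (D : set I) (f : I -> R) : R :=
  fine (\esum_(i in D) (EFin \o f)^\+ i)%E -
  fine (\esum_(i in D) (EFin \o f)^\- i)%E.

Definition csummable (I : choiceType) (D : set I) (f : I -> R[i]) : Prop :=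
  summable D (fun i => (complex.Re (f i))%:E) /\
  summable D (fun i => (complex.Im (f i))%:E).

Definition csum (I : choiceType) (D : set I) (f : I -> R[i]) : R[i] :=
  rsum D (fun i => complex.Re (f i)) +i* rsum D (fun i => complex.Im (f i)).

End ComplexAnalysis.

(* R^o rather than R, so that the product carries its R-module structure. *)
Notation plane R := (R^o * R^o)%type.

Section TropicalDistance.
Variable R : realType.
Implicit Types (K : set (plane R)) (u : int * int) (x : plane R) (s : R[i]).

Definition pairing u x : R := u.1%:~R * x.1 + u.2%:~R * x.2.

(* The zero vector is excluded, since gcdz 0 0 = 0. *)
Definition primitive : set (int * int) := [set u | coprimez u.1 u.2].

(* The infimum is a minimum when K is compact and nonempty. *)
Definition support K u : R := inf [set pairing u x | x in K].

(* The infimum is a minimum at the interior points of a compact K. *)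
Definition rho K x : R :=
  if `[< K^° x >] then inf [set pairing u x - support K u | u in primitive] else 0.

Definition lebesgue_plane :
    {measure set (measurableTypeR R * measurableTypeR R)%type -> \bar R} :=
  (lebesgue_measure \x lebesgue_measure)%E.

Definition Z_convergent K s : Prop :=
  cintegrable lebesgue_plane K (fun x => cpow (rho K x) (s - 2)).

Definition Z K s : R[i] :=
  cintegral lebesgue_plane K (fun x => cpow (rho K x) (s - 2)).

Definition H K s : R[i] := s * (s - 1) * Z K s.

Definition rho_max K : R := sup [set rho K x | x in K].

Definition max_locus K : set (plane R) := [set x | K x /\ rho K x = rho_max K].

Definition extremal_normals K : set (int * int) :=
  [set u | primitive u /\
           exists2 x, max_locus K x & rho_max K = pairing u x - support K u].

Definition minimal_model K : set (plane R) :=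
  \bigcap_(u in extremal_normals K) [set x | support K u <= pairing u x].

Definition boundary K : set (plane R) := closure K `\` K^°.

End TropicalDistance.

Section GammaTriangles.
Variable R : realType.

(* A Gamma-triangle together with its normalization: the affine map
   x |-> A x + t puts the straight sides on the nonnegative coordinate axes
   and Gamma on the graph of g over [0, r]. *)
Record gamma_triangle := GammaTriangle {
  gt_A : 'M[int]_2;
  gt_t : plane R;
  gt_r : R;
  gt_u : R;
  gt_g : R -> R;
  gt_detA : \det gt_A = 1;
  gt_r_gt0 : 0 < gt_r;
  gt_u_gt0 : 0 < gt_u;
  gt_g_cont : {within `[0, gt_r], continuous gt_g};
  gt_g_convex : convex_function (`[0, gt_r]%classic : set R) gt_g;
  gt_g_range : forall x, x \in `[0, gt_r] -> gt_g x \in `[0, gt_u];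
  gt_g0 : gt_g 0 = gt_u;
  gt_gr : gt_g gt_r = 0 }.

Implicit Types (T : gamma_triangle) (s : R[i]).

Definition chart T (x : plane R) : plane R :=
  (pairing (gt_A T 0 0, gt_A T 0 1) x + (gt_t T).1,
   pairing (gt_A T 1 0, gt_A T 1 1) x + (gt_t T).2).

Definition normal_arc T : set (plane R) :=
  [set p | p.1 \in `[0, gt_r T] /\ p.2 = gt_g T p.1].

Definition normal_sides T : set (plane R) :=
  [set p | (p.1 \in `[0, gt_r T] /\ p.2 = 0) \/
           (p.1 = 0 /\ p.2 \in `[0, gt_u T])].

Definition normal_region T : set (plane R) :=
  [set p | p.1 \in `[0, gt_r T] /\ p.2 \in `[0, gt_g T p.1]].

Definition arc T : set (plane R) := chart T @^-1` normal_arc T.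
Definition sides T : set (plane R) := chart T @^-1` normal_sides T.
Definition region T : set (plane R) := chart T @^-1` normal_region T.

Definition gamma T (a b : nat) : R := support (normal_arc T) (a%:Z, b%:Z).

Definition f_Gamma T (a b c d : nat) : R :=
  `| gamma T a b + gamma T c d - gamma T (a + c)%N (b + d)%N |.

(* ad - bc = 1, without truncated subtraction. *)
Definition unimodular_quadruples : set (nat * nat * nat * nat) :=
  [set q | let: (a, b, c, d) := q in (a * d)%N = (b * c).+1].

Definition F_term T s (q : nat * nat * nat * nat) : R[i] :=
  let: (a, b, c, d) := q in cpow (f_Gamma T a b c d) s.

Definition F_convergent T s : Prop :=
  csummable unimodular_quadruples (F_term T s).

Definition F_Gamma T s : R[i] := csum unimodular_quadruples (F_term T s).

(* Cutting a Gamma-triangle through its corner along (1, 1) yields two smaller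
   regions that are again bounded by an arc of the boundary of Omega and two
   rational segments, but the sum of their series is different. The intended
   pieces are the corners cut off from the minimal model, so their straight
   sides are required to lie on its boundary; the family T is then unique up to
   order. The complement of Omega (not of its interior) is taken, so that
   common boundary segments of Omega and its minimal model are not covered. *)
Definition gamma_decomposition (Omega : set (plane R)) (n : nat)
    (T : 'I_n -> gamma_triangle) : Prop :=
  [/\ closure (minimal_model Omega `\` Omega) = \bigcup_i region (T i),
      forall i, arc (T i) `<=` boundary Omega,
      forall i, sides (T i) `<=` boundary (minimal_model Omega) &
      forall i j, i != j -> (region (T i))^° `&` (region (T j))^° = set0].

Definition F_boundary (n : nat) (T : 'I_n -> gamma_triangle) s : R[i] :=
  \sum_(i < n) F_Gamma (T i) s.

End GammaTriangles.

Definition H_form (R : realType) (m l : R) (k : int) (s : R[i]) : R[i] :=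
  cpow m (s - 1) * (2 * l%:C * s + k%:~R * m%:C).

(* Main.v *)
(* For an integer vector u write lam u x = <u,x> - h(u), a function sublinear in u.
   The tropical distance is the infimum of lam over the primitive vectors, and that
   of the minimal model is the minimum of lam over the finitely many extremal
   normals, the corners cut off by Omega being unimodular pairs of such normals.
   Below a corner, all primitive normals are reached by inserting mediants v + w in a
   binary tree of unimodular bases (v, w). Since f = lam v + lam w - lam (v + w) never
   exceeds the maximum m of the distance, at each point at most one branch of the
   tree is active; so for G vanishing on t <= 0 the sum, over the tree, of
     G(min(lam v, lam w)) - G(min(lam v, lam w, lam (v + w)))
   telescopes, pointwise, to G(distance of the model) - G(distance of Omega). In the
   coordinates (lam v, lam w) each term has integral int_0^f (f - t) G(t) dt, which is
   f^s / (s (s - 1)) for G(t) = t^(s - 2); dominated convergence gives the formula.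
   For the model itself, the set where an extremal normal e realizes the distance
   is fibred by lam e over [0, m], and the fibre at t has length A_e + n_e (m - t)
   with n_e an integer, because the two neighbours of e at the ends of its side of
   the maximum locus form unimodular bases with e. *)
Require Import Defs.
From mathcomp Require Import all_boot all_order all_algebra.
From mathcomp Require Import complex all_classical all_reals all_analysis.
From mathcomp Require Import measurable_realfun ring lra zify.
Import Order.TTheory GRing.Theory Num.Theory numFieldNormedType.Exports.
Local Open Scope classical_set_scope.
Local Open Scope ring_scope.
Local Open Scope complex_scope.
Set Implicit Arguments.
Unset Strict Implicit.
Unset Printing Implicit Defensive.

(** The level theorem is proved for every bounded continuous [G] vanishing on t <= 0, so powers
    enter only at the end, cut off at [rho_max K], a value that no distance and no gap of the tree
    exceeds. Complex exponents are reduced to the real functions Re (c t^w); letting c vary recovers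
    the complex identity. Two obstacles shape the rest. The infimum over all normals must be
    controlled where it is positive: Dirichlet approximation makes [lam] grow linearly in the norm
    of the normal, uniformly where the distance is at least a given t > 0, so only finitely many
    normals matter near a maximum point. And the model is never described as a polygon with
    cyclically ordered vertices: a Farkas alternative in the plane yields, for each direction, a
    vertex and two extremal normals there. That one branch at most is active rests on a maximum
    point p: lam u x >= m + <u, x - p> for nonzero u excludes small values in the cone opposite to
    an active one. Convergence of the series is an outcome: for the real exponent Re s its terms are
    nonnegative and the level sums converge, which gives absolute convergence at s. *)

Local Notation supp := Defs.support.
Local Notation garc := Defs.arc.

(** * Unimodular changes of variables *)

Section change_of_variables.
Variable R : realType.
Notation mu := (@lebesgue_measure R).
Notation mT := (measurableTypeR R).
Notation mu2 := (lebesgue_plane R).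
Local Open Scope ereal_scope.

Lemma lebesgue_measure_translation (c : R) (A : set mT) : measurable A ->
  mu ((fun x : mT => (x + c)%R : mT) @^-1` A) = mu A.
Proof.
have mc : measurable_fun setT (fun x : mT => (x + c)%R : mT).
  by apply: measurable_funD => //; exact: measurable_cst.
move=> mA.
have /(_ mc) H := @lebesgue_measure_unique R (pushforward mu (fun x : mT => (x + c)%R : mT)).
rewrite -[LHS]/(pushforward mu (fun x : mT => (x + c)%R : mT) A) -H// => _ [[a b] _ <-].
transitivity (mu `](a - c)%R, (b - c)%R]%classic); last first.
  by congr (mu _); apply/seteqP; split => x /=; rewrite !in_itv/= ltrBlDr lerBrDr.
by rewrite /= !lebesgue_measure_itv/= !lte_fin ltrD2r -!EFinB opprB addrA addrNK.
Qed.

Definition shear (k c : R) (z : mT * mT) : mT * mT := (z.1, (z.2 + k * z.1 + c)%R).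

Lemma measurable_shear k c : measurable_fun setT (shear k c).
Proof.
apply/measurable_fun_pair => /=; first exact: measurable_fst.
apply: measurable_funD => //.
by apply: measurable_funD => //; apply: measurable_funM => //.
Qed.

(** Vertical sections are only translated, by an amount constant on each of them. *)
Lemma plane_measure_shear k c (A : set (mT * mT)%type) : measurable A ->
  mu2 (shear k c @^-1` A) = mu2 A.
Proof.
move=> mA.
rewrite /lebesgue_plane /product_measure1.
apply: eq_integral => x _ /=.
rewrite -[RHS](lebesgue_measure_translation (k * x + c)); last exact: measurable_xsection.
by congr (mu _); apply/seteqP; split => y; rewrite /xsection /= !inE /shear/= addrA.
Qed.

Definition plane_swap (z : mT * mT) : mT * mT := (z.2, z.1).

Definition measure_invariant (phi : mT * mT -> mT * mT) :=
  measurable_fun setT phi /\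
  forall A, measurable A -> mu2 (phi @^-1` A) = mu2 A.

Lemma measure_invariant_comp phi psi : measure_invariant phi ->
  measure_invariant psi -> measure_invariant (psi \o phi).
Proof.
move=> [mphi ephi] [mpsi epsi]; split; first exact: measurableT_comp.
move=> A mA; rewrite comp_preimage ephi ?epsi//.
by rewrite -[_ @^-1` _]setTI; exact: mpsi.
Qed.

Lemma measure_invariant_shear k c : measure_invariant (shear k c).
Proof.
by split; [exact: measurable_shear|move=> A mA; exact: plane_measure_shear].
Qed.

Lemma measure_invariant_swap : measure_invariant plane_swap.
Proof.
have ms : measurable_fun setT plane_swap by apply/measurable_fun_pair.
split=> // A mA.
have /(_ ms) H := @product_measure_unique _ _ _ _ R mu mu (pushforward mu2 plane_swap).
rewrite [RHS]H// => X Y mX mY.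
transitivity (mu2 (Y `*` X)).
  by congr (mu2 _); apply/seteqP; split => -[x y] /= [].
by rewrite muleC; exact: product_measure1E.
Qed.

(** A matrix of determinant 1 with c <> 0 is a product of an upper, a lower and an upper shear. When
    c = 0, adding the first row to the second makes the lower left entry a <> 0, and a shear of
    slope -1 undoes the addition. *)
Lemma measure_invariant_affine (a b c d p q : R) : (a * d - b * c = 1)%R ->
  measure_invariant (fun z : mT * mT =>
    ((a * z.1 + b * z.2 + p)%R, (c * z.1 + d * z.2 + q)%R)).
Proof.
have upper k e : measure_invariant (plane_swap \o (shear k e \o plane_swap)).
  apply: measure_invariant_comp; last exact: measure_invariant_swap.
  apply: measure_invariant_comp; first exact: measure_invariant_swap.
  exact: measure_invariant_shear.
have main a' b' c' d' p' q' : (a' * d' - b' * c' = 1)%R -> c' != 0%R ->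
    measure_invariant (fun z : mT * mT =>
    ((a' * z.1 + b' * z.2 + p')%R, (c' * z.1 + d' * z.2 + q')%R)).
  move=> det c0.
  have := measure_invariant_comp (measure_invariant_comp (upper ((d' - 1) / c')%R 0%R)
    (measure_invariant_shear c' q')) (upper ((a' - 1) / c')%R (p' - (a' - 1) / c' * q')%R).
  congr measure_invariant; apply/funext => -[x y] /=; rewrite /shear /plane_swap /=.
  have -> : (b' = (a' * d' - 1) / c')%R by rewrite -det; field.
  by congr pair; field.
move=> det; have [c0|/(main _ _ _ _ _ _ det)//] := eqVneq c 0%R.
have a0 : a != 0%R.
  by apply/eqP => a0; move: det; rewrite a0 c0 mul0r mulr0 subr0 => /esym/eqP; rewrite oner_eq0.
have := measure_invariant_comp (@main a b (c + a)%R (d + b)%R p (q + p)%R _ _)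
  (measure_invariant_shear (-1) 0).
rewrite c0 add0r; rewrite c0 in det => /(_ _ a0) H.
have {}H := H ltac:(by rewrite -[RHS]det; ring); move: H.
by congr measure_invariant; apply/funext => -[x y] /=; rewrite /shear /=; congr pair; ring.
Qed.

(** No integrability is asked of [F]: applied to absolute values, the lemma also transfers
    integrability through [phi]. *)
Lemma integral_invariant phi (F : mT * mT -> \bar R) : measure_invariant phi ->
  measurable_fun setT F -> \int[mu2]_z F (phi z) = \int[mu2]_z F z.
Proof.
move=> [mphi ephi].
have ge0 (f : mT * mT -> \bar R) : measurable_fun setT f -> (forall z, 0 <= f z) ->
    \int[mu2]_z f (phi z) = \int[mu2]_z f z.
  move=> mf f0.
  have := @ge0_integral_pushforward _ _ _ _ R phi mphi mu2 setT f measurableT mf.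
  rewrite preimage_setT => /(_ (fun _ _ => f0 _))/esym H.
  rewrite [LHS]H; apply: eq_measure_integral => A mA _.
  by rewrite -ephi.
move=> mF; rewrite integralE [RHS]integralE.
rewrite -[X in _ = X - _](ge0 (F^\+) (measurable_funepos mF) (funepos_ge0 F)).
rewrite -[X in _ = _ - X](ge0 (F^\-) (measurable_funeneg mF) (funeneg_ge0 F)).
by congr (_ - _); apply: eq_integral => x _; rewrite ?funeposE ?funenegE.
Qed.

Lemma integral_translation c (F : mT -> \bar R) : measurable_fun setT F ->
  \int[mu]_x F (x + c)%R = \int[mu]_x F x.
Proof.
have mc : measurable_fun setT (fun x : mT => (x + c)%R : mT).
  by apply: measurable_funD => //; exact: measurable_cst.
have ge0 (f : mT -> \bar R) : measurable_fun setT f -> (forall z, 0 <= f z) ->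
    \int[mu]_z f (z + c)%R = \int[mu]_z f z.
  move=> mf f0.
  have := @ge0_integral_pushforward _ _ _ _ R _ mc mu setT f measurableT mf.
  rewrite preimage_setT => /(_ (fun _ _ => f0 _))/esym H.
  rewrite [LHS]H; apply: eq_measure_integral => A mA _.
  exact: (lebesgue_measure_translation c mA).
move=> mF; rewrite integralE [RHS]integralE.
rewrite -[X in _ = X - _](ge0 (F^\+) (measurable_funepos mF) (funepos_ge0 F)).
rewrite -[X in _ = _ - X](ge0 (F^\-) (measurable_funeneg mF) (funeneg_ge0 F)).
by congr (_ - _); apply: eq_integral => x _; rewrite ?funeposE ?funenegE.
Qed.

End change_of_variables.

Lemma integrable_patch d (T : measurableType d) (R : realType)
    (mu : {measure set T -> \bar R}) (A : set T) (f : T -> R) : measurable A ->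
  mu.-integrable A (EFin \o f) -> mu.-integrable setT (EFin \o (f \_ A)).
Proof. by move=> mA /(integrable_mkcond _ mA); rewrite restrict_EFin. Qed.

(** * The integral contributed by one node of the tree *)

Section corner_cut.
Variable R : realType.
Notation mu := (@lebesgue_measure R).
Notation mT := (measurableTypeR R).
Notation mu2 := (lebesgue_plane R).
Variable G : R -> R.
Hypothesis cG : continuous G.
Hypothesis G0 : forall t, t <= 0 -> G t = 0.

(* In the coordinates [z] given by two unimodular normals [v], [w] of gap [f], adding
   the normal [v + w] changes [G] of the minimum by this amount. *)
Definition corner_cut (f : R) (z : mT * mT) : R :=
  G (Num.min z.1 z.2) - G (Num.min (Num.min z.1 z.2) (z.1 + z.2 - f)).

(** If a coordinate is nonpositive, both minima are, and [G] vanishes there. If z.1 >= f, then z.1 +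
    z.2 - f >= z.2, so the third argument does not lower the minimum; likewise for z.2. *)
Lemma corner_cut_out f z : 0 <= f -> ~~ ((0 < z.1 < f) && (0 < z.2 < f)) ->
  corner_cut f z = 0.
Proof.
case: z => x y; rewrite /corner_cut /=.
have [x0|x0] := leP x 0.
  by move=> _ _; rewrite !G0 ?subrr// !ge_min x0 ?orbT.
have [y0|y0] := leP y 0.
  by move=> _ _; rewrite !G0 ?subrr// !ge_min y0 ?orbT.
move=> f0; rewrite /= negb_and -!leNgt => fxy.
rewrite [X in G X - _ = _](_ : _ = Num.min (Num.min x y) (x + y - f)) ?subrr//.
by apply/esym/min_l; rewrite ge_min; case/orP: fxy => ?; apply/orP; lra.
Qed.

Lemma measurable_corner_cut f : measurable_fun setT (corner_cut f).
Proof.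
have mG := continuous_measurable_fun cG.
have m1 : measurable_fun setT (fun z : mT * mT => Num.min z.1 z.2).
  exact: measurable_minr.
apply: measurable_funB; apply: (measurableT_comp mG) => //.
apply: measurable_minr => //; apply: measurable_funB => //.
by apply: measurable_funD.
Qed.

Lemma continuous_bounded_itv (a b : R) : exists C : R, 0 <= C /\
  forall x, a <= x <= b -> `|G x| <= C.
Proof.
have [ab|ba] := leP a b; last first.
  by exists 0; split => // x /andP[ax xb]; have := le_lt_trans (le_trans ax xb) ba; rewrite ltxx.
have cn : {within `[a, b], continuous (fun x => `|G x|)}.
  apply: continuous_subspaceT => x; apply: continuous_comp; first exact: cG.
  exact: norm_continuous.
have [c cab Hc] := EVT_max ab cn.
by exists `|G c|.
Qed.

Lemma integrable_corner_cut f : 0 <= f ->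
  mu2.-integrable setT (EFin \o corner_cut f).
Proof.
move=> f0.
(* On the square [0, f]^2 the argument z.1 + z.2 - f takes its values in [-f, f]. *)
have [C [C0 HC]] := continuous_bounded_itv (- f) f.
pose A : set (mT * mT) := `[0, f]%classic `*` `[0, f]%classic.
have mA : measurable A by apply: measurableX.
have -> : EFin \o corner_cut f = (EFin \o corner_cut f) \_ A.
  apply/funext => z; rewrite /= patchE; case: ifPn => // /negP zA.
  rewrite corner_cut_out//; apply/negP => /andP[/andP[a b] /andP[c d]]; apply: zA.
  by rewrite inE; split => /=; rewrite in_itv/= !ltW.
apply/(integrable_mkcond _ mA); apply: measurable_bounded_integrable => //.
- rewrite /A; rewrite (_ : mu2 _ = (mu `[0%R, f] * mu `[0%R, f])%E); last exact: product_measure1E.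
  by rewrite !lebesgue_measure_itv/= lte_fin; case: ifP => _; rewrite ?mul0e ?ltry// -EFinB -EFinM ltry.
- by apply: measurable_funTS; exact: measurable_corner_cut.
- exists (C + C); split; first exact: num_real.
  move=> M CM z [/= z1 z2]; apply: le_trans (ltW CM).
  rewrite !in_itv/= in z1 z2; case/andP: z1 => z10 z1f; case/andP: z2 => z20 z2f.
  apply: (le_trans (ler_normB _ _)); apply: lerD; apply: HC.
    by rewrite ge_min le_min; apply/andP; split; [apply/andP; split; lra|rewrite z1f].
  rewrite !le_min !ge_min z1f /= andbT; do ?[apply/andP; split]; lra.
Qed.

(** For x fixed in ]0, f[, the two terms are, as functions of y, the ramp y |-> G(min(x, y)) and its
    translate by f - x. On y <= f the ramp is the sum of [a], supported in [0, x], and of the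
    plateau [b]. By translation invariance the two copies of [a] cancel, and the plateau of height G
    x and length f - x remains. *)
Lemma integral_corner_cut f : 0 <= f ->
  (\int[mu2]_z (corner_cut f z)%:E =
   \int[mu]_(t in `[0%R, f]) ((f - t) * G t)%:E)%E.
Proof.
move=> f0; rewrite -(integral12_prod_meas1 (integrable_corner_cut f0)).
rewrite [RHS]integral_mkcond; apply: eq_integral => x _.
rewrite /fubini_F patchE.
have [/andP[x0 xf]|xf] := boolP (0 < x < f); last first.
  under eq_integral => y _.
    rewrite /= corner_cut_out//; last by rewrite negb_and xf.
    over.
  rewrite integral0; case: ifPn => //; rewrite inE/= in_itv/= => /andP[x0 xlf].
  move: xf; rewrite negb_and -!leNgt => /orP[x0'|x0'].
    by rewrite G0// mulr0.
  by have -> : x = f; [lra|rewrite subrr mul0r].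
pose a := G \_ `[0, x].
pose b := (cst (G x)) \_ `]x, f].
have ia : mu.-integrable setT (EFin \o a).
  apply: integrable_patch => //.
  apply: continuous_compact_integrable; first exact: segment_compact.
  exact: continuous_subspaceT.
have lenb : mu `]x, f]%classic = (f - x)%:E.
  by rewrite lebesgue_measure_itv/= lte_fin xf -EFinB.
have ib : mu.-integrable setT (EFin \o b).
  apply: integrable_patch => //.
  apply: measurable_bounded_integrable => //.
    by rewrite [X in (X < _)%E]lenb ltry.
  exact: bounded_cst.
have iac : mu.-integrable setT (EFin \o (fun y => a (y + (x - f)))).
  have /integrableP[ma fa] := ia; apply/integrableP; split.
    apply: (measurableT_comp ma); apply: measurable_funD => //; exact: measurable_cst.
  rewrite (integral_translation (x - f) (F := fun y => `|(a y)%:E|%E))//.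
  exact: measurableT_comp.
transitivity (\int[mu]_y ((a y + b y)%:E - (a (y + (x - f)))%:E))%E.
  apply: eq_integral => y _; rewrite -EFinB; congr EFin.
  rewrite /corner_cut /a /b !patchE !mem_setE /= !in_itv/=.
  have [y0|y0] := leP y 0.
    rewrite (min_r (_ : y <= x)); last by lra.
    rewrite (G0 y0) (G0 (t := Num.min _ _)); last by rewrite ge_min y0.
    have -> : (x < y <= f) = false by apply/negbTE/negP => /andP[? ?]; lra.
    have -> : (0 <= y + (x - f) <= x) = false by apply/negbTE/negP => /andP[? ?]; lra.
    by case: ifPn => _; rewrite ?(G0 y0) !addr0 ?subrr.
  (* [point] is the value of a restricted function off its set; in [R] it is 0. *)
  have aE : (if 0 <= y + (x - f) <= x then G (y + (x - f)) else point) =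
            (if y <= f then G (x + y - f) else 0).
    have [yf|yf] := leP y f; last first.
      by case: ifPn => // /andP[? ?]; lra.
    have -> : x + y - f = y + (x - f) by lra.
    case: ifPn => //; rewrite negb_and -!ltNge => /orP[?|?]; last by lra.
    by rewrite G0 1?ltW.
  rewrite aE; have [yx|xy] /= := leP y x.
    rewrite (ltW y0) /= addr0 (le_trans yx (ltW xf)).
    by rewrite (min_r (_ : x + y - f <= y))//; lra.
  rewrite andbF add0r; have [yf|fy] := leP y f.
    by rewrite (min_r (_ : x + y - f <= x))//; lra.
  by rewrite (min_l (_ : x <= x + y - f)) ?subrr//; lra.
have iab : mu.-integrable setT (EFin \o (a \+ b)) by exact: (integrableD measurableT ia ib).
rewrite (integralB_EFin measurableT iab iac).
rewrite (integral_translation (x - f) (F := fun y => (a y)%:E)); last by have /integrableP[] := ia.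
rewrite (integralD_EFin measurableT ia ib).
have /integrable_fin_num fia := ia.
rewrite addeAC subee ?add0e; last exact: (fia measurableT).
rewrite mem_set/= ?in_itv/= ?ltW//.
transitivity (\int[mu]_(y in `]x, f]) (G x)%:E)%E.
  rewrite [RHS]integral_mkcond; apply: eq_integral => y _.
  by rewrite /b !patchE; case: ifP.
by rewrite integral_cst// [X in (_ * X)%E]lenb -EFinM mulrC.
Qed.
End corner_cut.

(** * Integer normals and the tropical distance *)

Section plane_basics.
Variable R : realType.
Implicit Types (K : set (plane R)) (u v w : int * int) (x y z p d : plane R).

Definition rpairing (d x : plane R) : R := d.1 * x.1 + d.2 * x.2.

Definition vec u : plane R := (u.1%:~R, u.2%:~R).

Lemma pairingE u x : pairing u x = rpairing (vec u) x.
Proof. by []. Qed.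

Lemma continuous_rpairing d : continuous (rpairing d).
Proof.
move=> x; rewrite /continuous_at /rpairing.
by apply: (@cvgD _ R^o); apply: (@cvgM R); try exact: cvg_cst;
  [exact: cvg_fst|exact: cvg_snd].
Qed.

Lemma pairingD u v x : pairing (u + v) x = pairing u x + pairing v x.
Proof. by rewrite /pairing /= !rmorphD/=; ring. Qed.

Lemma pairingN u x : pairing (- u) x = - pairing u x.
Proof. by rewrite /pairing /= !rmorphN/=; ring. Qed.

Lemma pairingMn u n x : pairing (u *+ n) x = pairing u x *+ n.
Proof.
by elim: n => [|n IH]; [rewrite /pairing /= !mul0r addr0|rewrite !mulrS pairingD IH].
Qed.

Lemma pairing_sub u x y : pairing u (x - y) = pairing u x - pairing u y.
Proof. by rewrite /pairing /=; ring. Qed.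

Lemma compact_rpairing_min K d : compact K -> K !=set0 ->
  exists2 y, K y & forall x, K x -> rpairing d y <= rpairing d x.
Proof.
move=> cK K0.
have cf : {within K, continuous (rpairing d)}.
  by apply: continuous_subspaceT; exact: continuous_rpairing.
have [y yK ymin] := compact_EVT_min K0 cK cf.
by exists y; [exact: set_mem|move=> x Kx; apply: ymin; exact: mem_set].
Qed.

Lemma support_attained K u : compact K -> K !=set0 ->
  exists2 y, K y & supp K u = pairing u y.
Proof.
move=> cK K0; have [y Ky ymin] := compact_rpairing_min (vec u) cK K0.
exists y => //; apply/eqP; rewrite eq_le; apply/andP; split.
  apply: ge_inf; last by exists y.
  by exists (pairing u y) => _ [x Kx <-]; exact: ymin.
apply: lb_le_inf; first by exists (pairing u y), y.
by move=> _ [x Kx <-]; exact: ymin.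
Qed.

Lemma support_le K u x : compact K -> K x -> supp K u <= pairing u x.
Proof.
move=> cK Kx; have [y Ky ymin] := compact_rpairing_min (vec u) cK (ex_intro _ x Kx).
apply: ge_inf; last by exists x.
by exists (pairing u y) => _ [z Kz <-]; exact: ymin.
Qed.

Definition lam K u x : R := pairing u x - supp K u.

Lemma lamD K u v x : compact K -> K !=set0 ->
  lam K (u + v) x <= lam K u x + lam K v x.
Proof.
move=> cK K0; have [y Ky yE] := support_attained (u + v) cK K0.
rewrite /lam yE !pairingD; have := support_le u cK Ky; have := support_le v cK Ky.
lra.
Qed.

Lemma lam0 K x : compact K -> K !=set0 -> lam K 0 x = 0.
Proof.
move=> cK K0; have [y Ky yE] := support_attained 0 cK K0.
by rewrite /lam yE /pairing /= !mul0r !addr0 subrr.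
Qed.

Lemma lamMn K u n x : compact K -> K !=set0 -> lam K (u *+ n) x = lam K u x *+ n.
Proof.
move=> cK K0; have [y Ky yE] := support_attained (u *+ n) cK K0.
have [z Kz zE] := support_attained u cK K0.
have suppE : supp K (u *+ n) = supp K u *+ n.
  apply/eqP; rewrite eq_le; apply/andP; split.
    by rewrite zE -pairingMn; exact: support_le.
  by rewrite yE pairingMn lerMn2r support_le ?orbT.
by rewrite /lam suppE pairingMn mulrnBl.
Qed.

Lemma lam_shift K u x y : lam K u y = lam K u x + pairing u (y - x).
Proof. by rewrite /lam pairing_sub; ring. Qed.

Lemma lam_ge0 K u x : compact K -> K x -> 0 <= lam K u x.
Proof. by move=> cK Kx; rewrite subr_ge0; exact: support_le. Qed.

Lemma convex_setE K x y t : convex_set K -> K x -> K y -> 0 <= t <= 1 ->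
  K (((1 - t) * x.1 + t * y.1, (1 - t) * x.2 + t * y.2) : plane R).
Proof.
move=> cK Kx Ky /andP[t0 t1].
have i01 : Itv.spec (@Itv.num_sem R) (Itv.Real `[0%Z, 1%Z]) t.
  by rewrite /= /Itv.num_sem num_real /= in_itv/= t0 t1.
have := cK y x (Itv.mk i01) (mem_set Ky) (mem_set Kx).
move=> /set_mem; congr K.
by apply: injective_projections; rewrite /= addrC.
Qed.

Lemma interiorP K x : K^° x <->
  exists2 r : R, 0 < r & forall y, `|y.1 - x.1| < r -> `|y.2 - x.2| < r -> K y.
Proof.
split.
  move=> /nbhs_ballP[r r0 Hr]; exists r => // y y1 y2; apply: Hr.
  by split; rewrite /ball /= distrC.
move=> [r r0 Hr]; apply/nbhs_ballP; exists r => //= y [].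
by rewrite /ball /= => y1 y2; apply: Hr; rewrite distrC.
Qed.

Lemma compact_coord_bound K : compact K -> K !=set0 ->
  exists2 B : R, 0 < B & forall x y, K x -> K y ->
    `|x.1 - y.1| <= B /\ `|x.2 - y.2| <= B.
Proof.
move=> cK K0.
have H d : exists m : R, forall x, K x -> m <= rpairing d x.
  by have [y _ Hy] := compact_rpairing_min d cK K0; exists (rpairing d y).
have [a Ha] := H ((1, 0) : plane R); have [a' Ha'] := H ((-1, 0) : plane R).
have [b Hb] := H ((0, 1) : plane R); have [b' Hb'] := H ((0, -1) : plane R).
have [z Kz] := K0.
have sub x : K x -> [/\ a <= x.1, a' <= - x.1, b <= x.2 & b' <= - x.2].
  move=> Kx; move: (Ha _ Kx) (Ha' _ Kx) (Hb _ Kx) (Hb' _ Kx).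
  by rewrite /rpairing /= !mul1r !mul0r !mulN1r !addr0 !add0r.
exists (1 + `|a| + `|a'| + `|b| + `|b'|) => [|x y Kx Ky].
  by rewrite -!addrA ltr_pwDl// !addr_ge0.
have [x1 x2 x3 x4] := sub _ Kx; have [y1 y2 y3 y4] := sub _ Ky.
have ln (e : R) : - `|e| <= e by rewrite lerNl -normrN ler_norm.
have na := ln a; have na' := ln a'; have nb := ln b; have nb' := ln b'.
have := normr_ge0 a; have := normr_ge0 a'; have := normr_ge0 b; have := normr_ge0 b'.
by move=> *; split; rewrite ler_norml; apply/andP; split; lra.
Qed.

Definition norm1 (d : plane R) : R := `|d.1| + `|d.2|.

Lemma norm1_ge0 d : 0 <= norm1 d.
Proof. by rewrite addr_ge0. Qed.

Lemma rpairing_norm1 d x B : `|x.1| <= B -> `|x.2| <= B ->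
  `|rpairing d x| <= norm1 d * B.
Proof.
move=> x1 x2; rewrite /rpairing /norm1 (le_trans (ler_normD _ _))// !normrM mulrDl.
by apply: lerD; apply: ler_wpM2l.
Qed.

(** The Euclidean distance is written out because the norm of the product is the maximum norm, whose
    nearest points y need not give a separating direction y - x. *)
Lemma sqr_dist_min K x : compact K -> K !=set0 ->
  exists2 y, K y & forall z, K z ->
    (y.1 - x.1) ^+ 2 + (y.2 - x.2) ^+ 2 <= (z.1 - x.1) ^+ 2 + (z.2 - x.2) ^+ 2.
Proof.
move=> cK K0; pose f z : R := (z.1 - x.1) ^+ 2 + (z.2 - x.2) ^+ 2.
have cf : {within K, continuous f}.
  apply: continuous_subspaceT => z; rewrite /continuous_at /f !expr2.
  have c1 : (fun z : plane R => z.1 - x.1) @ z --> z.1 - x.1.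
    by apply: (@cvgB _ R^o); [exact: cvg_fst|exact: cvg_cst].
  have c2 : (fun z : plane R => z.2 - x.2) @ z --> z.2 - x.2.
    by apply: (@cvgB _ R^o); [exact: cvg_snd|exact: cvg_cst].
  by apply: (@cvgD _ R^o); exact: (@cvgM R).
have [y yK ymin] := compact_EVT_min K0 cK cf.
by exists y; [exact: set_mem|move=> z Kz; apply: ymin; exact: mem_set].
Qed.

Lemma floor_dist (a : R) : `|a - (Num.floor a)%:~R| <= 1.
Proof.
have /andP[] := floor_itv a; rewrite intrD => ? ?.
by rewrite ler_norml; apply/andP; split; lra.
Qed.

(* The nearest point of [K] gives a real separating functional, which is then
   rounded to an integer one after scaling. *)
Lemma integer_separation K x : compact K -> convex_set K -> K !=set0 -> ~ K x ->
  exists u, lam K u x < 0.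
Proof.
move=> cK vK K0 nKx.
have [y Ky ymin] := sqr_dist_min x cK K0.
set d : plane R := y - x.
pose D := d.1 ^+ 2 + d.2 ^+ 2.
have D0 : 0 < D.
  rewrite lt_neqAle addr_ge0 ?sqr_ge0// andbT eq_sym; apply/negP.
  rewrite paddr_eq0 ?sqr_ge0// !sqrf_eq0 !subr_eq0 => /andP[/eqP e1 /eqP e2].
  by apply: nKx; rewrite (_ : x = y)//; apply: injective_projections.
have sep z : K z -> D <= rpairing d (z - x).
  move=> Kz; suff h : 0 <= rpairing d (z - y).
    rewrite (_ : rpairing d (z - x) = rpairing d (z - y) + D) ?lerDr//.
    by rewrite /rpairing /D /d /=; ring.
  rewrite leNgt; apply/negP => h.
  set p := rpairing d (z - y) in h.
  pose q := (z.1 - y.1) ^+ 2 + (z.2 - y.2) ^+ 2.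
  have q0 : 0 <= q by rewrite addr_ge0 ?sqr_ge0.
  (* Going from y towards z by t changes the squared distance by t (2 p + t q). This t satisfies t q
     = - p + t p, so the bracket is p + t p < 0. *)
  pose t := - p / (- p + q).
  have pq : 0 < - p + q by lra.
  have t0 : 0 < t by rewrite divr_gt0//; lra.
  have t1 : t <= 1 by rewrite ler_pdivrMr// mul1r; lra.
  have := ymin _ (@convex_setE K y z t vK Ky Kz _).
  rewrite (ltW t0) t1 /= => /(_ isT).
  have -> : ((1 - t) * y.1 + t * z.1 - x.1) ^+ 2 + ((1 - t) * y.2 + t * z.2 - x.2) ^+ 2 =
     (y.1 - x.1) ^+ 2 + (y.2 - x.2) ^+ 2 + t * (2 * p + t * q).
    by rewrite /p /q /rpairing /d /=; ring.
  have tq : t * (- p + q) = - p by rewrite /t divfK// gt_eqF.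
  suff : t * (2 * p + t * q) < 0 by lra.
  rewrite pmulr_rlt0//.
  have -> : t * q = - p + t * p by rewrite -[X in X + _]tq; ring.
  nra.
have [B B0 HB] := compact_coord_bound cK K0.
have [B' B'0 HB'] : exists2 B' : R, 0 < B' & forall z, K z ->
    `|z.1 - x.1| <= B' /\ `|z.2 - x.2| <= B'.
  exists (B + `|d.1| + `|d.2|) => [|z Kz].
    by rewrite -addrA ltr_pwDl// addr_ge0.
  have [h1 h2] := HB _ _ Kz Ky.
  have -> : z.1 - x.1 = (z.1 - y.1) + d.1 by rewrite /d /=; ring.
  have -> : z.2 - x.2 = (z.2 - y.2) + d.2 by rewrite /d /=; ring.
  have := normr_ge0 d.1; have := normr_ge0 d.2.
  by split; apply: (le_trans (ler_normD _ _)); lra.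
(* Rounding the coordinates of n d changes the pairing with x - z by at most 2 B', less than the
   gain n D. *)
pose n := Num.bound (2 * B' / D).
have nD : 2 * B' < n%:R * D.
  rewrite -ltr_pdivrMr//; apply: archi_boundP.
  by rewrite divr_ge0// ?mulr_ge0// ltW.
pose u : int * int := (Num.floor (n%:R * d.1), Num.floor (n%:R * d.2)).
exists u; have [z Kz zE] := support_attained u cK K0.
rewrite /lam zE -pairing_sub.
have [h1 h2] := HB' _ Kz; have h := sep _ Kz.
have f1 : `|n%:R * d.1 - u.1%:~R| <= 1.
  exact: floor_dist.
have f2 : `|n%:R * d.2 - u.2%:~R| <= 1 by exact: floor_dist.
have -> : pairing u (x - z) = - n%:R * rpairing d (z - x) +
  ((n%:R * d.1 - u.1%:~R) * (z.1 - x.1) + (n%:R * d.2 - u.2%:~R) * (z.2 - x.2)).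
  by rewrite /pairing /rpairing /=; ring.
have e1 : (n%:R * d.1 - u.1%:~R) * (z.1 - x.1) <= B'.
  rewrite (le_trans (ler_norm _))// normrM -[leRHS]mul1r.
  by apply: ler_pM.
have e2 : (n%:R * d.2 - u.2%:~R) * (z.2 - x.2) <= B'.
  rewrite (le_trans (ler_norm _))// normrM -[leRHS]mul1r.
  by apply: ler_pM.
have : n%:R * D <= n%:R * rpairing d (z - x) by apply: ler_wpM2l.
lra.
Qed.

Lemma lam_ge0_mem K x : compact K -> convex_set K -> K !=set0 ->
  (forall u, 0 <= lam K u x) -> K x.
Proof.
move=> cK vK K0 H; apply: contrapT => /(integer_separation cK vK K0)[u].
by rewrite ltNge H.
Qed.

Lemma pair_mulrn u n : u *+ n = (u.1 *+ n, u.2 *+ n).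
Proof. by elim: n => [//|n IH]; rewrite !mulrS IH. Qed.

Lemma primitive_multiple u : u != 0 ->
  exists (p : int * int) n, primitive p /\ u = p *+ n.+1.
Proof.
case: u => a b; have [->|a0] := eqVneq a 0.
  move=> b0; have {}b0 : b != 0 by apply: contraNneq b0 => ->.
  exists (0, sgz b), `|b|.-1%N; rewrite prednK ?absz_gt0//; split.
    by rewrite /primitive /= /coprimez gcd0z; move: b0; rewrite -sgz_eq0; case: sgzP.
  rewrite pair_mulrn /= mul0rn; congr pair.
  by rewrite -mulr_natr mulrC natz abszEsg mulrC mulrA -expr2 sqr_sg b0 mul1r.
move=> _; pose g := gcdn `|a| `|b|.
have g0 : (0 < g)%N by rewrite gcdn_gt0 absz_gt0 a0.
have /dvdzP[a' a'E] : (g%:Z %| a)%Z by rewrite /dvdz /=; exact: dvdn_gcdl.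
have /dvdzP[b' b'E] : (g%:Z %| b)%Z by rewrite /dvdz /=; exact: dvdn_gcdr.
exists (a', b'), g.-1; rewrite prednK//; split.
  rewrite /primitive /= /coprimez /gcdz.
  have : (g = gcdn `|a'| `|b'| * g)%N.
    by rewrite {1}/g a'E b'E !abszM /= muln_gcdl.
  by rewrite -{1}[g]mul1n => /eqP; rewrite eqn_pmul2r// => /eqP <-.
by rewrite pair_mulrn /= -(mulr_natr a') -(mulr_natr b') natz; congr pair.
Qed.

Lemma primitive_neq0 u : primitive u -> u != 0.
Proof. by move=> pu; apply/eqP => u0; move: pu; rewrite u0. Qed.

Lemma lam_ge_nonzero K x t : compact K -> K !=set0 -> 0 <= t ->
  (forall u, primitive u -> t <= lam K u x) -> forall u, u != 0 -> t <= lam K u x.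
Proof.
move=> cK K0 t0 H u /primitive_multiple[p [n [/H tp ->]]].
rewrite lamMn// mulrS (le_trans tp)// lerDl mulrn_wge0//.
exact: le_trans tp.
Qed.

(** Moving from x by r / 2 against the signs of u stays in K and lowers the pairing by r / 2 times
    the norm of u. Together with [lam_ge_interior] it characterizes the interior by linear growth of
    [lam] in the normal. *)
Lemma interior_lam_ge K x : compact K -> K^° x ->
  exists2 r : R, 0 < r & forall u, r * norm1 (vec u) <= lam K u x.
Proof.
move=> cK /interiorP[r r0 Hr]; exists (r / 2); first by rewrite divr_gt0.
move=> u; pose y : plane R := (x.1 - r / 2 * Num.sg (u.1%:~R), x.2 - r / 2 * Num.sg (u.2%:~R)).
have sgb (c : R) : `|r / 2 * Num.sg c| < r.
  rewrite normrM gtr0_norm ?divr_gt0// (@le_lt_trans _ _ (r / 2))//; last by lra.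
  apply: ler_piMr; first by rewrite divr_ge0// ltW.
  by rewrite normr_sg; case: (_ != _).
have Ky : K y by apply: Hr; rewrite /y /= addrC addKr normrN.
have := support_le u cK Ky.
have -> : pairing u y = pairing u x - r / 2 * norm1 (vec u).
  by rewrite /pairing /norm1 /y /= !normrEsg; ring.
rewrite /lam; lra.
Qed.

Lemma lam_ge_interior K x r : compact K -> convex_set K -> K !=set0 -> 0 < r ->
  (forall u, r * norm1 (vec u) <= lam K u x) -> K^° x.
Proof.
move=> cK vK K0 r0 H; apply/interiorP; exists r => // y y1 y2.
apply: lam_ge0_mem => // u; rewrite (lam_shift K u x y).
have := @rpairing_norm1 (vec u) (y - x) r (ltW y1) (ltW y2).
rewrite -pairingE ler_norml => /andP[h _]; have := H u; lra.
Qed.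

(** Pigeonhole: the fractional parts of the N + 1 multiples i k, 0 <= i <= N, fall into N boxes of
    length 1 / N. *)
Lemma dirichlet_approximation (k : R) N : (0 < N)%N ->
  exists (q : nat) (p : int), (0 < q <= N)%N /\ `|q%:R * k - p%:~R| <= N%:R^-1.
Proof.
move=> N0.
pose fr (i : nat) : R := i%:R * k - (Num.floor (i%:R * k))%:~R.
have fr01 i : 0 <= fr i < 1.
  have := floor_itv (i%:R * k); rewrite intrD /fr => /andP[? ?].
  by apply/andP; split; lra.
pose h (i : nat) := Num.truncn (N%:R * fr i).
have hb i : (h i)%:R <= N%:R * fr i < (h i).+1%:R.
  by apply: truncn_itv; rewrite mulr_ge0//; have /andP[] := fr01 i.
have hN i : (h i < N)%N.
  have /andP[h1 _] := hb i; have /andP[_ f1] := fr01 i.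
  rewrite -(ltr_nat R) (le_lt_trans h1)// gtr_pMr ?ltr0n//.
pose hh (i : 'I_N.+1) : 'I_N := Ordinal (hN i).
have : ~~ injectiveb hh.
  apply/negP => /injectiveP /leq_card; rewrite !card_ord ltnn//.
move=> /injectivePn[i [j ij hij]].
wlog lij : i j ij hij / (i < j)%N.
  move=> W; have [/W|lji] := ltnP i j; first exact.
  apply: (W j i); rewrite 1?eq_sym// ltn_neqAle lji andbT.
  by apply: contra ij => /eqP ji; apply/eqP/val_inj.
exists (j - i)%N, (Num.floor (j%:R * k) - Num.floor (i%:R * k)); split.
  by rewrite subn_gt0 lij /= (leq_trans (leq_subr _ _))// -ltnS.
have hE : h i = h j by have := congr1 val hij.
have -> : (j - i)%:R * k - (Num.floor (j%:R * k) - Num.floor (i%:R * k))%:~R = fr j - fr i.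
  by rewrite natrB 1?ltnW// intrB /fr; ring.
have /andP[a1 a2] := hb i; have /andP[b1 b2] := hb j.
rewrite hE in a1 a2; rewrite -natr1 in a2 b2.
have Np : (0 : R) < N%:R by rewrite ltr0n.
rewrite -[N%:R^-1]mul1r ler_pdivlMr// -(gtr0_norm Np) -normrM ler_norml.
by apply/andP; split; nra.
Qed.

(** Dirichlet's theorem for the slope u.2 / u.1, with |u.2| <= |u.1| by symmetry: w is (q, p) times
    the sign of u.1 and t = q / |u.1|, which makes the first coordinate exact. *)
Lemma lattice_approximation u N : u != 0 -> (0 < N)%N ->
  exists (w : int * int) (t : R), [/\ w != 0, 0 <= t, t * norm1 (vec u) <= 2 * N%:R,
    `|w.1%:~R - t * u.1%:~R| <= N%:R^-1 & `|w.2%:~R - t * u.2%:~R| <= N%:R^-1].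
Proof.
move=> u0 N0.
wlog u12 : u u0 / `|u.2%:~R : R| <= `|u.1%:~R|.
  move=> W; have [/(W u u0)//|/ltW u21] := leP `|u.2%:~R : R| `|u.1%:~R|.
  have u'0 : ((u.2, u.1) : int * int) != 0.
    by apply: contra u0 => /eqP[e1 e2]; apply/eqP; apply: injective_projections.
  have [w [t [w0 t0 t1 t2 t3]]] := W (u.2, u.1) u'0 u21.
  exists (w.2, w.1), t; split => //.
    by apply: contra w0 => /eqP[e1 e2]; apply/eqP; apply: injective_projections.
  by rewrite /norm1 /= addrC.
have a0 : u.1 != 0.
  apply: contra u0 => /eqP e1; move: u12; rewrite e1 normr0 normr_le0 intr_eq0 => /eqP e2.
  by apply/eqP; apply: injective_projections.
have na0 : 0 < `|u.1%:~R : R| by rewrite normr_gt0 intr_eq0.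
have [q [p [/andP[q0 qN] qp]]] := dirichlet_approximation (u.2%:~R / u.1%:~R) N0.
have s1 : `|u.1%:~R : R| = (sgz u.1)%:~R * u.1%:~R.
  by rewrite -intr_norm -intrM; congr (_%:~R); case: sgzP => *; lia.
have ss : (sgz u.1)%:~R * (sgz u.1)%:~R = 1 :> R.
  by rewrite -intrM -expr2 sqr_sg a0.
have ns : `|(sgz u.1)%:~R : R| = 1.
  by rewrite -intr_norm; move: a0; case: sgzP => // *; rewrite ?normrN1 ?normr1.
exists (sgz u.1 * q%:Z, sgz u.1 * p), (q%:R / `|u.1%:~R|); split.
- apply/eqP => -[/eqP]; rewrite mulf_eq0 sgz_eq0 (negbTE a0) /= => /eqP[q0'] _.
  by rewrite q0' in q0.
- by rewrite divr_ge0.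
- rewrite /norm1 /= mulrAC ler_pdivrMr// mulrAC.
  have qN' : (q%:R : R) <= N%:R by rewrite ler_nat.
  have q0' : 0 <= (q%:R : R) by [].
  nra.
- rewrite /= rmorphM /= s1.
  rewrite (_ : _ - _ = 0) ?normr0 ?invr_ge0//.
  have -> : q%:R / ((sgz u.1)%:~R * u.1%:~R) * u.1%:~R = q%:R * (sgz u.1)%:~R * ((sgz u.1)%:~R * (sgz u.1)%:~R)^-1 :> R.
    by field; rewrite !intr_eq0 sgz_eq0 a0.
  by rewrite ss invr1 mulr1 mulrC -pmulrn subrr.
- rewrite /= rmorphM /= s1.
  rewrite (_ : _ - _ = (sgz u.1)%:~R * (- (q%:R * (u.2%:~R / u.1%:~R) - p%:~R))).
    by rewrite normrM ns mul1r normrN.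
  have -> : q%:R / ((sgz u.1)%:~R * u.1%:~R) * u.2%:~R = q%:R * (u.2%:~R / u.1%:~R) * (sgz u.1)%:~R * ((sgz u.1)%:~R * (sgz u.1)%:~R)^-1 :> R.
    by field; rewrite !intr_eq0 sgz_eq0 a0.
  by rewrite ss invr1; ring.
Qed.

(* By Dirichlet's theorem, a direction in which [lam K] is small relative to the
   norm is close to a short lattice vector, where [lam K] would be below [t]. *)
Lemma lam_ge_norm1 K t : compact K -> convex_set K -> K !=set0 -> 0 < t ->
  exists2 r : R, 0 < r & forall x, (forall u, primitive u -> t <= lam K u x) ->
    forall u, r * norm1 (vec u) <= lam K u x.
Proof.
move=> cK vK K0 t0; have [B B0 HB] := compact_coord_bound cK K0.
(* With this N each coordinate error contributes at most B / N < t / 4, and the rate t / (4 N) on a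
   multiple of norm at most 2 N contributes at most t / 2: less than t in total. *)
pose N := (Num.bound (4 * B / t)).+1.
have N0 : (0 < N)%N by [].
have Np : (0 : R) < N%:R by rewrite ltr0n.
have NB : 4 * B < N%:R * t.
  rewrite -ltr_pdivrMr// (lt_trans (archi_boundP _)) ?ltr_nat//.
  by rewrite divr_ge0// ?mulr_ge0// ltW.
exists (t / (4 * N%:R)); first by rewrite divr_gt0// mulr_gt0.
move=> x /(lam_ge_nonzero cK K0 (ltW t0)) H u.
have [->|u0] := eqVneq u 0.
  by rewrite lam0// /norm1 /= normr0 addr0 mulr0.
have Kx : K x.
  apply: lam_ge0_mem => // v; have [->|v0] := eqVneq v 0; first by rewrite lam0.
  exact: le_trans (ltW t0) (H v v0).
rewrite leNgt; apply/negP => hu.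
have [w [c [w0 c0 cN e1 e2]]] := lattice_approximation u0 N0.
have [y Ky yE] := support_attained w cK K0.
have := H w w0; apply/negP; rewrite -ltNge /lam yE -pairing_sub.
have -> : pairing w (x - y) = c * pairing u (x - y) +
   ((w.1%:~R - c * u.1%:~R) * (x.1 - y.1) + (w.2%:~R - c * u.2%:~R) * (x.2 - y.2)).
  by rewrite /pairing /=; ring.
have [B1 B2] := HB _ _ Kx Ky.
have f1 : (w.1%:~R - c * u.1%:~R) * (x.1 - y.1) <= N%:R^-1 * B.
  by rewrite (le_trans (ler_norm _))// normrM; apply: ler_pM.
have f2 : (w.2%:~R - c * u.2%:~R) * (x.2 - y.2) <= N%:R^-1 * B.
  by rewrite (le_trans (ler_norm _))// normrM; apply: ler_pM.
have f3 : c * pairing u (x - y) <= t / 2.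
  apply: (@le_trans _ _ (c * lam K u x)).
    by apply: ler_wpM2l => //; rewrite /lam pairing_sub lerD2l lerN2; exact: support_le.
  apply: (@le_trans _ _ (c * (t / (4 * N%:R) * norm1 (vec u)))).
    by apply: ler_wpM2l => //; exact: ltW.
  rewrite mulrCA (_ : t / 2 = t / (4 * N%:R) * (2 * N%:R)); last by field; rewrite gt_eqF.
  by apply: ler_wpM2l => //; rewrite divr_ge0 ?ltW// mulr_gt0.
have f4 : N%:R^-1 * B < t / 4.
  by rewrite mulrC ltr_pdivrMr//; lra.
lra.
Qed.

Lemma primitive_e1 : primitive (1, 0).
Proof. by []. Qed.

Lemma rho_out K x : ~ K^° x -> rho K x = 0.
Proof. by rewrite /rho; case: asboolP. Qed.

Lemma rho_in K x : K^° x -> rho K x = inf [set lam K u x | u in primitive].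
Proof. by rewrite /rho; case: asboolP. Qed.

Lemma rho_ge0 K x : compact K -> 0 <= rho K x.
Proof.
move=> cK; have [Kx|/rho_out->//] := pselect (K^° x).
rewrite rho_in//; apply: lb_le_inf; first by exists (lam K (1, 0) x), (1, 0).
move=> _ [u _ <-]; apply: lam_ge0 => //; exact: interior_subset Kx.
Qed.

Lemma rho_le_lam K x u : compact K -> primitive u -> K x -> rho K x <= lam K u x.
Proof.
move=> cK pu Kx; have [iKx|/rho_out->] := pselect (K^° x); last exact: lam_ge0.
rewrite rho_in//; apply: ge_inf; last by exists u.
by exists 0 => _ [v _ <-]; exact: lam_ge0.
Qed.

Lemma rho_gt0_int K x : compact K -> 0 < rho K x -> K^° x.
Proof. by move=> cK; apply: contraPP => /rho_out ->; rewrite ltxx. Qed.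

Lemma le_rho K x t : compact K -> convex_set K -> K !=set0 -> 0 <= t ->
  (forall u, primitive u -> t <= lam K u x) -> t <= rho K x.
Proof.
move=> cK vK K0; rewrite le_eqVlt => /predU1P[<- _|t0 H]; first exact: rho_ge0.
have [r r0 /(_ _ H) Hr] := lam_ge_norm1 cK vK K0 t0.
rewrite rho_in; last exact: (lam_ge_interior cK vK K0 r0).
apply: lb_le_inf; first by exists (lam K (1, 0) x), (1, 0).
by move=> _ [u pu <-]; exact: H.
Qed.

Lemma rho_adherent K x e : compact K -> convex_set K -> K !=set0 -> 0 < e ->
  exists2 u, primitive u & lam K u x < rho K x + e.
Proof.
move=> cK vK K0 e0; apply: contrapT => H.
have : rho K x + e <= rho K x; last by rewrite gerDl leNgt e0.
apply: le_rho => //; first by rewrite addr_ge0 ?rho_ge0// ltW.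
move=> u pu; rewrite leNgt; apply/negP => h; apply: H; by exists u.
Qed.

Lemma rho_interior K x : compact K -> convex_set K -> K^° x -> 0 < rho K x.
Proof.
move=> cK vK Kx; have [r r0 Hr] := interior_lam_ge cK Kx.
have K0 : K !=set0 by exists x; exact: interior_subset.
apply: (lt_le_trans r0); apply: le_rho => //; first exact: ltW.
move=> u /primitive_neq0 u0; apply: le_trans (Hr u); rewrite ler_pMr//.
rewrite /norm1 /vec /= -!intr_norm -intrD -[1]/(1%:~R) ler_int.
have [u1|u1] := eqVneq u.1 0; last by rewrite ler_wpDr//; move: u1; lia.
have : u.2 != 0 by apply: contra u0 => /eqP u2; apply/eqP/injective_projections.
by rewrite u1; lia.
Qed.

End plane_basics.

(** * Maximum locus, extremal normals and minimal model *)

Section lattice_boxes.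
Variable R : realType.

Definition lattice_box (n : nat) : seq (int * int) :=
  [seq (i%:Z - n%:Z, j%:Z - n%:Z) | i <- iota 0 n.*2.+1, j <- iota 0 n.*2.+1].

Lemma mem_lattice_box n (u : int * int) :
  norm1 (vec R u) <= n%:R -> u \in lattice_box n.
Proof.
rewrite /norm1 /vec /= -!intr_norm -intrD -[n%:R]/(n%:Z%:~R) ler_int.
case: u => a b /= H; apply/allpairsP.
exists (absz (a + n%:Z), absz (b + n%:Z)).
by split; rewrite ?mem_iota /= ?add0n; [lia|lia|congr pair; lia].
Qed.

Lemma exists_pos_lower_bound (T : eqType) (s : seq T) (g : T -> R) :
  (forall i, i \in s -> 0 < g i) ->
  exists2 e : R, 0 < e & forall i, i \in s -> e <= g i.
Proof.
elim: s => [_|i s IH H]; first by exists 1.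
have [|e e0 He] := IH; first by move=> j js; apply: H; rewrite inE js orbT.
exists (Num.min e (g i)); first by rewrite lt_min e0 H ?mem_head.
move=> j; rewrite inE ge_min => /predU1P[->|/He->//].
by rewrite lexx orbT.
Qed.

Definition detz (u v : int * int) : int := u.1 * v.2 - u.2 * v.1.

Lemma int_mul_eq1 (x y : int) : y * x = 1 -> x = 1 \/ x = -1.
Proof.
move=> yx; have /eqP : (absz y * absz x)%N = 1%N by rewrite -abszM yx.
by rewrite muln_eq1 => /andP[_ /eqP]; lia.
Qed.

(** By Gauss's lemma corresponding coordinates divide each other, so they agree up to sign; the
    vanishing determinant makes the two signs agree. *)
Lemma primitive_parallel (u v : int * int) : primitive u -> primitive v ->
  detz u v = 0 -> u = v \/ u = - v.
Proof.
case: u v => [a b] [c d]; rewrite /primitive /detz /= => pu pv D.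
have e1 : a * d = b * c by lia.
have /dvdzP[x xE] : (a %| c)%Z.
  by rewrite -(Gauss_dvdzr c pu) -e1 dvdz_mulr.
have /dvdzP[y yE] : (c %| a)%Z.
  by rewrite -(Gauss_dvdzl a pv) e1 dvdz_mull.
have /dvdzP[z zE] : (b %| d)%Z.
  by rewrite coprimez_sym in pu; rewrite -(Gauss_dvdzr d pu) e1 dvdz_mulr.
have /dvdzP[w wE] : (d %| b)%Z.
  by rewrite coprimez_sym in pv; rewrite -(Gauss_dvdzl b pv) -e1 dvdz_mull.
have ac : a = c \/ a = - c.
  have [a0|a0] := eqVneq a 0; first by left; rewrite a0 xE a0 mulr0.
  have xy : y * x = 1.
    by apply: (mulIf a0); rewrite mul1r {2}yE xE; ring.
  by case: (int_mul_eq1 xy) => x1; rewrite x1 in xE; [left|right]; lia.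
have bd : b = d \/ b = - d.
  have [b0|b0] := eqVneq b 0; first by left; rewrite b0 zE b0 mulr0.
  have zw : w * z = 1.
    by apply: (mulIf b0); rewrite mul1r {2}wE zE; ring.
  by case: (int_mul_eq1 zw) => z1; rewrite z1 in zE; [left|right]; lia.
case: ac => ac; case: bd => bd.
- by left; rewrite ac bd.
- have [c0|c0] := eqVneq c 0; first by right; rewrite ac bd c0; congr pair; lia.
  by left; rewrite ac bd; congr pair; nia.
- have [c0|c0] := eqVneq c 0; first by left; rewrite ac bd c0; congr pair; lia.
  have /eqP : c * d = 0 by move: e1; rewrite ac bd; lia.
  by rewrite mulf_eq0 (negbTE c0) /= => /eqP d0; right; rewrite ac bd d0.
- by right; rewrite ac bd.
Qed.

(** u = a e + b e' with real a and b, expressed through pairings because the three vectors are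
    integer ones. *)
Definition combination (u : int * int) (a : R) (e : int * int) (b : R) (e' : int * int) :=
  forall x : plane R, pairing u x = a * pairing e x + b * pairing e' x.

Lemma pairing_coord (u : int * int) : pairing u ((1, 0) : plane R) = u.1%:~R /\
  pairing u ((0, 1) : plane R) = u.2%:~R.
Proof. by rewrite /pairing /= !mulr0 !mulr1 addr0 add0r. Qed.

Lemma combination_det u a e b e' : combination u a e b e' ->
  (detz u e')%:~R = a * (detz e e')%:~R /\ (detz e u)%:~R = b * (detz e e')%:~R.
Proof.
move=> H; have := H ((1, 0) : plane R); have := H ((0, 1) : plane R).
have [-> ->] := pairing_coord u; have [-> ->] := pairing_coord e.
have [-> ->] := pairing_coord e' => h2 h1.
by rewrite /detz !rmorphB /= !rmorphM /= h1 h2; split; ring.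
Qed.

Lemma cramer u e e' : detz e e' != 0 ->
  combination u ((detz u e')%:~R / (detz e e')%:~R) e
                ((detz e u)%:~R / (detz e e')%:~R) e'.
Proof.
rewrite -(intr_eq0 R) => D0 x; apply: (mulfI D0).
transitivity ((detz u e')%:~R * pairing e x + (detz e u)%:~R * pairing e' x); last by field.
by rewrite /pairing /detz !rmorphB /= !rmorphM /=; ring.
Qed.

(** If D = detz e e' divided every detz e w, it would divide both coordinates of the primitive e. So
    some w has a non-integral coordinate along e'. Reducing its two coordinates modulo 1 gives a
    point of the fundamental parallelogram, and the reflection z |-> e + e' - z brings it into the
    half a + b <= 1 if necessary. *)
Lemma exists_lattice_point_in_triangle e e' : primitive e -> detz e e' != 0 ->
  `|detz e e'| != 1 -> exists z (a b : R),
    [/\ combination z a e b e', 0 <= a, 0 < b < 1 & a + b <= 1].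
Proof.
move=> pe D0 D1; pose D := detz e e'.
have [w Dw] : exists w, ~ exists q, detz e w = q * D.
  apply: contrapT => H.
  have H' w : exists q, detz e w = q * D.
    by apply: contrapT => h; apply: H; exists w.
  have [q1 E1] := H' (0, 1); have [q2 E2] := H' (-1, 0).
  rewrite /detz /= in E1 E2.
  have d1 : (D %| e.1)%Z by apply/dvdzP; exists q1; lia.
  have d2 : (D %| e.2)%Z by apply/dvdzP; exists q2; lia.
  have : (D %| gcdz e.1 e.2)%Z by rewrite dvdz_gcd d1.
  by move: pe => /eqP ->; rewrite dvdz1; move: D1; rewrite -/D; lia.
have D0' : (D%:~R : R) != 0 by rewrite intr_eq0.
pose al : R := (detz w e')%:~R / D%:~R; pose be : R := (detz e w)%:~R / D%:~R.
have wE : combination w al e be e' := cramer w D0.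
pose fa := Num.floor al; pose fb := Num.floor be.
have /andP[a1 a2] := floor_itv al; have /andP[b1 b2] := floor_itv be.
rewrite -/fa -/fb !intrD in a1 a2 b1 b2.
have b0 : fb%:~R != be.
  apply/eqP => h; apply: Dw; exists fb; apply/eqP.
  by rewrite -(eqr_int R) intrM h /be divfK.
have b0' : fb%:~R < be by rewrite lt_neqAle b0.
pose z : int * int := (w.1 - fa * e.1 - fb * e'.1, w.2 - fa * e.2 - fb * e'.2).
have zE : combination z (al - fa%:~R) e (be - fb%:~R) e'.
  move=> x; rewrite !mulrBl; have := wE x; rewrite /z /pairing /= !rmorphB /= !rmorphM /=.
  lra.
have [le1|gt1] := leP ((al - fa%:~R) + (be - fb%:~R)) 1.
  by exists z, (al - fa%:~R), (be - fb%:~R); split => //; lra.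
exists (e + e' - z), (1 - (al - fa%:~R)), (1 - (be - fb%:~R)); split; try lra.
by move=> x; rewrite !pairingD pairingN zE; ring.
Qed.

Lemma exists_separator (s t : seq R) : (forall a b, a \in s -> b \in t -> a <= b) ->
  exists k, (forall a, a \in s -> a <= k) /\ (forall b, b \in t -> k <= b).
Proof.
elim: s => [_|a s IH H].
  elim: t => [|b t [k [_ kt]]]; first by exists 0.
  exists (Num.min b k); split => // c; rewrite inE => /predU1P[->|/kt kc].
    by rewrite ge_min lexx.
  by rewrite ge_min kc orbT.
have [b c bs ct|k [ks kt]] := IH; first by apply: H => //; rewrite inE bs orbT.
exists (Num.max a k); split => [b|b bt].
  by rewrite inE le_max => /predU1P[->|/ks->]; rewrite ?lexx ?orbT.
by rewrite ge_max kt// H// mem_head.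
Qed.

(** Each e has an orthogonal coordinate [c e] along u and a transversal one [detz u e]. If neither a
    vector on the ray of u nor two vectors on opposite sides span u, the slopes [k e] on the
    positive side are at most those on the negative side; a slope [kk] between them gives the
    direction d, which is -u plus [kk] times u turned by a right angle. *)
Lemma farkas_plane (s : seq (int * int)) (u : int * int) : u != 0 ->
  (exists e e' (a b : R), [/\ e \in s, e' \in s, 0 <= a, 0 <= b & combination u a e b e'])
  \/ (exists d : plane R, (forall e, e \in s -> 0 <= pairing e d) /\ pairing u d < 0).
Proof.
move=> u0.
pose c (e : int * int) : int := e.1 * u.1 + e.2 * u.2.
pose n : R := (c u)%:~R.
have n0 : 0 < n.
  rewrite /n ltr0z /c; move: u0; clear.
  case: u => u1 u2 /= u0.
  have [u10|u10] := eqVneq u1 0; last by nia.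
  have [u20|u20] := eqVneq u2 0; last by nia.
  by move: u0; rewrite u10 u20.
have decomp e x : n * pairing e x =
    (c e)%:~R * pairing u x + (detz u e)%:~R * (u.1%:~R * x.2 - u.2%:~R * x.1) :> R.
  by rewrite /n /c /detz /pairing !rmorphB !rmorphD /= !rmorphM /=; ring.
have [[e es /andP[/eqP De ce]]|noray] :=
    pselect (exists2 e, e \in s & (detz u e == 0) && (0 < c e)).
  left; exists e, e, (n / (c e)%:~R), 0; split => //.
    by rewrite divr_ge0// ?(ltW n0)// ler0z ltW.
  move=> x; rewrite mul0r addr0.
  have ce' : (c e)%:~R != 0 :> R by rewrite intr_eq0 gt_eqF.
  by apply: (mulfI ce'); rewrite mulrA mulrCA divff// mulr1 decomp De mul0r addr0.
have [[e [e' [es e's De De' h]]]|nopair] := pselect (exists e e',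
    [/\ e \in s, e' \in s, detz u e < 0, 0 < detz u e' &
      0 < c e * detz u e' - c e' * detz u e]).
  left; exists e, e', (n * (detz u e')%:~R / (c e * detz u e' - c e' * detz u e)%:~R),
    (n * (- detz u e)%:~R / (c e * detz u e' - c e' * detz u e)%:~R).
  have h' : 0 < (c e * detz u e' - c e' * detz u e)%:~R :> R by rewrite ltr0z.
  split => //.
  - by rewrite divr_ge0 ?(ltW h')// mulr_ge0 ?(ltW n0)// ler0z ltW.
  - by rewrite divr_ge0 ?(ltW h')// mulr_ge0 ?(ltW n0)// ler0z; lia.
  move=> x; apply: (mulfI (lt0r_neq0 h')).
  transitivity ((detz u e')%:~R * (n * pairing e x) - (detz u e)%:~R * (n * pairing e' x)).
    by rewrite (decomp e x) (decomp e' x) intrB (intrM _ (c e)) (intrM _ (c e')); ring.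
  move: h'; rewrite (intrN _ (detz u e)); move: (c e * _ - _)%:~R => S h'.
  by field; exact: lt0r_neq0.
right.
pose k e : R := (c e)%:~R / (detz u e)%:~R.
have [a b|kk [k1 k2]] := @exists_separator [seq k e | e <- s & 0 < detz u e]
    [seq k e | e <- s & detz u e < 0].
  move=> /mapP[e' +->] /mapP[e +->]; rewrite !mem_filter => /andP[De' e's] /andP[De es].
  have Dr' : 0 < (detz u e')%:~R :> R by rewrite ltr0z.
  have Dr : (detz u e)%:~R < 0 :> R by rewrite ltrz0.
  have hh : c e * detz u e' - c e' * detz u e <= 0.
    by rewrite leNgt; apply/negP => h; apply: nopair; exists e, e'.
  have hr : (c e)%:~R * (detz u e')%:~R - (c e')%:~R * (detz u e)%:~R <= 0 :> R.
    by rewrite -!rmorphM -rmorphB /= lerz0.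
  rewrite /k ler_pdivrMr// mulrAC ler_ndivlMr//; lra.
exists ((- u.1%:~R - kk * u.2%:~R, - u.2%:~R + kk * u.1%:~R) : plane R); split; last first.
  rewrite (_ : pairing _ _ = - n); first by rewrite oppr_lt0.
  by rewrite /pairing /n /c /= rmorphD /= !rmorphM /=; ring.
move=> e es; rewrite (_ : pairing _ _ = - (c e)%:~R + kk * (detz u e)%:~R); last first.
  by rewrite /pairing /c /detz /= rmorphB rmorphD /= !rmorphM /=; ring.
have [De|De|De] := ltgtP (detz u e) 0.
- have Dr : (detz u e)%:~R < 0 :> R by rewrite ltrz0.
  have : kk <= k e by apply: k2; apply/mapP; exists e; rewrite ?mem_filter ?De.
  by rewrite /k ler_ndivlMr//; lra.
- have Dr : 0 < (detz u e)%:~R :> R by rewrite ltr0z.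
  have : k e <= kk by apply: k1; apply/mapP; exists e; rewrite ?mem_filter ?De.
  by rewrite /k ler_pdivrMr//; lra.
- rewrite De mulr0 addr0 oppr_ge0 lerz0 leNgt; apply/negP => h.
  by apply: noray; exists e => //; rewrite De eqxx.
Qed.

End lattice_boxes.

(** * Tight normals at the maximum points, and the model that they cut out *)

Section max_locus.
Variable R : realType.
Variable K : set (plane R).
Hypothesis cK : compact K.
Hypothesis vK : convex_set K.
Hypothesis K0 : K^° !=set0.
Implicit Types (u v w e : int * int) (x y z p d : plane R).

Let Kne : K !=set0.
Proof. by have [x /interior_subset Kx] := K0; exists x. Qed.

Local Notation m := (rho_max K).

Lemma has_sup_rho : has_sup [set rho K x | x in K].
Proof.
have [x Kx] := Kne; split; first by exists (rho K x), x.
have [y _ ymax] := compact_rpairing_min ((-1, 0) : plane R) cK Kne.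
exists (y.1 - supp K (1, 0)) => _ [z Kz <-].
apply: (le_trans (rho_le_lam cK primitive_e1 Kz)).
have := ymax _ Kz; rewrite /lam /rpairing /pairing /= !mul0r mul1r !addr0 !mulN1r; lra.
Qed.

Lemma rho_le_max x : rho K x <= m.
Proof.
have H y : K y -> rho K y <= m.
  by move=> Ky; apply: ub_le_sup; [exact: has_sup_rho.2|exists y].
have [Kx|nKx] := pselect (K x); first exact: H.
have [y Ky] := Kne; rewrite rho_out; last by move=> /interior_subset.
by apply: le_trans (H _ Ky); exact: rho_ge0.
Qed.

Lemma rho_max_gt0 : 0 < m.
Proof. by have [x Kx] := K0; apply: lt_le_trans (rho_le_max x); exact: rho_interior. Qed.

(** A form of [max_locus] without the interior test of [rho]; the inequalities alone force p into K,
    by [le_rho]. *)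
Definition top p := forall u, primitive u -> m <= lam K u p.

Lemma top_rho p : top p -> rho K p = m.
Proof.
move=> tp; apply/eqP; rewrite eq_le rho_le_max /=.
by apply: le_rho => //; exact/ltW/rho_max_gt0.
Qed.

Lemma top_mem p : top p -> K p.
Proof.
move=> /top_rho tp; apply: interior_subset; apply: rho_gt0_int => //.
by rewrite tp rho_max_gt0.
Qed.

Lemma top_ge p u : top p -> u != 0 -> m <= lam K u p.
Proof. by move=> tp; apply: lam_ge_nonzero => //; exact/ltW/rho_max_gt0. Qed.

Lemma max_locus_top p : max_locus K p <-> top p.
Proof.
split=> [[Kp pm] u pu|tp]; last by split; [exact: top_mem|exact: top_rho].
by rewrite -pm; exact: rho_le_lam.
Qed.

Lemma continuous_lam u : continuous (lam K u).
Proof.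
move=> x; rewrite /continuous_at /lam; apply: (@cvgB _ R^o); last exact: cvg_cst.
exact: (continuous_rpairing (d := vec R u)).
Qed.

(** Otherwise every point of K has a normal whose [lam] stays below some t < m nearby. By
    compactness one t < m serves all of K, against the definition of m as a supremum. *)
Lemma exists_top : exists p, top p.
Proof.
apply: contrapT => notop.
have H x : exists2 u, primitive u & lam K u x < m.
  apply: contrapT => h; apply: notop; exists x => u pu; rewrite leNgt.
  by apply/negP => hu; apply: h; exists u.
have nc := (compact_near_coveringP K).1 cK.
have : \forall t \near m^'-, K `<=` (fun x => exists2 u, primitive u & lam K u x < t).
  apply: nc => x Kx; have [u pu ux] := H x.
  pose c := (lam K u x + m) / 2.
  exists ([set y | lam K u y < c], [set t | c < t]) => /=.
    split.
      have /(_ [set t : R | t < c]) h := @continuous_lam u x.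
      apply: h; apply: open_nbhs_nbhs; split; first exact: open_lt.
      by rewrite /c /=; lra.
    by near=> t; near: t; apply: nbhs_left_gt; rewrite /c; lra.
  by move=> [y t] [/= y1 t1]; exists u => //; exact: lt_trans t1.
move=> Hn.
have [t [tm Ht]] : exists t, t < m /\ K `<=` (fun x => exists2 u, primitive u & lam K u x < t).
  near m^'- => t; exists t; split; first by near: t; exact: nbhs_left_lt.
  by near: t.
have : m <= t; last by rewrite leNgt tm.
apply: sup_le_ub; first exact: has_sup_rho.1.
move=> _ [x Kx <-]; have [u pu ut] := Ht x Kx.
exact: le_trans (rho_le_lam cK pu Kx) (ltW ut).
Unshelve. all: by end_near. Qed.

Lemma top_segment p q t : top p -> top q -> 0 <= t <= 1 ->
  top ((1 - t) * p.1 + t * q.1, (1 - t) * p.2 + t * q.2).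
Proof.
move=> tp tq /andP[t0 t1] u pu.
have -> : lam K u ((1 - t) * p.1 + t * q.1, (1 - t) * p.2 + t * q.2) =
   (1 - t) * lam K u p + t * lam K u q by rewrite /lam /pairing /=; ring.
by have := tp u pu; have := tq u pu; nra.
Qed.

(** By linear growth only the normals of a bounded box can come near m close to p, and the finitely
    many non-tight ones among them have a common slack. *)
Lemma tight_gap p : top p -> exists2 e : R, 0 < e & forall u y, primitive u ->
  lam K u p != m -> `|y.1 - p.1| <= e -> `|y.2 - p.2| <= e -> m + e <= lam K u y.
Proof.
move=> tp; have m0 := rho_max_gt0.
have [r r0 /(_ _ tp) Hr] := lam_ge_norm1 cK vK Kne m0.
(* Beyond norm N, half of the growth r already exceeds m + 1; the other half absorbs the
   displacement, at most r / 2 in each coordinate. *)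
pose N := (Num.bound (2 * (m + 1) / r)).+1.
have Np : (0 : R) < N%:R by rewrite ltr0n.
have NB : 2 * (m + 1) < N%:R * r.
  rewrite -ltr_pdivrMr// (lt_trans (archi_boundP _)) ?ltr_nat//.
  by rewrite divr_ge0 ?(ltW r0)// mulr_ge0//; lra.
pose g u : R := lam K u p - m.
have [u|e e0 He] := @exists_pos_lower_bound R _
  [seq u <- lattice_box N | `[< primitive u /\ lam K u p != m >]] g.
  rewrite mem_filter => /andP[/asboolP[pu um] _].
  by rewrite /g subr_gt0 lt_neqAle eq_sym um tp.
have N1 : 0 < (N%:R + 1 : R) by lra.
exists (Num.min 1 (Num.min (r / 2) (e / (N%:R + 1)))).
  by rewrite !lt_min ltr01 !divr_gt0.
set eps := Num.min _ _ => u y pu um y1 y2.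
have eps1 : eps <= 1 by rewrite /eps ge_min lexx.
have eps2 : eps <= r / 2 by rewrite /eps !ge_min lexx orbT.
have eps3 : eps * (N%:R + 1) <= e.
  by rewrite -ler_pdivlMr// /eps !ge_min lexx !orbT.
have e0' : 0 < eps by rewrite !lt_min ltr01 !divr_gt0.
have := @rpairing_norm1 R (vec R u) (y - p) eps y1 y2.
rewrite -pairingE ler_norml => /andP[hl _].
rewrite (lam_shift K u p y).
have n0 := norm1_ge0 (vec R u).
have [uN|Nu] := leP (norm1 (vec R u)) N%:R.
  have : e <= g u.
    by apply: He; rewrite mem_filter (mem_lattice_box uN) andbT; apply/asboolP.
  rewrite /g => ?.
  have : norm1 (vec R u) * eps <= N%:R * eps by apply: ler_wpM2r => //; exact: ltW.
  lra.
have := Hr u.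
have : norm1 (vec R u) * eps <= norm1 (vec R u) * (r / 2) by apply: ler_wpM2l.
have : N%:R * r <= norm1 (vec R u) * r by apply: ler_wpM2r; exact: ltW.
lra.
Qed.

Definition scaled (c : R) d : plane R := (c * d.1, c * d.2).

Lemma lam_move u p c d : lam K u (p + scaled c d) = lam K u p + c * pairing u d.
Proof. by rewrite /lam /pairing /scaled /=; ring. Qed.

Lemma small_scale (e : R) d : 0 < e ->
  exists2 c : R, 0 < c & `|c * d.1| <= e /\ `|c * d.2| <= e.
Proof.
move=> e0; have n0 := norm1_ge0 d.
have b : 0 < 1 + norm1 d by lra.
exists (e / (1 + norm1 d)); first by rewrite divr_gt0.
have h (x : R) : `|x| <= norm1 d -> `|e / (1 + norm1 d) * x| <= e.
  move=> hx; rewrite normrM gtr0_norm ?divr_gt0// mulrAC ler_pdivrMr//.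
  by apply: ler_wpM2l; [exact: ltW|lra].
have := normr_ge0 d.1; have := normr_ge0 d.2.
by split; apply: h; rewrite /norm1; lra.
Qed.

Definition tight u p := [/\ primitive u, top p & lam K u p = m].

(* The maximum of [rho K] cannot be increased from [p], so the tight normals at
   [p] do not lie in an open half-plane. *)
Lemma tight_no_ascent p d (c : R) : top p -> 0 < c ->
  (forall u, tight u p -> c <= pairing u d) -> False.
Proof.
move=> tp c0 H; have m0 := rho_max_gt0.
have [e e0 He] := tight_gap tp.
have [s s0 [s1 s2]] := small_scale d e0.
pose t := m + Num.min e (s * c).
have : t <= rho K (p + scaled s d).
  apply: le_rho => //; first by rewrite addr_ge0 ?(ltW m0)// le_min !ltW// mulr_gt0.
  move=> u pu; have [um|um] := eqVneq (lam K u p) m.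
    rewrite lam_move um lerD2l ge_min; apply/orP; right.
    by rewrite ler_pM2l//; apply: H.
  apply: (@le_trans _ _ (m + e)); first by rewrite lerD2l ge_min lexx.
  by apply: He => //=; rewrite addrC addKr.
rewrite leNgt (le_lt_trans (rho_le_max _))// /t ltrDl lt_min e0 mulr_gt0//.
Qed.

Lemma tight_move p d : top p -> (forall u, tight u p -> 0 <= pairing u d) ->
  exists2 c : R, 0 < c & top (p + scaled c d).
Proof.
move=> tp H; have [e e0 He] := tight_gap tp.
have [s s0 [s1 s2]] := small_scale d e0; exists s => // u pu.
have [um|um] := eqVneq (lam K u p) m.
  by rewrite lam_move um lerDl mulr_ge0// ?(ltW s0)//; apply: H.
apply: (@le_trans _ _ (m + e)); first by rewrite lerDl ltW.
by apply: He => //=; rewrite addrC addKr.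
Qed.

Definition extremal u := extremal_normals K u.

Lemma extremalP u : extremal u <-> exists p, tight u p.
Proof.
split=> [[pu [p /max_locus_top tp mE]]|[p [pu tp um]]].
  by exists p; split => //; rewrite /lam -mE.
by split=> //; exists p; [exact/max_locus_top|rewrite -um].
Qed.

Lemma exists_tight p : top p -> exists u, tight u p.
Proof.
move=> tp; apply: contrapT => H.
by apply: (@tight_no_ascent p 0 1 tp ltr01) => u ut; exfalso; apply: H; exists u.
Qed.

(** A tight normal u satisfies r norm1 u <= m, with the same r at all maximum points. *)
Lemma extremal_seq : exists s : seq (int * int), forall u, u \in s <-> extremal u.
Proof.
have m0 := rho_max_gt0; have [r r0 Hr] := lam_ge_norm1 cK vK Kne m0.
pose N := Num.bound (m / r).
have NB : m < N%:R * r.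
  by rewrite -ltr_pdivrMr// archi_boundP// divr_ge0 ?ltW.
exists [seq u <- lattice_box N | `[< extremal u >]] => u.
rewrite mem_filter; split=> [/andP[/asboolP]//|eu]; rewrite (asboolT eu) /=.
have [p [pu tp um]] := (extremalP u).1 eu.
apply: (@mem_lattice_box R); have := Hr p tp u; rewrite um => h.
by rewrite -(ler_pM2l r0) (le_trans h)// mulrC ltW.
Qed.

Lemma closed_top : closed top.
Proof.
rewrite (_ : top = \bigcap_(u in primitive) [set p | m <= lam K u p]).
  apply: closed_bigI => u _.
  have /continuous_closedP h := @continuous_lam u.
  by apply: (h [set t : R | m <= t]); exact: closed_ge.
by apply/seteqP; split=> p tp u pu; exact: tp.
Qed.

Lemma compact_top : compact top.
Proof. by apply: (subclosed_compact closed_top cK) => p; exact: top_mem. Qed.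

(** Otherwise a maximum point farthest in the direction d, which exists by compactness, could be
    moved further along d by [tight_move]. *)
Lemma extremal_spanning d : d != 0 -> exists2 e, extremal e & pairing e d < 0.
Proof.
move=> d0; apply: contrapT => H.
have H' e : extremal e -> 0 <= pairing e d.
  by move=> ee; rewrite leNgt; apply/negP => h; apply: H; exists e.
have [p tp pmax] := compact_rpairing_min (- d) compact_top exists_top.
have [u ut|c c0 tpc] := @tight_move p d tp.
  by apply: H'; apply/extremalP; exists p.
have := pmax _ tpc; rewrite leNgt => /negP; apply.
have dd : 0 < d.1 ^+ 2 + d.2 ^+ 2.
  rewrite lt_neqAle addr_ge0 ?sqr_ge0// andbT eq_sym; apply: contra d0.
  rewrite paddr_eq0 ?sqr_ge0// !sqrf_eq0 => /andP[/eqP d1 /eqP d2].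
  by apply/eqP/injective_projections.
rewrite (_ : rpairing _ _ = rpairing (- d) p - c * (d.1 ^+ 2 + d.2 ^+ 2)).
  by rewrite gtrDl oppr_lt0 mulr_gt0.
by rewrite /rpairing /scaled /=; ring.
Qed.

Lemma lam_combination u a e b e' x : combination u a e b e' -> 0 <= a -> 0 <= b ->
  lam K u x <= a * lam K e x + b * lam K e' x.
Proof.
move=> uE a0 b0; have [y Ky yE] := support_attained u cK Kne.
rewrite /lam yE !uE.
have : a * supp K e <= a * pairing e y by apply: ler_wpM2l => //; exact: support_le.
have : b * supp K e' <= b * pairing e' y by apply: ler_wpM2l => //; exact: support_le.
lra.
Qed.

Lemma extremal_primitive u : extremal u -> primitive u.
Proof. by case. Qed.

(* At the midpoint of two maximum points the tight normals are orthogonal to the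
   segment, hence a pair of opposite vectors. *)
Lemma tight_between e e' p p' : detz e e' != 0 -> tight e p -> tight e' p' ->
  m < lam K e' p -> m < lam K e p' ->
  exists u (a b : R), [/\ 0 < a, 0 < b, combination u a e b e', tight u p & tight u p'].
Proof.
move=> D0 [pe tp ep] [pe' tp' ep'] lep lep'.
pose d := p' - p.
have ed : 0 < pairing e d by rewrite /d pairing_sub; move: lep' ep; rewrite /lam; lra.
have ed' : pairing e' d < 0 by rewrite /d pairing_sub; move: lep ep'; rewrite /lam; lra.
pose c : plane R := ((1 - 1/2) * p.1 + 1/2 * p'.1, (1 - 1/2) * p.2 + 1/2 * p'.2).
have tc : top c by apply: top_segment => //; apply/andP; split; lra.
have tightc u : tight u c -> [/\ primitive u, tight u p, tight u p' & pairing u d = 0].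
  move=> [pu _ uc]; have := tp u pu; have := tp' u pu.
  have : lam K u c = (lam K u p + lam K u p') / 2 by rewrite /lam /c /pairing /=; field.
  rewrite uc => h h1 h2; have e1 : lam K u p = m by lra.
  have e2 : lam K u p' = m by lra.
  by split => //; rewrite /d pairing_sub; move: e1 e2; rewrite /lam; lra.
have perp u v : pairing u d = 0 -> pairing v d = 0 -> detz u v = 0.
  move=> ud vd; apply/eqP; rewrite -(intr_eq0 R).
  have h1 : (detz u v)%:~R * d.1 = 0.
    rewrite (_ : _ * _ = v.2%:~R * pairing u d - u.2%:~R * pairing v d).
      by rewrite ud vd !mulr0 subrr.
    by rewrite /detz /pairing rmorphB /= !rmorphM /=; ring.
  have h2 : (detz u v)%:~R * d.2 = 0.
    rewrite (_ : _ * _ = u.1%:~R * pairing v d - v.1%:~R * pairing u d).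
      by rewrite ud vd !mulr0 subrr.
    by rewrite /detz /pairing rmorphB /= !rmorphM /=; ring.
  apply/negPn/negP => D; move: ed; rewrite /pairing.
  move: h1 h2 => /eqP + /eqP; rewrite !mulf_eq0 (negbTE D) /= => /eqP -> /eqP ->.
  by rewrite !mulr0 addr0 ltxx.
have [u1 u1c] := exists_tight tc.
have [pu1 u1p u1p' u1d] := tightc _ u1c.
have Nu1c : tight (- u1) c.
  apply: contrapT => nt; apply: (@tight_no_ascent c (vec R u1) 1 tc ltr01) => u uc.
  have [pu up up' ud] := tightc _ uc.
  have [->|uE] := primitive_parallel pu pu1 (perp _ _ ud u1d); last by rewrite uE in uc.
  have : ((u1.1 * u1.1 + u1.2 * u1.2)%:~R : R) = pairing u1 (vec R u1).
    by rewrite /pairing /= rmorphD /= !rmorphM.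
  move=> <-; rewrite -[1]/(1%:~R) ler_int.
  have := primitive_neq0 pu1; clear; case: u1 => a b /= ab0.
  have [a0|a0] := eqVneq a 0; last by nia.
  have [b0|b0] := eqVneq b 0; last by nia.
  by move: ab0; rewrite a0 b0.
have [_ Nu1p Nu1p' _] := tightc _ Nu1c.
have uE := @cramer R u1 e e' D0.
set a := _ / _ in uE; set b := _ / _ in uE.
have abd : a * pairing e d + b * pairing e' d = 0 by rewrite -uE.
have ab0 : a != 0 \/ b != 0.
  have [a0|] := eqVneq a 0; last by left.
  have [b0|] := eqVneq b 0; last by right.
  exfalso; have [x0 y0] := @pairing_coord R u1; move: x0 y0; rewrite !uE a0 b0 !mul0r addr0.
  move=> /esym/eqP + /esym/eqP; rewrite !intr_eq0 => /eqP x0 /eqP y0.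
  have := primitive_neq0 pu1; apply/negP; rewrite negbK; apply/eqP.
  exact: injective_projections.
have [a0|a0] := ltP 0 a.
  exists u1, a, b; split => //.
  by move: abd; clear -ed ed' a0; nra.
have a0' : a < 0.
  rewrite lt_neqAle a0 andbT; apply/eqP => aE; case: ab0; rewrite ?aE ?eqxx// => b0.
  move: abd; rewrite aE mul0r add0r => /eqP; rewrite mulf_eq0 (negbTE b0) /=.
  by rewrite lt_eqF.
exists (- u1), (- a), (- b); split => //; [lra| |].
  by move: abd; clear -ed ed' a0'; nra.
by move=> x; rewrite pairingN uE; ring.
Qed.

Lemma common_tight e e' : detz e e' != 0 -> extremal e -> extremal e' ->
  (exists p, tight e p /\ tight e' p) \/
  exists u (a b : R), [/\ 0 < a, 0 < b, combination u a e b e',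
    (exists p, tight e p /\ tight u p) & (exists p, tight e' p /\ tight u p)].
Proof.
move=> D0 /extremalP[p ep] /extremalP[p' ep'].
have [pe tp epm] := ep; have [pe' tp' ep'm] := ep'.
have := tp _ pe'; rewrite le_eqVlt => /predU1P[h|h1].
  by left; exists p; split.
have := tp' _ pe; rewrite le_eqVlt => /predU1P[h|h2].
  by left; exists p'; split.
have [u [a [b [a0 b0 uE up up']]]] := tight_between D0 ep ep' h1 h2.
by right; exists u, a, b; split => //; [exists p|exists p'].
Qed.

Definition hat x := forall e, extremal e -> 0 <= lam K e x.

Lemma minimal_modelE : minimal_model K = hat.
Proof.
apply/seteqP; split=> x Hx e ee; have := Hx e ee; rewrite /lam /= ?subr_ge0//.
Qed.

Lemma sub_hat x : K x -> hat x.
Proof. by move=> Kx e _; exact: lam_ge0. Qed.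

Lemma lam_eq0_corner e e' x y : detz e e' != 0 -> lam K e x = 0 -> lam K e' x = 0 ->
  lam K e y = 0 -> lam K e' y = 0 -> x = y.
Proof.
move=> D0 ex e'x ey e'y.
have h u : combination u ((detz u e')%:~R / (detz e e')%:~R) e
   ((detz e u)%:~R / (detz e e')%:~R) e' := @cramer R u e e' D0.
have he : pairing e (x - y) = 0 by rewrite pairing_sub; move: ex ey; rewrite /lam; lra.
have he' : pairing e' (x - y) = 0 by rewrite pairing_sub; move: e'x e'y; rewrite /lam; lra.
have h0 u : pairing u (x - y) = 0 by rewrite h he he' !mulr0 addr0.
have := h0 (1, 0); have := h0 (0, 1); rewrite /pairing /= !mul0r !mul1r addr0 add0r.
by move=> h1 h2; apply: injective_projections; apply/eqP; rewrite -subr_eq0; apply/eqP.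
Qed.

(* A point of [K] minimizing an extremal normal strictly between [e] and [e']
   can only be the corner where [e] and [e'] are minimal. *)
Lemma corner_mem e e' (z : int * int) (a b : R) (v : plane R) : detz e e' != 0 -> extremal z ->
  combination z a e b e' -> 0 < a -> 0 < b -> hat v ->
  lam K e v = 0 -> lam K e' v = 0 -> K v.
Proof.
move=> D0 ez zE a0 b0 hv ev e'v.
have [y Ky yE] := support_attained z cK Kne.
have zy : lam K z y = 0 by rewrite /lam yE subrr.
have zv : lam K z v = 0.
  apply/eqP; rewrite eq_le hv// andbT.
  by rewrite (le_trans (lam_combination v zE (ltW a0) (ltW b0)))// ev e'v !mulr0 addr0.
have ey := lam_ge0 e cK Ky; have e'y := lam_ge0 e' cK Ky.
have h : a * lam K e y + b * lam K e' y = 0.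
  have := zE y; have := zE v; move: zy zv ev e'v; rewrite /lam => h1 h2 h3 h4 h5 h6.
  have : a * (pairing e v - supp K e) + b * (pairing e' v - supp K e') = 0.
    by rewrite h3 h4 !mulr0 addr0.
  lra.
have ey0 : lam K e y = 0.
  apply/eqP; rewrite eq_le ey andbT -(pmulr_rle0 _ a0).
  have : 0 <= b * lam K e' y by rewrite mulr_ge0// ltW.
  lra.
have e'y0 : lam K e' y = 0.
  apply/eqP; rewrite eq_le e'y andbT -(pmulr_rle0 _ b0).
  have : 0 <= a * lam K e y by rewrite mulr_ge0// ltW.
  lra.
by rewrite (lam_eq0_corner D0 ev e'v ey0 e'y0).
Qed.

(** Sublinearity gives lam z <= (a + b) m <= m at p, while lam z >= m for every nonzero z, so both
    are equalities. A proper multiple of a primitive vector would have lam at least 2 m, hence z is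
    primitive. *)
Lemma tight_combination (z : int * int) (a b : R) e e' p : combination z a e b e' -> 0 <= a -> 0 <= b ->
  a + b <= 1 -> z != 0 -> tight e p -> tight e' p -> tight z p /\ a + b = 1.
Proof.
move=> zE a0 b0 ab z0 [pe tp ep] [pe' _ e'p]; have m0 := rho_max_gt0.
have := lam_combination p zE a0 b0; rewrite ep e'p -mulrDl => h.
have h' := top_ge tp z0.
have ab1 : a + b = 1.
  apply/eqP; rewrite eq_le ab /= -(ler_pM2r m0) mul1r.
  exact: le_trans h.
have zm : lam K z p = m by apply/eqP; rewrite eq_le h' andbT (le_trans h)// ab1 mul1r.
split => //; split => //.
have [q [n [pq zq]]] := primitive_multiple z0.
case: n zq => [|n] zq; first by rewrite zq.
exfalso; move: zm; rewrite zq lamMn// mulrS.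
have : m *+ n.+1 <= lam K q p *+ n.+1 by rewrite lerMn2r tp// orbT.
have := tp _ pq; have : m <= m *+ n.+1 by rewrite mulrS lerDl mulrn_wge0 ?ltW.
lra.
Qed.

(** The source of unimodularity. Without a common maximum point, [common_tight] gives an extremal
    normal strictly between e and e'; if the determinant is not a unit, so does a lattice point of
    the triangle 0, e, e'. Either one puts v in K by [corner_mem]. *)
Lemma outside_corner e e' (v : plane R) : detz e e' != 0 -> extremal e -> extremal e' -> hat v ->
  lam K e v = 0 -> lam K e' v = 0 -> ~ K v ->
  (exists p, tight e p /\ tight e' p) /\ `|detz e e'| = 1.
Proof.
move=> D0 ee ee' hv ev e'v nKv.
have [[p [ep e'p]]|[u [a [b [a0 b0 uE [p [_ up]] _]]]]] := common_tight D0 ee ee'; last first.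
  exfalso; apply: nKv; apply: (corner_mem D0 _ uE) => //.
  by apply/extremalP; exists p.
split; first by exists p.
apply/eqP/negPn/negP => D1.
have pe : primitive e by case: ee.
have [z [a [b [zE a0 /andP[b0 b1] ab]]]] := @exists_lattice_point_in_triangle R e e' pe D0 D1.
have z0 : z != 0.
  apply/eqP => z0; have [_] := combination_det zE.
  rewrite z0 {1}/detz /= !mulr0 subrr => /esym/eqP.
  by rewrite mulf_eq0 intr_eq0 (negbTE D0) orbF gt_eqF.
have [zt ab1] := tight_combination zE a0 (ltW b0) ab z0 ep e'p.
apply: nKv; apply: (corner_mem D0 _ zE) => //; last by lra.
by apply/extremalP; exists p.
Qed.

Lemma closed_hat : closed hat.
Proof.
rewrite (_ : hat = \bigcap_(e in extremal) [set x | 0 <= lam K e x]).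
  apply: closed_bigI => u _.
  have /continuous_closedP h := @continuous_lam u.
  by apply: (h [set t : R | 0 <= t]); exact: closed_ge.
by apply/seteqP; split=> p tp u pu; exact: tp.
Qed.

(** Either u is a nonnegative combination of extremal normals, which bounds it, or some d pairs
    nonnegatively with all of them, against [extremal_spanning]. *)
Lemma hat_lower_bound u : u != 0 -> exists c : R, forall x, hat x -> c <= pairing u x.
Proof.
move=> u0; have [s sE] := extremal_seq.
have [[e [e' [a [b [es e's a0 b0 uE]]]]]|[d [H ud]]] := @farkas_plane R s u u0.
  exists (a * supp K e + b * supp K e') => x hx; rewrite uE.
  have := hx e ((sE e).1 es); have := hx e' ((sE e').1 e's).
  by rewrite /lam !subr_ge0 => h1 h2; apply: lerD; apply: ler_wpM2l.
have d0 : d != 0 by apply: contraTneq ud => ->; rewrite /pairing /= !mulr0 addr0 ltxx.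
have [e ee] := extremal_spanning d0.
by rewrite ltNge H//; exact/sE.
Qed.

Lemma compact_hat : compact hat.
Proof.
have [a Ha] := @hat_lower_bound (1, 0) isT; have [b Hb] := @hat_lower_bound (0, 1) isT.
have [a' Ha'] := @hat_lower_bound (-1, 0) isT; have [b' Hb'] := @hat_lower_bound (0, -1) isT.
apply: (@subclosed_compact _ _ (`[a, - a']%classic `*` `[b, - b']%classic) closed_hat).
  by apply: compact_setX; exact: segment_compact.
move=> x hx; have := Ha x hx; have := Ha' x hx; have := Hb x hx; have := Hb' x hx.
rewrite /pairing /= !mul0r !mul1r !addr0 !add0r !mulN1r => *.
by split; rewrite /= in_itv/=; apply/andP; split; lra.
Qed.

Lemma convex_hat : convex_set hat.
Proof.
move=> x y t /set_mem hx /set_mem hy; apply/mem_set => e ee.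
have t0 : 0 <= t%:num by [].
have t1 : t%:num <= 1 by [].
have -> : lam K e (conv t x y) = t%:num * lam K e x + (1 - t%:num) * lam K e y.
  rewrite (_ : conv t x y = ((t%:num * x.1 + (1 - t%:num) * y.1,
                              t%:num * x.2 + (1 - t%:num) * y.2) : plane R))//.
  by rewrite /lam /pairing /=; ring.
apply: addr_ge0; apply: mulr_ge0 => //; first [exact: hx|exact: hy].
Qed.

Lemma interior_hat : hat^° !=set0.
Proof.
by have [x Kx] := K0; exists x; apply: interiorS Kx => y; exact: sub_hat.
Qed.

Lemma hat_move (v : plane R) d : hat v -> (forall e, extremal e -> lam K e v = 0 -> 0 <= pairing e d) ->
  exists2 c : R, 0 < c & hat (v + scaled c d).
Proof.
move=> hv H; have [s sE] := extremal_seq.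
have [u|c c0 Hc] := @exists_pos_lower_bound R _ [seq e <- s | 0 < lam K e v]
    (fun e => lam K e v / (1 + `|pairing e d|)).
  by rewrite mem_filter => /andP[u0 _]; rewrite divr_gt0.
exists c => // e ee; rewrite lam_move.
have := hv e ee; rewrite le_eqVlt => /predU1P[e0|e0].
  by rewrite -e0 add0r; apply: mulr_ge0; [exact: ltW|exact: H].
have n0 := normr_ge0 (pairing e d).
have : c <= lam K e v / (1 + `|pairing e d|).
  by apply: Hc; rewrite mem_filter e0; apply/sE.
rewrite ler_pdivlMr; last by lra.
have : c * - `|pairing e d| <= c * pairing e d.
  by apply: ler_wpM2l; [exact: ltW|rewrite lerNl -normrN ler_norm].
lra.
Qed.

(* Every direction is a nonnegative combination of two extremal normals that are
   minimal at a common vertex of the minimal model and tight at a common point. *)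
Lemma vertex_cone u : u != 0 -> exists (v : plane R) e e' p (a b : R),
  [/\ hat v /\ (forall x, hat x -> pairing u v <= pairing u x),
      lam K e v = 0 /\ lam K e' v = 0, tight e p /\ tight e' p,
      0 <= a /\ 0 <= b & combination u a e b e'].
Proof.
move=> u0; have [v hv vmin] := compact_rpairing_min (vec R u) compact_hat
  (ex_intro _ _ (sub_hat (interior_subset (projT2 (cid K0))))).
have [s sE] := extremal_seq.
have [[e [e' [a [b [es e's a0 b0 uE]]]]]|[d [H ud]]] :=
    @farkas_plane R [seq e <- s | lam K e v == 0] u u0; last first.
  have [e ee ev|c c0 hc] := @hat_move v d hv.
    by apply: H; rewrite mem_filter ev eqxx; apply/sE.
  have := vmin _ hc; rewrite leNgt => /negP; case.
  rewrite -!pairingE (_ : pairing u (v + _) = pairing u v + c * pairing u d).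
    by rewrite gtrDl pmulr_rlt0.
  by rewrite /pairing /scaled /=; ring.
move: es e's; rewrite !mem_filter => /andP[/eqP ev /sE ee] /andP[/eqP e'v /sE ee'].
(* The degenerate case: u is a nonnegative multiple of one extremal normal, taken twice. *)
have single e1 (c : R) : extremal e1 -> lam K e1 v = 0 -> 0 <= c ->
    (forall x, pairing u x = c * pairing e1 x) ->
    exists (v : plane R) e e' p (a b : R), [/\ hat v /\ (forall x, hat x -> pairing u v <= pairing u x),
      lam K e v = 0 /\ lam K e' v = 0, tight e p /\ tight e' p,
      0 <= a /\ 0 <= b & combination u a e b e'].
  move=> /extremalP[p e1p] e1v c0 uc; exists v, e1, e1, p, c, 0; split => //.
  by move=> x; rewrite mul0r addr0.
have [D0|D0] := eqVneq (detz e e') 0.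
  have [eE|eE] := primitive_parallel (extremal_primitive ee) (extremal_primitive ee') D0.
    apply: (single e (a + b)) => //; first by rewrite addr_ge0.
    by move=> x; rewrite uE -eE mulrDl.
  have [ab|ab] := leP b a.
    apply: (single e (a - b)) => //; first by rewrite subr_ge0.
    by move=> x; rewrite uE eE pairingN; ring.
  apply: (single e' (b - a)) => //; first by rewrite subr_ge0 ltW.
  by move=> x; rewrite uE eE pairingN; ring.
have [[p [ep e'p]]|[w [al [be [al0 be0 wE [p [ep wp]] [p' [e'p' wp']]]]]]] :=
    common_tight D0 ee ee'.
  by exists v, e, e', p, a, b.
have wv : lam K w v = 0.
  apply/eqP; rewrite eq_le; apply/andP; split; last by apply: hv; apply/extremalP; exists p.
  by rewrite (le_trans (lam_combination v wE (ltW al0) (ltW be0)))// ev e'v !mulr0 addr0.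
(* If e and e' share no maximum point, the normal w between them is also minimal at v and shares one
   with each. The sign tells on which side of w the vector u lies, hence which of e', e is paired
   with w. *)
have [h|h] := leP (a * be) (b * al).
  exists v, w, e', p', (a / al), (b - a / al * be); split => //.
    split; first by rewrite divr_ge0// ltW.
    by rewrite subr_ge0 mulrAC ler_pdivrMr.
  by move=> x; rewrite wE uE; field; exact: lt0r_neq0.
exists v, e, w, p, (a - b / be * al), (b / be); split => //.
  split; last by rewrite divr_ge0// ltW.
  by rewrite subr_ge0 mulrAC ler_pdivrMr// ltW.
by move=> x; rewrite wE uE; field; exact: lt0r_neq0.
Qed.

Lemma Kne' : hat !=set0.
Proof. by have [x /interior_subset Kx] := K0; exists x; exact: sub_hat. Qed.

Lemma support_hat e : extremal e -> supp hat e = supp K e.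
Proof.
move=> ee; have [y hy yE] := support_attained e compact_hat Kne'.
have [z Kz zE] := support_attained e cK Kne.
apply/eqP; rewrite eq_le; apply/andP; split.
  by rewrite zE; apply: support_le; [exact: compact_hat|exact: sub_hat].
by rewrite yE -subr_ge0; exact: hy.
Qed.

Lemma lam_hat e x : extremal e -> lam hat e x = lam K e x.
Proof. by move=> ee; rewrite /lam support_hat. Qed.

(** Write u = a e + b e' as in [vertex_cone]. At the common vertex, [supp hat] is additive along
    this decomposition; at the common maximum point, m <= lam u <= (a + b) m, so a + b >= 1. Hence
    lam is at least (a + b) t >= t. *)
Lemma lam_hat_ge u t x : u != 0 -> 0 <= t -> (forall e, extremal e -> t <= lam K e x) ->
  t <= lam hat u x.
Proof.
move=> u0 t0 H.
have [v [e [e' [p [a [b [[hv vmin] [ev e'v] [ep e'p] [a0 b0] uE]]]]]]] := vertex_cone u0.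
have ee : extremal e by apply/extremalP; exists p.
have ee' : extremal e' by apply/extremalP; exists p.
have m0 := rho_max_gt0.
have ab1 : 1 <= a + b.
  have [_ tp epm] := ep; have [_ _ e'pm] := e'p.
  rewrite -(ler_pM2r m0) mul1r mulrDl (le_trans (top_ge tp u0))//.
  by have := lam_combination p uE a0 b0; rewrite epm e'pm.
have suE : supp hat u = a * supp K e + b * supp K e'.
  have : supp hat u = pairing u v.
    apply/eqP; rewrite eq_le; apply/andP; split.
      by apply: support_le => //; exact: compact_hat.
    by have [y hy ->] := support_attained u compact_hat Kne'; exact: vmin.
  by move=> ->; rewrite uE; move: ev e'v; rewrite /lam => h1 h2; congr (_ * _ + _ * _); lra.
rewrite /lam suE uE.
have h1 : a * t <= a * lam K e x by apply: ler_wpM2l => //; exact: H.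
have h2 : b * t <= b * lam K e' x by apply: ler_wpM2l => //; exact: H.
have h3 : t <= (a + b) * t by rewrite ler_peMl.
by move: h1 h2 h3; rewrite /lam; lra.
Qed.

Lemma le_rho_hat t x : 0 <= t -> (forall e, extremal e -> t <= lam K e x) ->
  t <= rho hat x.
Proof.
move=> t0 H; apply: le_rho => //; [exact: compact_hat|exact: convex_hat|exact: Kne'|].
by move=> u /primitive_neq0 u0; exact: lam_hat_ge.
Qed.

Lemma rho_hat_le e x : extremal e -> hat x -> rho hat x <= lam K e x.
Proof.
move=> ee hx; rewrite -lam_hat//; apply: rho_le_lam => //; first exact: compact_hat.
exact: extremal_primitive.
Qed.

(** If the distance exceeded m at x, then x - p would be an ascent direction at a maximum point
    p. *)
Lemma rho_hat_le_max x : rho hat x <= m.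
Proof.
rewrite leNgt; apply/negP => h.
have hx : hat x.
  by apply: interior_subset; apply: rho_gt0_int; [exact: compact_hat|exact: lt_trans rho_max_gt0 h].
have [p tp] := exists_top.
apply: (@tight_no_ascent p (x - p) (rho hat x - m) tp); first by rewrite subr_gt0.
move=> u ut; have eu : extremal u by apply/extremalP; exists p.
have := rho_hat_le eu hx; have [_ _ <-] := ut.
by rewrite pairing_sub /lam; lra.
Qed.

Lemma rho_max_hat : rho_max hat = m.
Proof.
have ub : ubound [set rho hat x | x in hat] m by move=> _ [x _ <-]; exact: rho_hat_le_max.
have [p tp] := exists_top; have hp := sub_hat (top_mem tp).
apply/eqP; rewrite eq_le; apply/andP; split.
  by apply: sup_le_ub => //; exists (rho hat p), p.
apply: (@le_trans _ _ (rho hat p)).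
  apply: le_rho_hat; first exact: ltW rho_max_gt0.
  by move=> e /extremal_primitive pe; exact: tp.
by apply: ub_le_sup; [exists m|exists p].
Qed.

End max_locus.

(** * Corners of the minimal model and Gamma-triangles *)

Lemma det_mx2 (A : 'M[int]_2) : \det A = A 0 0 * A 1 1 - A 0 1 * A 1 0.
Proof.
have E1 : lift ord0 ord0 = 1 :> 'I_2 by exact: val_inj.
have E2 : lift (1 : 'I_2) (0 : 'I_1) = 0 by exact: val_inj.
rewrite (expand_det_row _ 0) !big_ord_recl big_ord0 /cofactor !det_mx11 !mxE E1.
by rewrite E2 /= expr0 expr1 -[ord0]/(0 : 'I_2); ring.
Qed.

Section corners.
Variable R : realType.
Variable K : set (plane R).
Hypothesis cK : compact K.
Hypothesis vK : convex_set K.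
Hypothesis K0 : K^° !=set0.
Implicit Types (u w e f : int * int) (x y z p d v : plane R).

Let Kne : K !=set0.
Proof. by have [x /interior_subset Kx] := K0; exists x. Qed.

Local Notation m := (rho_max K).
Local Notation ext := (extremal K).
Local Notation hatK := (hat K).

Let chat : compact hatK := compact_hat cK vK K0.
Let vhat : convex_set hatK := @convex_hat _ K.

Lemma segment_interior x y t : K x -> K^° y -> 0 < t <= 1 ->
  K^° ((1 - t) * x.1 + t * y.1, (1 - t) * x.2 + t * y.2).
Proof.
move=> Kx Ky /andP[t0 t1]; have [r r0 Hr] := interior_lam_ge cK Ky.
apply: (@lam_ge_interior _ K _ (t * r)) => //; first by rewrite mulr_gt0.
move=> u; rewrite (_ : lam K u _ = (1 - t) * lam K u x + t * lam K u y); last first.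
  by rewrite /lam /pairing /=; ring.
have h1 : 0 <= (1 - t) * lam K u x by apply: mulr_ge0; [lra|exact: lam_ge0].
have h2 : t * (r * norm1 (vec R u)) <= t * lam K u y by apply: ler_wpM2l (Hr u); exact: ltW.
by rewrite -mulrA; lra.
Qed.

Lemma hat_boundary y : hatK y -> ~ hatK^° y -> exists2 e, ext e & lam K e y = 0.
Proof.
move=> hy nhy; apply: contrapT => H; apply: nhy.
have [s sE] := extremal_seq cK vK K0.
have [u us|t t0 Ht] := @exists_pos_lower_bound R _ s (fun e => lam K e y).
  have eu := (sE u).1 us; rewrite lt_neqAle hy// andbT eq_sym.
  by apply/eqP => h; apply: H; exists u.
apply: rho_gt0_int => //; apply: (lt_le_trans t0); apply: le_rho_hat => //.
  exact: ltW.
by move=> e /sE es; exact: Ht.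
Qed.

Lemma hat_not_interior e y : ext e -> lam K e y = 0 -> ~ hatK^° y.
Proof.
move=> ee ey hy; have := rho_interior chat vhat hy.
have := rho_hat_le cK vK K0 ee (interior_subset hy).
by rewrite ey => h1 h2; have := lt_le_trans h2 h1; rewrite ltxx.
Qed.

Lemma orthogonal_parallel u w d : d != 0 -> pairing u d = 0 -> pairing w d = 0 ->
  detz u w = 0.
Proof.
move=> d0 ud wd; apply/eqP; rewrite -(intr_eq0 R).
have h1 : (detz u w)%:~R * d.1 = 0.
  rewrite (_ : _ * _ = w.2%:~R * pairing u d - u.2%:~R * pairing w d).
    by rewrite ud wd !mulr0 subrr.
  by rewrite /detz /pairing rmorphB /= !rmorphM /=; ring.
have h2 : (detz u w)%:~R * d.2 = 0.
  rewrite (_ : _ * _ = u.1%:~R * pairing w d - w.1%:~R * pairing u d).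
    by rewrite ud wd !mulr0 subrr.
  by rewrite /detz /pairing rmorphB /= !rmorphM /=; ring.
apply/negPn/negP => D; move: d0; apply/negP; rewrite negbK; apply/eqP.
move: h1 h2 => /eqP + /eqP; rewrite !mulf_eq0 (negbTE D) /= => /eqP ? /eqP ?.
exact: injective_projections.
Qed.

(* A segment in the boundary of the minimal model lies on an extremal side. *)
Lemma side_extremal f (p q z : plane R) : primitive f -> hatK p -> hatK q -> hatK z ->
  p != q -> pairing f p = pairing f q -> pairing f p < pairing f z ->
  ~ hatK^° ((p.1 + q.1) / 2, (p.2 + q.2) / 2) -> ext f /\ lam K f p = 0.
Proof.
move=> pf hp hq hz pq fpq fpz nint.
have hy : hatK ((p.1 + q.1) / 2, (p.2 + q.2) / 2).
  rewrite (_ : (_, _) = (((1 - 1/2) * p.1 + 1/2 * q.1,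
                          (1 - 1/2) * p.2 + 1/2 * q.2) : plane R)).
    by apply: convex_setE => //; apply/andP; split; lra.
  by congr pair; field.
have [e ee ey] := hat_boundary hy nint.
have hep := hp e ee; have heq := hq e ee.
have sumE : lam K e p + lam K e q = 0.
  transitivity (2 * lam K e ((p.1 + q.1) / 2, (p.2 + q.2) / 2)); last by rewrite ey mulr0.
  by rewrite /lam /pairing /=; field.
have ep : lam K e p = 0 by lra.
have eq0 : lam K e q = 0 by lra.
have epq : pairing e (p - q) = 0 by rewrite pairing_sub; move: ep eq0; rewrite /lam; lra.
have fpq' : pairing f (p - q) = 0 by rewrite pairing_sub fpq subrr.
have D0 : detz e f = 0 by apply: orthogonal_parallel epq fpq'; rewrite subr_eq0.
have [ef|ef] := primitive_parallel (extremal_primitive ee) pf D0; first by rewrite -ef.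
exfalso; have := hz e ee; rewrite (lam_shift K e p z) ep add0r pairing_sub ef !pairingN.
lra.
Qed.

(** For vertices outside K the determinant is a unit by [outside_corner]; fixing it to 1 orients the
    pair and makes it unique for v. *)
Definition corner e e' v := [/\ detz e e' = 1, ext e, ext e' &
  [/\ hatK v, lam K e v = 0, lam K e' v = 0 & ~ K v]].

Lemma corner_det e e' v : corner e e' v -> detz e e' != 0.
Proof. by case=> ->. Qed.

Lemma corner_points e e' v : corner e e' v ->
  (exists2 q, K q & lam K e' q = 0 /\ 0 < lam K e q) /\
  (exists2 q, K q & lam K e q = 0 /\ 0 < lam K e' q).
Proof.
move=> c; have D0 := corner_det c; have [_ ee ee' [hv ev e'v nKv]] := c; split.
  have [q Kq qE] := support_attained e' cK Kne.
  have q0 : lam K e' q = 0 by rewrite /lam qE subrr.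
  exists q => //; split => //; rewrite lt_neqAle lam_ge0// andbT eq_sym.
  by apply/eqP => h; apply: nKv; rewrite (lam_eq0_corner D0 ev e'v h q0).
have [q Kq qE] := support_attained e cK Kne.
have q0 : lam K e q = 0 by rewrite /lam qE subrr.
exists q => //; split => //; rewrite lt_neqAle lam_ge0// andbT eq_sym.
by apply/eqP => h; apply: nKv; rewrite (lam_eq0_corner D0 ev e'v q0 h).
Qed.

Lemma combination_lam w (a b : R) e e' v x : combination w a e b e' ->
  lam K e v = 0 -> lam K e' v = 0 ->
  pairing w x - pairing w v = a * lam K e x + b * lam K e' x.
Proof.
move=> wE ev e'v; rewrite !wE; rewrite (lam_shift K e v x) (lam_shift K e' v x) ev e'v.
by rewrite !pairing_sub; ring.
Qed.

Lemma corner_strict_min e e' v w (a b : R) x : corner e e' v ->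
  combination w a e b e' -> 0 < a -> 0 < b -> hatK x -> pairing w x <= pairing w v -> x = v.
Proof.
move=> c wE a0 b0 hx; have D0 := corner_det c; have [_ ee ee' [hv ev e'v nKv]] := c.
rewrite -subr_le0 (combination_lam x wE ev e'v) => h.
have h1 := hx e ee; have h2 := hx e' ee'.
have h3 : 0 <= a * lam K e x by apply: mulr_ge0 => //; exact: ltW.
have h4 : 0 <= b * lam K e' x by apply: mulr_ge0 => //; exact: ltW.
have /eqP : a * lam K e x = 0 by lra.
have /eqP : b * lam K e' x = 0 by lra.
rewrite !mulf_eq0 (gt_eqF a0) (gt_eqF b0) /= => /eqP h5 /eqP h6.
exact: (lam_eq0_corner D0 h6 h5 ev e'v).
Qed.

Lemma integer_combination w e e' : detz e e' = 1 ->
  combination w ((detz w e')%:~R : R) e (detz e w)%:~R e'.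
Proof.
move=> D1; have := @cramer R w e e'; rewrite D1 !divr1; exact.
Qed.

Lemma combination_neq0 w (a b : R) e e' : combination w a e b e' -> w != 0 ->
  a = 0 -> b = 0 -> False.
Proof.
move=> wE /negP w0 a0 b0; apply: w0; apply/eqP.
have [h1 h2] := @pairing_coord R w.
apply: injective_projections; apply/eqP; rewrite -(intr_eq0 R).
  by rewrite -h1 wE a0 b0 !mul0r addr0.
by rewrite -h2 wE a0 b0 !mul0r addr0.
Qed.

(** Points of K on the two sides through v show that f has nonnegative coordinates in the basis e,
    e'; both positive would put v in K by [corner_mem]. *)
Lemma corner_other_normal e e' v f : corner e e' v -> ext f -> lam K f v = 0 ->
  f = e \/ f = e'.
Proof.
move=> c ef fv; have D0 := corner_det c; have [D1 ee ee' [hv ev e'v nKv]] := c.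
have [[q Kq [e'q eq]] [q' Kq' [eq' e'q']]] := corner_points c.
have fE := integer_combination f D1.
set a : int := detz f e' in fE; set b : int := detz e f in fE.
have a0 : 0 <= a.
  have : pairing f v <= pairing f q by rewrite -subr_ge0; move: (lam_ge0 f cK Kq) fv; rewrite /lam; lra.
  rewrite -subr_ge0 (combination_lam q fE ev e'v) e'q mulr0 addr0.
  by rewrite pmulr_lge0// ler0z.
have b0 : 0 <= b.
  have : pairing f v <= pairing f q' by rewrite -subr_ge0; move: (lam_ge0 f cK Kq') fv; rewrite /lam; lra.
  rewrite -subr_ge0 (combination_lam q' fE ev e'v) eq' mulr0 add0r.
  by rewrite pmulr_lge0// ler0z.
have pf := extremal_primitive ef; have pe := extremal_primitive ee; have pe' := extremal_primitive ee'.
have nz := combination_neq0 fE (primitive_neq0 pf).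
have [a00|an0] := eqVneq a 0.
  right; have fe' : detz f e' = 0 by [].
  have [//|fN] := primitive_parallel pf pe' fe'; exfalso.
  move: b0; rewrite /b fN /detz /=; move: D1; rewrite /detz; lia.
have [b00|bn0] := eqVneq b 0.
  left; have fe' : detz f e = 0 by move: b00; rewrite /b /detz; lia.
  have [//|fN] := primitive_parallel pf pe fe'; exfalso.
  move: a0; rewrite /a fN /detz /=; move: D1; rewrite /detz; lia.
exfalso; apply: nKv; apply: (corner_mem cK K0 D0 ef fE) => //; rewrite ltr0z; lia.
Qed.

Lemma corner_unique e e' f f' v : corner e e' v -> corner f f' v -> e = f /\ e' = f'.
Proof.
move=> c c'; have [D1 _ _ _] := c; have [D1' ef ef' [_ fv f'v _]] := c'.
have h1 := corner_other_normal c ef fv; have h2 := corner_other_normal c ef' f'v.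
case: h1 h2 => h1 [] h2; rewrite h1 h2 in D1' *; move: D1 D1'; rewrite /detz => *;
  by [split|lia].
Qed.

(** The chart-free form of [f_Gamma], see [f_GammaE]; superadditivity of the support gives its
    sign. *)
Definition gap u w : R := supp K (u + w) - supp K u - supp K w.

Lemma gap_lam u w x : gap u w = lam K u x + lam K w x - lam K (u + w) x.
Proof. by rewrite /gap /lam pairingD; ring. Qed.

Lemma gap_ge0 u w : 0 <= gap u w.
Proof. by have [x Kx] := Kne; rewrite (gap_lam u w x) subr_ge0; exact: lamD. Qed.

(** At a common maximum point lam e = lam e' = m, whereas lam (e + e') >= m. *)
Lemma corner_gap_le e e' v : corner e e' v -> gap e e' <= m.
Proof.
move=> c; have D0 := corner_det c; have [D1 ee ee' [hv ev e'v nKv]] := c.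
have [[p [[_ tp ep] [_ _ e'p]]] _] := outside_corner cK vK K0 D0 ee ee' hv ev e'v nKv.
rewrite (gap_lam e e' p) ep e'p lerBlDr lerD2l; apply: (top_ge cK vK K0 tp).
apply/eqP => ee0; move: D1.
have -> : e' = - e by apply/eqP; rewrite -addr_eq0 addrC ee0.
by rewrite /detz /=; lia.
Qed.

Definition normal1 (T : gamma_triangle R) : int * int := (gt_A T 0 0, gt_A T 0 1).
Definition normal2 (T : gamma_triangle R) : int * int := (gt_A T 1 0, gt_A T 1 1).

Section one_triangle.
Variable T : gamma_triangle R.
Local Notation e1 := (normal1 T).
Local Notation e2 := (normal2 T).

Lemma detz_normals : detz e1 e2 = 1.
Proof.
by rewrite -(gt_detA T) det_mx2.
Qed.

Lemma chartE x : chart T x = (pairing e1 x + (gt_t T).1, pairing e2 x + (gt_t T).2).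
Proof. by []. Qed.

Lemma chart_surj (X Y : R) : exists x, chart T x = (X, Y).
Proof.
have D := detz_normals; rewrite /detz /normal1 /normal2 /= in D.
have DR : (gt_A T 0 0)%:~R * (gt_A T 1 1)%:~R - (gt_A T 0 1)%:~R * (gt_A T 1 0)%:~R = 1 :> R.
  by rewrite -!intrM -intrB D.
exists (((X - (gt_t T).1) * (gt_A T 1 1)%:~R - (Y - (gt_t T).2) * (gt_A T 0 1)%:~R,
         (Y - (gt_t T).2) * (gt_A T 0 0)%:~R - (X - (gt_t T).1) * (gt_A T 1 0)%:~R) : plane R).
rewrite /chart /pairing /=; move: DR.
set a := (gt_A T 0 0)%:~R; set b := (gt_A T 0 1)%:~R; set c := (gt_A T 1 0)%:~R.
set d := (gt_A T 1 1)%:~R => DR; congr pair.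
  transitivity ((X - (gt_t T).1) * (a * d - b * c) + (gt_t T).1); first by ring.
  by rewrite DR; ring.
transitivity ((Y - (gt_t T).2) * (a * d - b * c) + (gt_t T).2); first by ring.
by rewrite DR; ring.
Qed.

Lemma normals_primitive : primitive e1 /\ primitive e2.
Proof.
have D := detz_normals; split; apply/coprimezP.
  by exists (e2.2, - e2.1); move: D; rewrite /detz /=; lia.
by exists (- e1.2, e1.1); move: D; rewrite /detz /=; lia.
Qed.

Local Notation r := (gt_r T).
Local Notation hgt := (gt_u T).
Local Notation g := (gt_g T).

Lemma g_bounds X : 0 <= X <= r -> 0 <= g X <= hgt.
Proof. by move=> h; have := @gt_g_range _ T X; rewrite !in_itv/=; apply. Qed.

Hypothesis Hreg : region T `<=` closure (hatK `\` K).
Hypothesis Harc : garc T `<=` boundary K.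
Hypothesis Hsides : sides T `<=` boundary hatK.

Lemma region_hat x : region T x -> hatK x.
Proof.
move=> /Hreg /(closureI (A := hatK)) [h _]; move: h.
by rewrite -(closure_id _).1//; exact: closed_hat.
Qed.

Lemma region_not_interior x : region T x -> ~ K^° x.
Proof.
move=> /Hreg h Kx; have [|y [[_ nKy] /interior_subset //]] := h (K^°).
by apply: open_nbhs_nbhs; split => //; exact: open_interior.
Qed.

Lemma region_chart x X Y : chart T x = (X, Y) -> 0 <= X <= r -> 0 <= Y <= g X -> region T x.
Proof.
by move=> cx h1 h2; rewrite /region /preimage /normal_region /mkset cx /= !in_itv/=.
Qed.

Lemma arc_chart x X : chart T x = (X, g X) -> 0 <= X <= r -> garc T x.
Proof.
by move=> cx h1; rewrite /Defs.arc /preimage /normal_arc /mkset cx /= !in_itv/=.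
Qed.

Lemma arc_mem x X : chart T x = (X, g X) -> 0 <= X <= r -> K x.
Proof.
move=> cx h1; have [h _] := Harc (arc_chart cx h1).
by rewrite (closure_id K).1//; exact: compact_closed.
Qed.

Lemma triangle_vertices : exists z0 p q, [/\ chart T z0 = (0, 0), chart T p = (r, 0),
  chart T q = (0, hgt) & [/\ hatK z0, hatK p, hatK q, K p & K q]].
Proof.
have r0 := gt_r_gt0 T; have u0 := gt_u_gt0 T.
have [z0 z0E] := chart_surj 0 0; have [p pE] := chart_surj r 0.
have [q qE] := chart_surj 0 hgt.
have b0 : (0 : R) <= 0 <= r by rewrite lexx ltW.
have br : (0 : R) <= r <= r by rewrite lexx ltW.
have /andP[g0 _] := g_bounds b0.
have Kp : K p by apply: (@arc_mem p r) => //; rewrite gt_gr.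
have Kq : K q by apply: (@arc_mem q 0) => //; rewrite gt_g0.
exists z0, p, q; split => //; split => //; try exact: sub_hat.
by apply/region_hat/(region_chart z0E b0); rewrite lexx.
Qed.

(** The straight sides lie on the boundary of the model, so [side_extremal], applied to their
    midpoints, makes both row vectors extremal and determines the translation. The chart is thus
    intrinsic. *)
Lemma normals_extremal : [/\ ext e1, ext e2 &
  forall x, chart T x = (lam K e1 x, lam K e2 x)].
Proof.
have [z0 [p [q [z0E pE qE [ho hp hq Kp Kq]]]]] := triangle_vertices.
have [pe1 pe2] := normals_primitive.
have r0 := gt_r_gt0 T; have u0 := gt_u_gt0 T.
have [z01 z02] : pairing e1 z0 = - (gt_t T).1 /\ pairing e2 z0 = - (gt_t T).2.
  by move: z0E; rewrite chartE => -[/eqP + /eqP]; rewrite !addr_eq0 => /eqP -> /eqP ->.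
have [p1 p2] : pairing e1 p = r - (gt_t T).1 /\ pairing e2 p = - (gt_t T).2.
  by move: pE; rewrite chartE => -[h1 h2]; split; lra.
have [q1 q2] : pairing e1 q = - (gt_t T).1 /\ pairing e2 q = hgt - (gt_t T).2.
  by move: qE; rewrite chartE => -[h1 h2]; split; lra.
have op : z0 != p by apply/eqP => E; move: p1; rewrite -E z01; lra.
have oq : z0 != q by apply/eqP => E; move: q2; rewrite -E z02; lra.
have mid f x y : pairing f ((x.1 + y.1) / 2, (x.2 + y.2) / 2) = (pairing f x + pairing f y) / 2.
  by rewrite /pairing /=; field.
have [] := @side_extremal e2 z0 p q pe2 ho hp hq op.
- by rewrite z02 p2.
- by rewrite z02 q2; lra.
- have [] // : boundary hatK ((z0.1 + p.1) / 2, (z0.2 + p.2) / 2).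
  apply: Hsides; left; rewrite chartE /= !mid z01 z02 p1 p2 in_itv/=.
  by split; [apply/andP; split; lra|lra].
move=> ee2 oe2.
have [] := @side_extremal e1 z0 q p pe1 ho hq hp oq.
- by rewrite z01 q1.
- by rewrite z01 p1; lra.
- have [] // : boundary hatK ((z0.1 + q.1) / 2, (z0.2 + q.2) / 2).
  apply: Hsides; right; rewrite chartE /= !mid z01 z02 q1 q2 in_itv/=.
  by split; [lra|apply/andP; split; lra].
move=> ee1 oe1; split => // x.
rewrite chartE (lam_shift K e1 z0) (lam_shift K e2 z0) oe1 oe2 !pairing_sub z01 z02.
by congr pair; lra.
Qed.

Lemma g_cont X : 0 <= X <= r -> forall c, c < g X ->
  exists2 d : R, 0 < d & forall X', 0 <= X' <= r -> `|X' - X| < d -> c < g X'.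
Proof.
move=> hX c cg; have /subspace_continuousP := @gt_g_cont _ T.
have hX' : X \in `[0, r] by rewrite in_itv.
move=> /(_ X hX') /cvgrPdist_lt /(_ (g X - c)); rewrite subr_gt0 => /(_ cg).
rewrite near_withinE => /nbhs_ballP[d d0 Hd]; exists d => // X' X'r dX.
have : `|g X - g X'| < g X - c.
  by apply: Hd; rewrite /= ?in_itv//= /ball /= distrC.
by rewrite ltr_norml => /andP[_]; lra.
Qed.

(* Otherwise [K] would contain interior points below the arc. *)
Lemma arc_below q : K q -> lam K e1 q <= r -> g (lam K e1 q) <= lam K e2 q.
Proof.
move=> Kq qr; have [ee1 ee2 cE] := normals_extremal.
have r0 := gt_r_gt0 T; have u0 := gt_u_gt0 T.
rewrite leNgt; apply/negP => h.
have q1 := lam_ge0 e1 cK Kq; have q2 := lam_ge0 e2 cK Kq.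
have qr' : lam K e1 q < r.
  rewrite lt_neqAle qr andbT; apply/eqP => E; move: h; rewrite E gt_gr.
  by rewrite ltNge q2.
have hX : 0 <= lam K e1 q <= r by rewrite q1.
have [d d0 Hd] := @g_cont _ hX ((lam K e2 q + g (lam K e1 q)) / 2) ltac:(lra).
have [k Kk] := K0; have Kk' := interior_subset Kk.
have k1 := lam_ge0 e1 cK Kk'; have k2 := lam_ge0 e2 cK Kk'.
pose D1 := lam K e1 k - lam K e1 q; pose D2 := lam K e2 k - lam K e2 q.
pose c1 := Num.min d (Num.min (r - lam K e1 q) ((g (lam K e1 q) - lam K e2 q) / 2)).
have c10 : 0 < c1.
  by rewrite !lt_min d0 subr_gt0 qr' /= divr_gt0// subr_gt0.
pose t := Num.min 1 (c1 / (2 * (1 + `|D1| + `|D2|))).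
have n1 := normr_ge0 D1; have n2 := normr_ge0 D2.
have den : 0 < 2 * (1 + `|D1| + `|D2|) by rewrite mulr_gt0//; lra.
have t0 : 0 < t by rewrite lt_min ltr01 divr_gt0.
have t1 : t <= 1 by rewrite ge_min lexx.
have tc : t * (2 * (1 + `|D1| + `|D2|)) <= c1.
  by rewrite -ler_pdivlMr// /t ge_min lexx orbT.
have tD1 : `|t * D1| < c1.
  rewrite normrM gtr0_norm// (lt_le_trans _ tc)//.
  by have := mulr_ge0 (ltW t0) n2; have := mulr_ge0 (ltW t0) n1; lra.
have tD2 : `|t * D2| < c1.
  rewrite normrM gtr0_norm// (lt_le_trans _ tc)//.
  by have := mulr_ge0 (ltW t0) n2; have := mulr_ge0 (ltW t0) n1; lra.
have [cd [cr cg]] : c1 <= d /\ (c1 <= r - lam K e1 q /\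
    c1 <= (g (lam K e1 q) - lam K e2 q) / 2).
  by rewrite /c1 !ge_min !lexx !orbT.
pose z : plane R := ((1 - t) * q.1 + t * k.1, (1 - t) * q.2 + t * k.2).
have Kz : K^° z by apply: segment_interior => //; rewrite t0.
have zE f : lam K f z = lam K f q + t * (lam K f k - lam K f q).
  by rewrite /lam /z /pairing /=; ring.
have z1 : lam K e1 z = lam K e1 q + t * D1 by exact: zE.
have z2 : lam K e2 z = lam K e2 q + t * D2 by exact: zE.
have Kz' := interior_subset Kz.
have z10 := lam_ge0 e1 cK Kz'; have z20 := lam_ge0 e2 cK Kz'.
move: tD1 tD2; rewrite !ltr_norml => /andP[a1 a2] /andP[b1 b2].
have zr : 0 <= lam K e1 z <= r by rewrite z10 /= z1; lra.
apply: (region_not_interior _ Kz); apply: (region_chart (cE z) zr).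
rewrite z20 ltW//; apply: (@lt_trans _ _ ((lam K e2 q + g (lam K e1 q)) / 2)).
  by rewrite z2; lra.
apply: Hd => //; rewrite z1 addrC addKr; rewrite ltr_norml; apply/andP; split; lra.
Qed.

Lemma triangle_corner : exists2 v, corner e1 e2 v & region T v.
Proof.
have [ee1 ee2 cE] := normals_extremal.
have [z0 [p [q [z0E pE qE [ho hp hq Kp Kq]]]]] := triangle_vertices.
have r0 := gt_r_gt0 T; have u0 := gt_u_gt0 T.
have b0 : (0 : R) <= 0 <= r by rewrite lexx ltW.
move: (z0E); rewrite cE => -[z01 z02].
exists z0; last by apply: (region_chart z0E b0); rewrite lexx gt_g0 ltW.
split => //; first exact: detz_normals.
split => // Ko; have := arc_below Ko; rewrite z01 z02 gt_g0 => /(_ (ltW r0)).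
by rewrite leNgt u0.
Qed.

(** A functional with nonnegative coefficients has the same minimum on the arc as on K: a point q of
    K is dominated by the point of the arc with the same abscissa, or by (r, 0) if its abscissa
    exceeds r. *)
Lemma gammaE (a b : nat) : gamma T a b =
  supp K (e1 *+ a + e2 *+ b) + (gt_t T).1 *+ a + (gt_t T).2 *+ b.
Proof.
have [ee1 ee2 cE] := normals_extremal.
have r0 := gt_r_gt0 T; have u0 := gt_u_gt0 T.
have pE x : pairing (e1 *+ a + e2 *+ b) x + (gt_t T).1 *+ a + (gt_t T).2 *+ b =
    pairing (a%:Z, b%:Z) (chart T x).
  rewrite chartE pairingD !pairingMn.
  rewrite -(mulr_natl (pairing e1 x)) -(mulr_natl (pairing e2 x)).
  rewrite -(mulr_natl (gt_t T).1) -(mulr_natl (gt_t T).2).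
  by rewrite [RHS]/pairing /= -!pmulrn; ring.
set w := e1 *+ a + e2 *+ b in pE *.
have [q Kq qE] := support_attained w cK Kne.
have lb y : normal_arc T y -> supp K w + (gt_t T).1 *+ a + (gt_t T).2 *+ b <=
    pairing (a%:Z, b%:Z) y.
  move=> [y1 y2]; have [x xE] := chart_surj y.1 y.2.
  have xE' : chart T x = y by rewrite xE -surjective_pairing.
  rewrite -xE' -pE 2!lerD2r; apply: support_le => //.
  by apply: (@arc_mem x y.1); rewrite ?xE ?y2//; move: y1; rewrite in_itv.
have q1 := lam_ge0 e1 cK Kq; have q2 := lam_ge0 e2 cK Kq.
have [y Ny yq] : exists2 y, normal_arc T y & pairing (a%:Z, b%:Z) y <= pairing (a%:Z, b%:Z) (chart T q).
  have [qr|rq] := leP (lam K e1 q) r.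
    exists (lam K e1 q, g (lam K e1 q)); first by split => //=; rewrite in_itv/= q1.
    by rewrite cE /pairing /= lerD2l ler_wpM2l// arc_below.
  exists (r, g r); first by split => //=; rewrite in_itv/= lexx ltW.
  by rewrite cE gt_gr /pairing /= mulr0; apply: lerD; rewrite ?mulr_ge0// ler_wpM2l// ltW.
apply/eqP; rewrite eq_le /gamma; apply/andP; split.
  rewrite qE pE (le_trans _ yq)//; apply: ge_inf; last by exists y.
  by exists (supp K w + (gt_t T).1 *+ a + (gt_t T).2 *+ b) => _ [z Nz <-]; exact: lb.
apply: lb_le_inf; first by exists (pairing (a%:Z, b%:Z) y), y.
by move=> _ [z Nz <-]; exact: lb.
Qed.

Lemma f_GammaE (a b c d : nat) : f_Gamma T a b c d =
  gap (e1 *+ a + e2 *+ b) (e1 *+ c + e2 *+ d).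
Proof.
rewrite /f_Gamma !gammaE.
have wE : e1 *+ (a + c) + e2 *+ (b + d) = (e1 *+ a + e2 *+ b) + (e1 *+ c + e2 *+ d).
  by rewrite !mulrnDr addrACA.
rewrite wE; set g0 := gap _ _; rewrite (_ : _ - _ = - g0).
  by rewrite normrN ger0_norm// gap_ge0.
by rewrite /g0 /gap !mulrnDr; ring.
Qed.

(** As v is outside K, it lies strictly below the arc and to the left of r. Comparing v with the
    point of the arc above it gives the second coefficient nonnegative, then comparing it with the
    end (r, 0) gives the first. *)
Lemma triangle_min_cone u v : hatK v -> (forall x, hatK x -> pairing u v <= pairing u x) ->
  ~ K v -> region T v -> exists a b : nat, u = e1 *+ a + e2 *+ b.
Proof.
move=> hv vmin nKv rv; have [ee1 ee2 cE] := normals_extremal.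
have r0 := gt_r_gt0 T; have u0 := gt_u_gt0 T.
have uE := integer_combination u detz_normals.
set al : int := detz u e2 in uE; set be : int := detz e1 u in uE.
have dE x : pairing u x - pairing u v = al%:~R * (lam K e1 x - lam K e1 v) +
    be%:~R * (lam K e2 x - lam K e2 v) by rewrite !uE /lam; ring.
move: (rv); rewrite /region /preimage /normal_region /mkset cE /= !in_itv/= => -[Xr /andP[Y0 Yg]].
have Yg' : lam K e2 v < g (lam K e1 v).
  rewrite lt_neqAle Yg andbT; apply/eqP => E; apply: nKv.
  by apply: (@arc_mem v (lam K e1 v)) => //; rewrite cE E.
have Xr' : lam K e1 v < r.
  have /andP[_ h] := Xr; rewrite lt_neqAle h andbT; apply/eqP => E.
  by move: Yg'; rewrite E gt_gr ltNge Y0.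
have [x1 x1E] := chart_surj (lam K e1 v) (g (lam K e1 v)).
have hx1 : hatK x1.
  by apply: region_hat; apply: (region_chart x1E) => //; rewrite lexx (le_trans Y0).
have [_ [p [_ [_ pE _ [_ hp _ _ _]]]]] := triangle_vertices.
move: x1E pE; rewrite !cE => -[x11 x12] [p1 p2].
have b0 : 0 <= be.
  have := vmin _ hx1; rewrite -subr_ge0 dE x11 x12 subrr mulr0 add0r.
  by rewrite pmulr_lge0 ?subr_gt0// ler0z.
have a0 : 0 <= al.
  have := vmin _ hp; rewrite -subr_ge0 dE p1 p2 sub0r mulrN.
  have h : 0 <= be%:~R * lam K e2 v by apply: mulr_ge0; rewrite ?ler0z.
  move=> h'; have : 0 <= al%:~R * (r - lam K e1 v) by lra.
  by rewrite pmulr_lge0 ?subr_gt0// ler0z.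
have D := detz_normals.
exists (absz al), (absz be); rewrite !pair_mulrn /=.
have mulrn_absz (x c : int) : 0 <= c -> x *+ `|c|%N = x * c.
  by move=> c0; rewrite -mulr_natr natz gez0_abs.
rewrite !mulrn_absz// /al /be.
apply: injective_projections => /=.
  by transitivity (u.1 * detz e1 e2); [rewrite D mulr1|rewrite /detz /=; ring].
by transitivity (u.2 * detz e1 e2); [rewrite D mulr1|rewrite /detz /=; ring].
Qed.

(** Serves to show that two triangles with the same corner overlap. *)
Lemma region_near_corner : exists2 c : R, 0 < c &
  forall c' x, 0 < c' <= c -> chart T x = (c', c') -> (region T)^° x.
Proof.
have [ee1 ee2 cE] := normals_extremal.
have r0 := gt_r_gt0 T; have u0 := gt_u_gt0 T.
have b0 : (0 : R) <= 0 <= r by rewrite lexx ltW.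
have [d d0 Hd] := @g_cont 0 b0 (hgt / 2) ltac:(rewrite gt_g0; lra).
(* Around (c, c) the coordinates stay within [0, 2 c], so 2 c < d, 2 c <= r and 2 c <= [hgt] / 2 are
   needed. *)
exists (Num.min (d / 3) (Num.min (r / 2) (hgt / 4))).
  by rewrite !lt_min !divr_gt0.
move=> c x /andP[c0]; rewrite !le_min => /andP[cd /andP[cr cu]].
rewrite cE => -[x1 x2].
have n1 := norm1_ge0 (vec R e1); have n2 := norm1_ge0 (vec R e2).
have den : 0 < 1 + norm1 (vec R e1) + norm1 (vec R e2) by lra.
pose rad := c / (1 + norm1 (vec R e1) + norm1 (vec R e2)).
have rad0 : 0 < rad by rewrite divr_gt0.
have radE : rad * (1 + norm1 (vec R e1) + norm1 (vec R e2)) = c.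
  by rewrite divfK// gt_eqF.
apply/interiorP; exists rad => // y y1 y2.
have b1 := @rpairing_norm1 R (vec R e1) (y - x) rad (ltW y1) (ltW y2).
have b2 := @rpairing_norm1 R (vec R e2) (y - x) rad (ltW y1) (ltW y2).
have m1 := mulr_ge0 (ltW rad0) n1; have m2 := mulr_ge0 (ltW rad0) n2.
have l1 := lam_shift K e1 x y; have l2 := lam_shift K e2 x y.
rewrite x1 in l1; rewrite x2 in l2.
move: b1 b2; rewrite -!pairingE !ler_norml => /andP[b1 b1'] /andP[b2 b2'].
have Y1 : 0 <= lam K e1 y <= r by apply/andP; split; lra.
apply: (region_chart (cE y) Y1); apply/andP; split; first lra.
apply: ltW; apply: (@le_lt_trans _ _ (hgt / 2)); first lra.
apply: Hd => //; rewrite subr0 ger0_norm; lra.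
Qed.

End one_triangle.

Section decomposition.
Variables (n : nat) (T : 'I_n -> gamma_triangle R).
Hypothesis HT : gamma_decomposition K T.

Let Hreg i : region (T i) `<=` closure (hatK `\` K).
Proof.
have [+ _ _ _] := HT; rewrite minimal_modelE => ->.
by move=> x xi; exists i.
Qed.

Let Harc i : garc (T i) `<=` boundary K.
Proof. by have [_ + _ _] := HT. Qed.

Let Hsides i : sides (T i) `<=` boundary hatK.
Proof. by have [_ _ + _] := HT; rewrite minimal_modelE. Qed.

Local Notation E1 i := (normal1 (T i)).
Local Notation E2 i := (normal2 (T i)).

Lemma decomposition_corner i : exists2 v, corner (E1 i) (E2 i) v & region (T i) v.
Proof. exact: (triangle_corner (@Hreg i) (@Harc i) (@Hsides i)). Qed.

Lemma decomposition_f_Gamma i (a b c d : nat) : f_Gamma (T i) a b c d =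
  gap (E1 i *+ a + E2 i *+ b) (E1 i *+ c + E2 i *+ d).
Proof. exact: (f_GammaE (@Hreg i) (@Harc i) (@Hsides i)). Qed.

(** Where u is minimal on the model: at a point of K nothing is lost in passing to K, and a point
    outside K lies in a triangle whose cone contains u by [triangle_min_cone]. *)
Lemma decomposition_cover u : u != 0 -> supp hatK u = supp K u \/
  exists i (a b : nat), u = E1 i *+ a + E2 i *+ b.
Proof.
move=> u0; have [v hv vE] := support_attained u chat (Kne' cK K0).
have vmin x : hatK x -> pairing u v <= pairing u x by rewrite -vE; exact: support_le.
have [Kv|nKv] := pselect (K v).
  left; apply/eqP; rewrite eq_le; apply/andP; split.
    have [y Ky ->] := support_attained u cK Kne.
    by apply: support_le => //; exact: sub_hat.
  by rewrite vE; exact: support_le.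
right; have [i _ ri] : (\bigcup_i region (T i)) v.
  have [<- _ _ _] := HT; rewrite minimal_modelE.
  by apply: subset_closure.
have [a [b uE]] := triangle_min_cone (@Hreg i) (@Harc i) (@Hsides i) hv vmin nKv ri.
by exists i, a, b.
Qed.

Lemma natural_combination (e e' : int * int) (a b : nat) :
  combination (e *+ a + e' *+ b) (a%:R : R) e b%:R e'.
Proof. by move=> x; rewrite pairingD !pairingMn !mulr_natl. Qed.

(** A normal in the open cone of triangle i is minimal on the model at the corner of i only. If it
    also lies in the closed cone of j, the corners coincide, hence the charts, and both interiors
    contain points near that corner. *)
Lemma decomposition_disjoint i j (a b a' b' : nat) : i != j -> (0 < a)%N -> (0 < b)%N ->
  E1 i *+ a + E2 i *+ b = E1 j *+ a' + E2 j *+ b' -> False.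
Proof.
move=> ij a0 b0 wE.
have [v cv _] := decomposition_corner i; have [v' cv' _] := decomposition_corner j.
have wi := natural_combination (E1 i) (E2 i) a b.
have wj := natural_combination (E1 j) (E2 j) a' b'; rewrite -wE in wj.
have [_ e1j e2j [hv' e1v' e2v' nKv']] := cv'.
have [_ e1i e2i [hv e1v e2v nKv]] := cv.
have le : pairing (E1 i *+ a + E2 i *+ b) v' <= pairing (E1 i *+ a + E2 i *+ b) v.
  rewrite -subr_ge0 (combination_lam v wj e1v' e2v').
  by rewrite addr_ge0// mulr_ge0//; [exact: hv|exact: hv].
have vv : v' = v.
  by apply: (corner_strict_min cv wi) => //; rewrite ltr0n.
rewrite vv in cv'; have [eq1 eq2] := corner_unique cv cv'.
have [_ _ ci] := normals_extremal (@Hreg i) (@Harc i) (@Hsides i).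
have [_ _ cj] := normals_extremal (@Hreg j) (@Harc j) (@Hsides j).
have cc x : chart (T i) x = chart (T j) x by rewrite ci cj eq1 eq2.
have [c c0 Hc] := region_near_corner (@Hreg i) (@Harc i) (@Hsides i).
have [c' c'0 Hc'] := region_near_corner (@Hreg j) (@Harc j) (@Hsides j).
pose d := Num.min c c'.
have [x xE] := chart_surj (T i) d d.
have d0 : 0 < d by rewrite lt_min c0.
have [_ _ _ /(_ i j ij) dis] := HT.
suff : ((region (T i))^° `&` (region (T j))^°) x by rewrite dis.
split.
  by apply: (Hc d) => //; rewrite d0 ge_min lexx.
by apply: (Hc' d) => //; rewrite -?cc// d0 ge_min lexx orbT.
Qed.

End decomposition.

End corners.

(** * Existence of the decomposition *)

Section existence.
Variable R : realType.
Variable K : set (plane R).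
Hypothesis cK : compact K.
Hypothesis vK : convex_set K.
Hypothesis K0 : K^° !=set0.
Implicit Types (u w f : int * int) (x y z p q d : plane R).

Let Kne : K !=set0.
Proof. by have [x /interior_subset Kx] := K0; exists x. Qed.

Local Notation ext := (extremal K).
Local Notation hatK := (hat K).

Let chat : compact hatK := compact_hat cK vK K0.
Let vhat : convex_set hatK := @convex_hat _ K.

Lemma slice_min f f' (c : R) : (exists2 q, K q & lam K f q = c) ->
  exists q, [/\ K q, lam K f q = c &
    forall q', K q' -> lam K f q' = c -> lam K f' q <= lam K f' q'].
Proof.
move=> [q0 Kq0 q0c]; pose S := K `&` [set q | lam K f q = c].
have cS : compact S.
  apply: compact_closedI => //.
  have /continuous_closedP h := @continuous_lam _ K f.
  by apply: (h [set t : R | t = c]); exact: closed_eq.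
have [q [Kq qc] qmin] := compact_rpairing_min (vec R f') cS (ex_intro _ q0 (conj Kq0 q0c)).
exists q; split => // q' Kq' q'c; rewrite /lam lerD2r; exact: qmin.
Qed.

Lemma lam_convex f x y (t : R) : lam K f ((1 - t) * x.1 + t * y.1, (1 - t) * x.2 + t * y.2) =
  (1 - t) * lam K f x + t * lam K f y.
Proof. by rewrite /lam /pairing /=; ring. Qed.

Section corner_triangle.
Variables (e e' : int * int) (v : plane R).
Hypothesis Hc : corner K e e' v.

Local Notation X := (lam K e).
Local Notation Y := (lam K e').

Let X0 q : K q -> 0 <= X q.
Proof. exact: lam_ge0. Qed.
Let Y0 q : K q -> 0 <= Y q.
Proof. exact: lam_ge0. Qed.

Definition lower_graph (c : R) : R := inf [set Y q | q in K `&` [set q | X q = c]].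

(** Here r and h locate the first points of K on the two sides, positive since v is outside K. The
    segment between these two points meets every slice X = c with 0 <= c <= r. *)
Lemma corner_bounds : exists r h : R, [/\ 0 < r, 0 < h,
  (exists2 p, K p & X p = r /\ Y p = 0) /\ (forall q, K q -> Y q = 0 -> r <= X q),
  (exists2 p, K p & X p = 0 /\ Y p = h) /\ (forall q, K q -> X q = 0 -> h <= Y q) &
  forall c, 0 <= c <= r -> exists q, [/\ K q, X q = c, Y q = lower_graph c &
    forall q', K q' -> X q' = c -> lower_graph c <= Y q']].
Proof.
have D0 := corner_det Hc; have [D1 ee ee' [hv ev e'v nKv]] := Hc.
have [[q1 Kq1 [q1Y q1X]] [q2 Kq2 [q2X q2Y]]] := corner_points cK K0 Hc.
have [p [Kp pY pmin]] := @slice_min e' e 0 (ex_intro2 _ _ q1 Kq1 q1Y).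
have [p' [Kp' pX' pmin']] := @slice_min e e' 0 (ex_intro2 _ _ q2 Kq2 q2X).
have p0 : 0 < X p.
  rewrite lt_neqAle X0// andbT eq_sym; apply/eqP => h; apply: nKv.
  by rewrite (lam_eq0_corner D0 ev e'v h pY).
have p'0 : 0 < Y p'.
  rewrite lt_neqAle Y0// andbT eq_sym; apply/eqP => h; apply: nKv.
  by rewrite (lam_eq0_corner D0 ev e'v pX' h).
exists (X p), (Y p'); split => //; [by split; [exists p|]|by split; [exists p'|]|].
move=> c /andP[c0 cp].
have [|q [Kq qc qmin]] := @slice_min e e' c.
  exists ((1 - c / X p) * p'.1 + c / X p * p.1, (1 - c / X p) * p'.2 + c / X p * p.2).
    by apply: convex_setE => //; rewrite divr_ge0 ?(ltW p0)// ler_pdivrMr// mul1r.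
  by rewrite lam_convex pX' mulr0 add0r divfK// gt_eqF.
have qE : Y q = lower_graph c.
  apply/eqP; rewrite eq_le; apply/andP; split.
    apply: lb_le_inf; first by exists (Y q), q.
    by move=> _ [q' [Kq' q'c] <-]; exact: qmin.
  apply: ge_inf; last by exists q.
  by exists (Y q) => _ [q' [Kq' q'c] <-]; exact: qmin.
by exists q; split => //; rewrite -qE.
Qed.

Section with_bounds.
Variables r h : R.
Hypothesis r0 : 0 < r.
Hypothesis h0 : 0 < h.
Hypothesis Hp : (exists2 p, K p & X p = r /\ Y p = 0) /\ (forall q, K q -> Y q = 0 -> r <= X q).
Hypothesis Hq : (exists2 p, K p & X p = 0 /\ Y p = h) /\ (forall q, K q -> X q = 0 -> h <= Y q).
Hypothesis Hg : forall c, 0 <= c <= r -> exists q, [/\ K q, X q = c, Y q = lower_graph c &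
    forall q', K q' -> X q' = c -> lower_graph c <= Y q'].

Local Notation g := lower_graph.

Lemma lower_graph_ends : g 0 = h /\ g r = 0.
Proof.
have [[p Kp [pX pY]] pmin] := Hp; have [[p' Kp' [p'X p'Y]] p'min] := Hq.
have [|q [Kq qX qY qmin]] := Hg (c := 0); first by rewrite lexx ltW.
have [|q' [Kq' q'X q'Y q'min]] := Hg (c := r); first by rewrite lexx ltW.
split; apply/eqP; rewrite eq_le; apply/andP; split.
- by rewrite -p'Y; exact: qmin.
- by rewrite -qY; exact: p'min.
- by rewrite -pY; exact: q'min.
- by rewrite -q'Y; exact: Y0.
Qed.

Lemma lower_graph_convex a b t : 0 <= a <= r -> 0 <= b <= r -> 0 <= t <= 1 ->
  g ((1 - t) * a + t * b) <= (1 - t) * g a + t * g b.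
Proof.
move=> ha hb ht; have /andP[t0 t1] := ht.
have [q [Kq qX qY _]] := Hg ha; have [q' [Kq' q'X q'Y _]] := Hg hb.
have hc : 0 <= (1 - t) * a + t * b <= r.
  by move/andP: ha => [? ?]; move/andP: hb => [? ?]; apply/andP; split; nra.
have [_ [_ _ _ qm]] := Hg hc.
rewrite -qY -q'Y -lam_convex; apply: qm; first exact: convex_setE.
by rewrite lam_convex qX q'X.
Qed.

Lemma lower_graph_range c : 0 <= c <= r -> 0 <= g c <= h.
Proof.
move=> hc; have [q [Kq qX qY _]] := Hg hc; rewrite -{1}qY Y0//=.
have [g0 gr] := lower_graph_ends; have /andP[c0 cr] := hc.
have t01 : 0 <= c / r <= 1 by rewrite divr_ge0 ?(ltW r0)// ler_pdivrMr// mul1r.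
have := @lower_graph_convex 0 r (c / r).
rewrite lexx (ltW r0) => /(_ isT); rewrite lexx => /(_ isT t01).
rewrite mulr0 add0r divfK ?gt_eqF// g0 gr mulr0 addr0 => hh.
rewrite (le_trans hh)// ler_piMl//; first exact: ltW.
by have /andP[? ?] := t01; lra.
Qed.

(** From below: the part of K with Y <= g c - eps is compact and misses the slice X = c, so it stays
    at a distance [d1] from it. From above: convexity against the end r, where g = 0, gives g c' <=
    g c on the right; against the end 0, where g = h, it costs (c - c') h / c on the left, whence
    [d2]. *)
Lemma lower_graph_delta c (eps : R) : 0 <= c <= r -> 0 < eps ->
  exists2 d : R, 0 < d & forall c', 0 <= c' <= r -> `|c' - c| < d -> `|g c' - g c| < eps.
Proof.
move=> hc eps0; have /andP[c0 cr] := hc; have [g0 gr] := lower_graph_ends.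
pose S := K `&` [set q | Y q <= g c - eps].
have cS : compact S.
  apply: compact_closedI => //.
  have /continuous_closedP cl := @continuous_lam _ K e'.
  by apply: (cl [set t : R | t <= g c - eps]); exact: closed_le.
have [d1 d10 Hd1] : exists2 d : R, 0 < d & forall q, S q -> d <= `|X q - c|.
  have [S0|S0] := pselect (S !=set0); last first.
    by exists 1 => // q Sq; exfalso; apply: S0; exists q.
  have cf : {within S, continuous (fun q => `|X q - c|)}.
    apply: continuous_subspaceT => q; rewrite /continuous_at.
    apply: cvg_norm; apply: (@cvgB _ R^o); last exact: cvg_cst.
    exact: (@continuous_lam _ K e q).
  have [q qS qmin] := compact_EVT_min S0 cS cf.
  have [Kq qe] := set_mem qS.
  exists (`|X q - c|); last by move=> q' Sq'; apply: qmin; exact: mem_set.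
  rewrite normr_gt0 subr_eq0; apply/eqP => qX.
  have [_ [_ _ _ qm]] := Hg hc; have := qm q Kq qX; move: qe; rewrite /=; lra.
pose d2 : R := if c == 0 then 1 else eps * c / h.
have d20 : 0 < d2.
  rewrite /d2; case: eqVneq => // cn0; have c0' : 0 < c by rewrite lt_neqAle eq_sym cn0.
  by rewrite divr_gt0// mulr_gt0.
exists (Num.min d1 d2); first by rewrite lt_min d10.
move=> c' hc'; rewrite lt_min => /andP[cd1 cd2]; have /andP[c'0 c'r] := hc'.
rewrite ltr_norml; apply/andP; split.
  rewrite ltrBrDl; rewrite ltNge; apply/negP => hlt.
  have [q [Kq qX qY _]] := Hg hc'.
  have : d1 <= `|X q - c| by apply: Hd1; split => //=; rewrite qY; lra.
  by rewrite qX leNgt cd1.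
have /andP[gc0 gch] := lower_graph_range hc.
have hr : 0 <= r <= r by rewrite lexx ltW.
have hz : (0 : R) <= 0 <= r by rewrite lexx ltW.
have [cc'|c'c] := leP c c'.
  have [rc|rc] := eqVneq c r.
    have -> : c' = c by apply/eqP; rewrite eq_le cc' rc c'r.
    by rewrite subrr.
  have rc' : 0 < r - c by rewrite subr_gt0 lt_neqAle rc.
  pose t := (c' - c) / (r - c).
  have t01 : 0 <= t <= 1.
    by rewrite divr_ge0 ?(ltW rc') ?subr_ge0//= ler_pdivrMr// mul1r lerD2r.
  have := lower_graph_convex hc hr t01; rewrite gr mulr0 addr0.
  have -> : (1 - t) * c + t * r = c + t * (r - c) by ring.
  rewrite /t divfK ?gt_eqF// addrC subrK -/t => le1.
  have : (1 - t) * g c <= g c by rewrite ler_piMl//; move/andP: t01 => [? ?]; lra.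
  lra.
have cp : 0 < c by exact: le_lt_trans c'0 c'c.
move: cd2; rewrite /d2 gt_eqF// => cd2.
pose t := (c - c') / c.
have t01 : 0 <= t <= 1.
  rewrite divr_ge0 ?(ltW cp) ?subr_ge0 ?(ltW c'c)//= ler_pdivrMr// mul1r.
  by rewrite lerBlDr lerDl.
have := lower_graph_convex hc hz t01; rewrite g0 mulr0 addr0.
have -> : (1 - t) * c = c - t * c by ring.
rewrite /t divfK ?gt_eqF// subKr -/t => le1.
have : (1 - t) * g c <= g c by rewrite ler_piMl//; move/andP: t01 => [? ?]; lra.
have : t * h < eps.
  rewrite /t mulrAC ltr_pdivrMr// -ltr_pdivlMr//.
  by move: cd2; rewrite distrC ger0_norm ?subr_ge0// ltW.
lra.
Qed.

Lemma lower_graph_continuous : {within `[0, r], continuous g}.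
Proof.
apply/subspace_continuousP => c; rewrite /= in_itv/= => hc.
apply/cvgrPdist_lt => eps eps0.
have [d d0 Hd] := lower_graph_delta hc eps0.
rewrite near_withinE; apply/nbhs_ballP; exists d => //= c' cc'.
rewrite in_itv/= => hc'; rewrite distrC; apply: Hd => //.
by move: cc'; rewrite /ball /= distrC.
Qed.

Lemma lower_graph_convex_function : convex_function (`[0, r]%classic : set R) g.
Proof.
move=> t a b; rewrite !mem_setE !in_itv/= => ha hb.
change (g (t%:num * a + (1 - t%:num) * b : R) <= t%:num * g a + (1 - t%:num) * g b :> R).
have := @lower_graph_convex b a t%:num hb ha.
rewrite ge0 le1 => /(_ isT); rewrite addrC (addrC ((1 - _) * g b)); exact.
Qed.

Lemma exists_gamma_triangle : exists T : gamma_triangle R,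
  [/\ gt_r T = r, gt_u T = h, gt_g T = g & forall x, chart T x = (X x, Y x)].
Proof.
have [g0 gr] := lower_graph_ends; have [D1 _ _ _] := Hc.
pose A : 'M[int]_2 := \matrix_(i < 2, j < 2)
  (let w := if i == 0 then e else e' in if j == 0 then w.1 else w.2).
have dA : \det A = 1.
  by rewrite det_mx2 !mxE /= -D1 /detz; ring.
have rg (x : R) : x \in `[0, r] -> g x \in `[0, h].
  by rewrite !in_itv/=; exact: lower_graph_range.
exists (@GammaTriangle R A (- supp K e, - supp K e') r h g dA r0 h0
  lower_graph_continuous lower_graph_convex_function rg g0 gr).
split => // x; rewrite /chart /= !mxE /=.
by rewrite /lam /pairing /=.
Qed.

Section with_triangle.
Variable T : gamma_triangle R.
Hypothesis Tr : gt_r T = r.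
Hypothesis Tu : gt_u T = h.
Hypothesis Tg : gt_g T = g.
Hypothesis Tc : forall x, chart T x = (X x, Y x).

Lemma regionP x : region T x <-> 0 <= X x <= r /\ 0 <= Y x <= g (X x).
Proof. by rewrite /region /preimage /normal_region /mkset Tc Tr Tg /= !in_itv. Qed.

Lemma same_chart x y : X x = X y -> Y x = Y y -> x = y.
Proof.
move=> xe xe'; have D0 := corner_det Hc.
have h1 : lam K e x - lam K e y = 0 by rewrite xe subrr.
have h2 : lam K e' x - lam K e' y = 0 by rewrite xe' subrr.
have h3 w : pairing w (x - y) = 0.
  rewrite (@cramer R w e e' D0) !pairing_sub.
  have -> : pairing e x - pairing e y = 0 by move: h1; rewrite /lam; lra.
  have -> : pairing e' x - pairing e' y = 0 by move: h2; rewrite /lam; lra.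
  by rewrite !mulr0 addr0.
have := h3 (1, 0); have := h3 (0, 1); rewrite /pairing /= !mul0r !mul1r addr0 add0r.
by move=> a b; apply: injective_projections; apply/eqP; rewrite -subr_eq0; apply/eqP.
Qed.

Let d1 : plane R := (e'.2%:~R, - e'.1%:~R).
Let d2 : plane R := (- e.2%:~R, e.1%:~R).

Let d1E : pairing e d1 = 1 /\ pairing e' d1 = 0.
Proof.
have [D1 _ _ _] := Hc; split; last by rewrite /pairing /d1 /=; ring.
by rewrite -[RHS]/(1%:~R) -D1 /pairing /d1 /detz /= rmorphB /= !rmorphM /=; ring.
Qed.

Let d2E : pairing e d2 = 0 /\ pairing e' d2 = 1.
Proof.
have [D1 _ _ _] := Hc; split; first by rewrite /pairing /d2 /=; ring.
by rewrite -[RHS]/(1%:~R) -D1 /pairing /d2 /detz /= rmorphB /= !rmorphM /=; ring.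
Qed.

Lemma move1 x c : X (x + scaled c d1) = X x + c /\ Y (x + scaled c d1) = Y x.
Proof. by have [a b] := d1E; rewrite !lam_move a b mulr1 mulr0 addr0. Qed.

Lemma move2 x c : X (x + scaled c d2) = X x /\ Y (x + scaled c d2) = Y x + c.
Proof. by have [a b] := d2E; rewrite !lam_move a b mulr1 mulr0 addr0. Qed.

(** The point x lies on the vertical segment from a point b of the side through v, in the model by
    convexity, to the point q of K on the graph. *)
Lemma region_sub_hat x : region T x -> hatK x.
Proof.
have [_ ee ee' [hv ev e'v nKv]] := Hc.
move=> /regionP[xr /andP[y0 yg]]; have /andP[x0 xr'] := xr.
have [q [Kq qX qY _]] := Hg xr.
have [[p Kp [pX pY]] _] := Hp.
pose b : plane R := ((1 - X x / r) * v.1 + X x / r * p.1, (1 - X x / r) * v.2 + X x / r * p.2).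
have hb : hatK b.
  apply: convex_setE => //; first exact: sub_hat.
  by rewrite divr_ge0 ?(ltW r0)// ler_pdivrMr// mul1r.
have bX : X b = X x by rewrite lam_convex ev pX mulr0 add0r divfK// gt_eqF.
have bY : Y b = 0 by rewrite lam_convex e'v pY !mulr0 addr0.
have [g0|g0] := eqVneq (g (X x)) 0.
  rewrite (@same_chart x b)// bY.
  by apply/eqP; rewrite eq_le y0 andbT -g0.
have gp : 0 < g (X x) by rewrite lt_neqAle eq_sym g0 (le_trans y0).
pose t := Y x / g (X x).
have tg : t * g (X x) = Y x by rewrite divfK.
rewrite (@same_chart x ((1 - t) * b.1 + t * q.1, (1 - t) * b.2 + t * q.2)).
- apply: convex_setE => //; first exact: sub_hat.
  by rewrite divr_ge0 ?(ltW gp)// ler_pdivrMr// mul1r.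
- by rewrite lam_convex bX qX; ring.
- by rewrite lam_convex bY qY mulr0 add0r tg.
Qed.

Lemma closure_ray (A : set (plane R)) x d (c0 : R) : 0 < c0 ->
  (forall c, 0 < c <= c0 -> A (x + scaled c d)) -> closure A x.
Proof.
move=> c00 H B /nbhs_ballP[r' r'0 HB].
have r'2 : 0 < r' / 2 by rewrite divr_gt0.
have [s s0 [s1 s2]] := small_scale d r'2.
pose c := Num.min c0 s.
have cp : 0 < c by rewrite lt_min c00.
exists (x + scaled c d); split; first by apply: H; rewrite cp ge_min lexx.
apply: HB.
have hlp (z : R) : `|s * z| <= r' / 2 -> `|c * z| < r'.
  move=> hz; apply: (@le_lt_trans _ _ (r' / 2)); last by move: r'0 => /=; lra.
  apply: le_trans hz; rewrite !normrM (gtr0_norm cp) (gtr0_norm s0); apply: ler_wpM2r => //.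
  by rewrite ge_min lexx orbT.
by split; rewrite /ball /= -normrN opprB addrC addKr; exact: hlp.
Qed.

Lemma below_graph_notin x : 0 <= X x <= r -> Y x < g (X x) -> ~ K x.
Proof.
by move=> xr yg Kx; have [_ [_ _ _ qm]] := Hg xr; have := qm x Kx erefl; rewrite leNgt yg.
Qed.

(** Points below the graph are outside K. Points of the graph are approached vertically from below,
    except when Y = 0: then X = r, and the approach is along the side. *)
Lemma region_sub_closure : region T `<=` closure (hatK `\` K).
Proof.
move=> x rx; have /regionP[xr /andP[y0]] := rx; have /andP[x0 xr'] := xr.
have hx := region_sub_hat rx.
have sE c d : x + scaled c (- d) = x + scaled (- c) d.
  by rewrite /scaled /=; congr (_ + _); rewrite !mulrN !mulNr.
rewrite le_eqVlt => /predU1P[yg|yg]; last first.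
  by apply: subset_closure; split => //; exact: below_graph_notin.
have [y0'|yn0] := eqVneq (Y x) 0.
  have [q [Kq qX qY _]] := Hg xr.
  have Kx : K x by rewrite (@same_chart x q)// qY.
  have xE : X x = r by apply/eqP; rewrite eq_le xr'; exact: Hp.2.
  apply: (@closure_ray _ x (- d1) r r0) => c /andP[c0 cr].
  rewrite sE; have [m1 m2] := move1 x (- c); rewrite xE in m1.
  have hr1 : 0 <= X (x + scaled (- c) d1) <= r by rewrite m1; apply/andP; split; lra.
  have /andP[gg0 _] := lower_graph_range hr1.
  split.
    by apply: region_sub_hat; apply/regionP; split => //; rewrite m2 y0' lexx.
  move=> Kc; have := Hp.2 _ Kc; rewrite m1 m2 => /(_ y0'); lra.
have yp : 0 < Y x by rewrite lt_neqAle eq_sym yn0.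
apply: (@closure_ray _ x (- d2) (Y x) yp) => c /andP[c0 cr].
rewrite sE; have [m1 m2] := move2 x (- c).
split.
  apply: region_sub_hat; apply/regionP; rewrite m1 m2; split => //.
  by apply/andP; split; lra.
by apply: below_graph_notin; rewrite m1// m2 -yg; lra.
Qed.

Lemma arc_sub_boundary : garc T `<=` boundary K.
Proof.
move=> x; rewrite /Defs.arc /preimage /normal_arc /mkset Tc Tr Tg /= in_itv/= => -[xr yg].
have [q [Kq qX qY qm]] := Hg xr.
have Kx : K x by rewrite (@same_chart x q)// qY.
split; first exact: subset_closure.
move=> /interiorP[s s0 Hs].
have s2 : 0 < s / 2 by rewrite divr_gt0.
have [c c0 [c1 c2]] := small_scale d2 s2.
have hs : s / 2 < s by lra.
have [m1 m2] := move2 x (- c).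
have Kc : K (x + scaled (- c) d2).
  by apply: Hs; rewrite addrC addKr /= mulNr normrN; exact: le_lt_trans hs.
by have := qm _ Kc m1; rewrite m2; lra.
Qed.

Lemma sides_sub_boundary : sides T `<=` boundary hatK.
Proof.
have [_ ee ee' _] := Hc.
move=> x xs; have : region T x /\ (X x = 0 \/ Y x = 0).
  move: xs; rewrite /sides /preimage /normal_sides /mkset Tc Tr Tu /= !in_itv/=.
  have [g0 _] := lower_graph_ends.
  case=> -[a b]; split; try by [left|right].
    by apply/regionP; split => //; rewrite b lexx; have /andP[] := lower_graph_range a.
  by apply/regionP; rewrite a g0 lexx (ltW r0).
move=> [rx xy]; split; first by apply: subset_closure; exact: region_sub_hat.
by case: xy => h'; [exact: (hat_not_interior cK vK K0 ee h')|exact: (hat_not_interior cK vK K0 ee' h')].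
Qed.

(** Comparison with the end (r, 0) of the arc gives a > 0 and X x < r; comparison with the point of
    the graph over x puts x below the graph. *)
Lemma region_of_separation x (a b : R) : hatK x -> 0 <= a -> 0 <= b ->
  (forall q, K q -> a * X x + b * Y x < a * X q + b * Y q) -> region T x.
Proof.
move=> hx a0 b0 H; have [_ ee ee' _] := Hc.
have x0 := hx e ee; have y0 := hx e' ee'.
have [[p Kp [pX pY]] _] := Hp.
have := H p Kp; rewrite pX pY mulr0 addr0 => h1.
have by0 : 0 <= b * Y x by apply: mulr_ge0.
have ap : 0 < a.
  rewrite lt_neqAle a0 andbT eq_sym; apply/eqP => a00.
  by move: h1; rewrite a00 !mul0r add0r ltNge by0.
have xr : X x < r by rewrite -(ltr_pM2l ap); lra.
have hx' : 0 <= X x <= r by rewrite x0 ltW.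
apply/regionP; split => //; rewrite y0 /=.
have [q [Kq qX qY _]] := Hg hx'.
have := H q Kq; rewrite qX qY ltrD2l => h2; apply: ltW.
have [b00|bn0] := eqVneq b 0; first by move: h2; rewrite b00 !mul0r ltxx.
by rewrite -(ltr_pM2l (_ : 0 < b))// lt_neqAle eq_sym bn0.
Qed.

Lemma closed_region : closed (region T).
Proof.
have cX := @continuous_lam _ K e; have cY := @continuous_lam _ K e'.
have H (A : set R) f : closed A -> closed [set x | A (lam K f x)].
  by move=> cA; have /continuous_closedP cl := @continuous_lam _ K f; exact: cl.
move=> x clx.
have cle (S : set (plane R)) : closed S -> region T `<=` S -> S x.
  by move=> cS sub; rewrite (closure_id S).1//; exact: closure_subset clx.
have x1 : 0 <= X x.
  by apply: (cle _ (H _ e (@closed_ge _ 0))) => y /regionP[/andP[? _] _].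
have x2 : X x <= r.
  by apply: (cle _ (H _ e (@closed_le _ r))) => y /regionP[/andP[_ ?] _].
have y1 : 0 <= Y x.
  by apply: (cle _ (H _ e' (@closed_ge _ 0))) => y /regionP[_ /andP[? _]].
have xr : 0 <= X x <= r by rewrite x1.
apply/regionP; split => //; rewrite y1 /= leNgt; apply/negP => yg.
have eps0 : 0 < (Y x - g (X x)) / 2 by rewrite divr_gt0// subr_gt0.
have [d d0 Hd] := lower_graph_delta xr eps0.
have nX : nbhs x [set y | `|X y - X x| < d].
  have /cvgrPdist_lt /(_ d d0) := cX x; apply: filterS => y /=.
  by rewrite distrC.
have nY : nbhs x [set y | `|Y y - Y x| < (Y x - g (X x)) / 2].
  have /cvgrPdist_lt /(_ _ eps0) := cY x; apply: filterS => y /=.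
  by rewrite distrC.
have [y [/regionP[yr /andP[_ yg']] [yX yY]]] := clx _ (filterI nX nY).
have := Hd _ yr yX; move: yY; rewrite /= !ltr_norml => /andP[? ?] /andP[? ?].
lra.
Qed.

Lemma interior_region_below x : (region T)^° x -> Y x < g (X x).
Proof.
move=> ix; have /regionP[xr /andP[y0 yg]] := interior_subset ix.
move: ix => /interiorP[s s0 Hs].
have s2 : 0 < s / 2 by rewrite divr_gt0.
have [c c0 [c1 c2]] := small_scale d2 s2.
have hs : s / 2 < s by lra.
have [m1 m2] := move2 x c.
have /regionP[_ /andP[_]] : region T (x + scaled c d2).
  by apply: Hs; rewrite addrC addKr /=; exact: le_lt_trans hs.
by rewrite m1 m2; lra.
Qed.

Lemma interior_region_notin x : (region T)^° x -> ~ K x.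
Proof.
move=> ix; have /regionP[xr _] := interior_subset ix.
exact: below_graph_notin xr (interior_region_below ix).
Qed.

(** The functional is negative at x but nonnegative at two points of K: the one on the graph above
    x, and one at the height of x further to the right. So it increases in both coordinates. *)
Lemma interior_region_cone x u : (region T)^° x -> lam K u x < 0 ->
  exists a b : R, [/\ 0 < a, 0 < b & combination u a e b e'].
Proof.
move=> ix ux; have rx := interior_subset ix.
have /regionP[xr /andP[y0 yg]] := rx; have /andP[x0 xr'] := xr.
have [D1 ee ee' _] := Hc.
have yg' := interior_region_below ix.
have [q [Kq qX qY _]] := Hg xr; have [[p Kp [pX pY]] _] := Hp.
have uE := @integer_combination R u e e' D1.
set a : R := (detz u e')%:~R in uE; set b : R := (detz e u)%:~R in uE.
exists a, b.
have dE y : lam K u y - lam K u x = a * (X y - X x) + b * (Y y - Y x).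
  by rewrite /lam !uE; ring.
have gp : 0 < g (X x) by exact: le_lt_trans yg'.
have xr2 : 0 < r - X x.
  rewrite subr_gt0 lt_neqAle xr' andbT; apply/eqP => xE.
  by move: gp; rewrite xE; have [_ ->] := lower_graph_ends; rewrite ltxx.
(* On the segment from q to p, this parameter gives the point of height Y x. *)
pose t := (g (X x) - Y x) / g (X x).
have t0 : 0 < t by rewrite divr_gt0// subr_gt0.
have t1 : t <= 1 by rewrite ler_pdivrMr// mul1r lerBlDr lerDl.
have Kz : K ((1 - t) * q.1 + t * p.1, (1 - t) * q.2 + t * p.2).
  by apply: convex_setE => //; rewrite ltW.
have lq := lam_ge0 u cK Kq; have lz := lam_ge0 u cK Kz.
split => //.
  have := dE ((1 - t) * q.1 + t * p.1, (1 - t) * q.2 + t * p.2).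
  rewrite (lam_convex e) (lam_convex e') qX qY pX pY mulr0 addr0.
  have -> : (1 - t) * g (X x) - Y x = 0.
    have -> : (1 - t) * g (X x) = g (X x) - t * g (X x) by ring.
    by rewrite /t divfK ?gt_eqF// subKr subrr.
  have -> : (1 - t) * X x + t * r - X x = t * (r - X x) by ring.
  rewrite mulr0 addr0 => h3.
  have : 0 < a * (t * (r - X x)) by rewrite -h3; lra.
  by rewrite pmulr_lgt0// mulr_gt0.
have := dE q; rewrite qX qY subrr mulr0 add0r => h1.
have : 0 < b * (g (X x) - Y x) by rewrite -h1; lra.
by rewrite pmulr_lgt0// subr_gt0.
Qed.

End with_triangle.
End with_bounds.
End corner_triangle.
Lemma corner_triangle_exists e e' v : corner K e e' v -> exists T : gamma_triangle R,
  [/\ forall x, chart T x = (lam K e x, lam K e' x),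
     region T `<=` closure (hatK `\` K), garc T `<=` boundary K,
     sides T `<=` boundary hatK &
  [/\ closed (region T),
     forall x (a b : R), hatK x -> 0 <= a -> 0 <= b ->
       (forall q, K q -> a * lam K e x + b * lam K e' x < a * lam K e q + b * lam K e' q) ->
       region T x,
     forall x, (region T)^° x -> ~ K x &
     forall x u, (region T)^° x -> lam K u x < 0 ->
       exists a b : R, [/\ 0 < a, 0 < b & combination u a e b e']]].
Proof.
move=> Hc; have [r [h [r0 h0 Hp Hq Hg]]] := corner_bounds Hc.
have [T [Tr Tu Tg Tc]] := exists_gamma_triangle Hc r0 h0 Hp Hq Hg.
exists T; split => //.
- exact: (region_sub_closure Hc r0 h0 Hp Hq Hg Tr Tg Tc).
- exact: (arc_sub_boundary Hc Hg Tr Tg Tc).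
- exact: (sides_sub_boundary Hc r0 h0 Hp Hq Hg Tr Tu Tg Tc).
split.
- exact: (closed_region r0 h0 Hp Hq Hg Tr Tg Tc).
- exact: (region_of_separation Hc Hp Hg Tr Tg Tc).
- exact: (interior_region_notin Hc Hg Tr Tg Tc).
- exact: (interior_region_cone Hc r0 Hp Hq Hg Tr Tg Tc).
Qed.

Lemma corner_swap e e' v : `|detz e e'| = 1 -> ext e -> ext e' -> hatK v -> lam K e v = 0 ->
  lam K e' v = 0 -> ~ K v -> corner K e e' v \/ corner K e' e v.
Proof.
move=> D1 ee ee' hv ev e'v nKv.
have [D|D] : detz e e' = 1 \/ detz e' e = 1 by move: D1; rewrite /detz; lia.
  by left; split.
by right; split.
Qed.

(* A point of the minimal model outside [K] is separated from [K] by a normal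
   lying in the cone of a corner outside [K]. *)
Lemma outside_corner_cone y : hatK y -> ~ K y -> exists e e' v (a b : R),
  [/\ corner K e e' v, 0 <= a, 0 <= b &
    forall q, K q -> a * lam K e y + b * lam K e' y < a * lam K e q + b * lam K e' q].
Proof.
move=> hy nKy; have [u uy] := integer_separation cK vK Kne nKy.
have u0 : u != 0 by apply: contraTneq uy => ->; rewrite lam0// ltxx.
have [v [e [e' [p [a [b [[hv vmin] [ev e'v] [ep e'p] [a0 b0] uE]]]]]]] :=
  vertex_cone cK vK K0 u0.
have ee : ext e by apply/(extremalP cK vK K0); exists p.
have ee' : ext e' by apply/(extremalP cK vK K0); exists p.
have sep q : K q -> a * lam K e y + b * lam K e' y < a * lam K e q + b * lam K e' q.
  move=> Kq; rewrite -(combination_lam y uE ev e'v) -(combination_lam q uE ev e'v).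
  rewrite ltrD2r; have := support_le u cK Kq; move: uy; rewrite /lam; lra.
have nKv : ~ K v.
  move=> Kv; have := sep v Kv; rewrite ev e'v !mulr0 addr0 ltNge.
  by rewrite addr_ge0//; apply: mulr_ge0 => //; [exact: hy|exact: hy].
have D0 : detz e e' != 0.
  apply/eqP => D0.
  have [ee2|ee2] := primitive_parallel (extremal_primitive ee) (extremal_primitive ee') D0.
    have [q Kq qE] := support_attained e cK Kne.
    have := sep q Kq; have -> : lam K e q = 0 by rewrite /lam qE subrr.
    rewrite -ee2 /lam -/(lam K e y).
    have -> : pairing e q - supp K e = 0 by rewrite qE subrr.
    rewrite !mulr0 addr0 ltNge addr_ge0//; apply: mulr_ge0 => //; exact: (hy e ee).
  have m0 := rho_max_gt0 cK vK K0.
  have [_ _ ep'] := ep; have [_ _ e'p'] := e'p.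
  move: ep' e'p' ev e'v; rewrite ee2 /lam !pairingN; lra.
have [_ D1] := outside_corner cK vK K0 D0 ee ee' hv ev e'v nKv.
have [c|c] := corner_swap D1 ee ee' hv ev e'v nKv.
  by exists e, e', v, a, b.
exists e', e, v, b, a; split => // q Kq.
by rewrite addrC [ltRHS]addrC; exact: sep.
Qed.

(** One triangle for each of the finitely many pairs of extremal normals forming a corner. They
    cover by [outside_corner_cone]. A point in two interiors is separated from K by a normal in both
    open cones; it is minimal on the model at one point only, so the corners, hence the pairs,
    agree. *)
Lemma exists_decomposition : exists (n : nat) (T : 'I_n -> gamma_triangle R),
  gamma_decomposition K T.
Proof.
have [s sE] := extremal_seq cK vK K0.
pose P (w : (int * int) * (int * int)) := exists v, corner K w.1 w.2 v.
(* Without repetitions, so that distinct indices carry distinct pairs. *)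
pose L := undup [seq w <- [seq (e, e') | e <- s, e' <- s] | `[< P w >]].
have LP (w : (int * int) * (int * int)) : w \in L <-> P w.
  rewrite mem_undup mem_filter; split=> [/andP[/asboolP]//|Pw].
  rewrite (asboolT Pw) /=; have [v [_ /sE es /sE es' _]] := Pw.
  by apply/allpairsP; exists w; split => //; case: w {Pw} es es'.
pose w_ (i : 'I_(size L)) := nth (0, 0) L i.
have Pw i : P (w_ i) by apply/LP/mem_nth.
pose T i := projT1 (cid (corner_triangle_exists (projT2 (cid (Pw i))))).
have TP i := projT2 (cid (corner_triangle_exists (projT2 (cid (Pw i))))).
exists (size L), T; rewrite /gamma_decomposition minimal_modelE; split.
- apply/seteqP; split=> [x|x [i _ xi]]; last first.
    by have [_ h _ _ _] := TP i; exact: h xi.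
  have cU : closed (\bigcup_i region (T i)).
    apply: closed_bigcup => [|i _]; first exact: finite_finset.
    by have [_ _ _ _ [h _ _ _]] := TP i; exact: h.
  move=> cx.
  rewrite ((closure_id _).1 cU); apply: closure_subset cx => y [hy nKy].
  have [e [e' [v [a [b [c a0 b0 sep]]]]]] := outside_corner_cone hy nKy.
  have eL : (e, e') \in L by apply/LP; exists v.
  have iL : (index (e, e') L < size L)%N by rewrite index_mem.
  exists (Ordinal iL) => //.
  have [_ _ _ _ [_ h _ _]] := TP (Ordinal iL).
  by apply: (h y a b) => //; rewrite /w_ /= nth_index.
- by move=> i; have [_ _ h _ _] := TP i.
- by move=> i; have [_ _ _ h _] := TP i.
- move=> i j ij; apply/seteqP; split => // x [xi xj].
  have [_ _ _ _ [_ _ ni hi]] := TP i; have [_ _ _ _ [_ _ _ hj]] := TP j.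
  have [u ux] := integer_separation cK vK Kne (ni x xi).
  have [a [b [a0 b0 uE]]] := hi x u xi ux.
  have [a' [b' [a'0 b'0 uE']]] := hj x u xj ux.
  have [v cv] := Pw i; have [v' cv'] := Pw j.
  have [_ ei ei' [hv ev e'v _]] := cv; have [_ ej ej' [hv' ev' e'v' _]] := cv'.
  have vv : v' = v.
    apply: (corner_strict_min cv uE) => //.
    rewrite -subr_ge0 (combination_lam v uE' ev' e'v').
    by apply: addr_ge0; (apply: mulr_ge0; [exact: ltW|exact: hv]).
  rewrite vv in cv'; have [eq1 eq2] := corner_unique cK K0 cv cv'.
  move: ij => /eqP; apply; apply: val_inj => /=; apply/eqP.
  have <- := @nth_uniq _ (0, 0) L i j (ltn_ord i) (ltn_ord j) (undup_uniq _).
  by apply/eqP; rewrite -/(w_ i) -/(w_ j) [w_ i]surjective_pairing eq1 eq2 -surjective_pairing.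
Qed.

End existence.

(** * The tree of unimodular bases *)

Definition quad := (nat * nat * nat * nat)%type.
Definition left_child (q : quad) : quad :=
  let: (a, b, c, d) := q in (a, b, a + c, b + d)%N.
Definition right_child (q : quad) : quad :=
  let: (a, b, c, d) := q in (a + c, b + d, c, d)%N.
Definition root_quad : quad := (1, 0, 0, 1)%N.

Fixpoint tree (n : nat) (q : quad) : seq quad :=
  if n is k.+1 then q :: tree k (left_child q) ++ tree k (right_child q) else [::].

Section quad_vectors.
Variables e e' : int * int.

Definition qfst (q : quad) : int * int := e *+ q.1.1.1 + e' *+ q.1.1.2.
Definition qsnd (q : quad) : int * int := e *+ q.1.2 + e' *+ q.2.

Lemma qfst_left q : qfst (left_child q) = qfst q.
Proof. by case: q => [[[a b] c] d]. Qed.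
Lemma qsnd_left q : qsnd (left_child q) = qfst q + qsnd q.
Proof. by case: q => [[[a b] c] d]; rewrite /qfst /qsnd /= !mulrnDr addrACA. Qed.
Lemma qfst_right q : qfst (right_child q) = qfst q + qsnd q.
Proof. by case: q => [[[a b] c] d]; rewrite /qfst /qsnd /= !mulrnDr addrACA. Qed.
Lemma qsnd_right q : qsnd (right_child q) = qsnd q.
Proof. by case: q => [[[a b] c] d]. Qed.

Lemma detzDl u v w : detz (u + v) w = detz u w + detz v w.
Proof. by rewrite /detz /=; ring. Qed.
Lemma detzDr u v w : detz w (u + v) = detz w u + detz w v.
Proof. by rewrite /detz /=; ring. Qed.
Lemma detzC u v : detz u v = - detz v u.
Proof. by rewrite /detz; ring. Qed.
Lemma detzz u : detz u u = 0.
Proof. by rewrite /detz; ring. Qed.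
Lemma detz0 u : detz 0 u = 0.
Proof. by rewrite /detz /=; ring. Qed.

Definition unimodular q := detz (qfst q) (qsnd q) = 1.

Lemma unimodular_left q : unimodular q -> unimodular (left_child q).
Proof. by rewrite /unimodular qfst_left qsnd_left detzDr detzz add0r. Qed.

Lemma unimodular_right q : unimodular q -> unimodular (right_child q).
Proof. by rewrite /unimodular qfst_right qsnd_right detzDl detzz addr0. Qed.

(** By Cramer's rule the two determinants are the coordinates of u in the basis [qfst q], [qsnd q]
    when it is unimodular. *)
Definition open_cone q u := 0 < detz u (qsnd q) /\ 0 < detz (qfst q) u.
Definition closed_cone q u := 0 <= detz u (qsnd q) /\ 0 <= detz (qfst q) u.

Lemma open_cone_left q u : open_cone (left_child q) u -> open_cone q u.
Proof.
rewrite /open_cone qfst_left qsnd_left detzDr (detzC u (qfst q)) => -[h1 h2].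
by split => //; lia.
Qed.

Lemma open_cone_right q u : open_cone (right_child q) u -> open_cone q u.
Proof.
rewrite /open_cone qfst_right qsnd_right detzDl (detzC (qsnd q) u) => -[h1 h2].
by split => //; lia.
Qed.

Lemma closed_cone_left q u : closed_cone (left_child q) u -> closed_cone q u.
Proof.
rewrite /closed_cone qfst_left qsnd_left detzDr (detzC u (qfst q)) => -[h1 h2].
by split => //; lia.
Qed.

Lemma closed_cone_right q u : closed_cone (right_child q) u -> closed_cone q u.
Proof.
rewrite /closed_cone qfst_right qsnd_right detzDl (detzC (qsnd q) u) => -[h1 h2].
by split => //; lia.
Qed.

Lemma cones_left_right q u : closed_cone (right_child q) u -> ~ open_cone (left_child q) u.
Proof.
rewrite /closed_cone /open_cone qfst_right qsnd_right qfst_left qsnd_left.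
rewrite /detz /= => -[h1 h2] [h3 h4]; lia.
Qed.

Lemma cones_right_left q u : closed_cone (left_child q) u -> ~ open_cone (right_child q) u.
Proof.
rewrite /closed_cone /open_cone qfst_right qsnd_right qfst_left qsnd_left.
rewrite /detz /= => -[h1 h2] [h3 h4]; lia.
Qed.

Lemma quad_decomposition q u : unimodular q ->
  u = qfst q *~ detz u (qsnd q) + qsnd q *~ detz (qfst q) u.
Proof.
rewrite /unimodular => D; move: (qfst q) (qsnd q) D => [a b] [c d] D.
have pz (x : int * int) (k : int) : x *~ k = (x.1 * k, x.2 * k).
  by case: x => x y; rewrite -(mulrzz x) -(mulrzz y); case: k => k;
    rewrite /intmul pair_mulrn.
case: u => x y; rewrite !pz /detz /= in D *; apply: injective_projections => /=.
  by transitivity (x * (a * d - b * c)); [rewrite D mulr1|ring].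
by transitivity (y * (a * d - b * c)); [rewrite D mulr1|ring].
Qed.

End quad_vectors.

(** * Minima of a sublinear function along the tree *)

Section sublinear.
Variable R : realType.
(** Used with L u = lam K u x and l u = <u, x - p> for a maximum point p, where [Ll] says that lam K
    u p >= m. *)
Variables (L l : int * int -> R) (m : R).
Hypothesis LD : forall u v : int * int, L (u + v) <= L u + L v.
Hypothesis LM : forall (u : int * int) n, L (u *+ n) = L u *+ n.
Hypothesis lD : forall u v : int * int, l (u + v) = l u + l v.
Hypothesis lM : forall (u : int * int) n, l (u *+ n) = l u *+ n.
Hypothesis Ll : forall u : int * int, u != 0 -> m + l u <= L u.
Hypothesis m0 : 0 < m.
Variables e e' : int * int.

Local Notation fs := (qfst e e').
Local Notation sn := (qsnd e e').

Definition qmin q : R := Num.min (L (fs q)) (L (sn q)).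
Definition qmid q : R := L (fs q + sn q).
Definition qgap q : R := L (fs q) + L (sn q) - qmid q.

Fixpoint level_min (n : nat) (q : quad) : R :=
  if n is k.+1 then Num.min (level_min k (left_child q)) (level_min k (right_child q))
  else qmin q.

Let mediant_double (v w : int * int) : v + (v + w) + w = (v + w) *+ 2.
Proof. by rewrite mulr2n -!addrA; congr (_ + _); rewrite addrCA. Qed.

(** With v = [qfst q] and w = [qsnd q], 2 (v + w) = (2 v + w) + w gives 2 L (v + w) <= L (2 v + w) +
    L w. *)
Lemma qgap_left q : qgap (left_child q) <= qgap q.
Proof.
rewrite /qgap /qmid qfst_left qsnd_left.
have := LD (fs q + (fs q + sn q)) (sn q).
rewrite (mediant_double (fs q) (sn q)).
by rewrite LM mulr2n; lra.
Qed.

Lemma qgap_right q : qgap (right_child q) <= qgap q.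
Proof.
rewrite /qgap /qmid qfst_right qsnd_right.
have := LD (fs q) (fs q + sn q + sn q).
rewrite addrA (mediant_double (fs q) (sn q)).
by rewrite LM mulr2n; lra.
Qed.

Let L0 : L 0 = 0.
Proof. by have := LM 0 0; rewrite !mulr0n. Qed.

(* If the mediant beats both [fs q] and [sn q], then [L] is large outside the
   open cone: on the sides by subadditivity, in the opposite cone by [Ll]. *)
Lemma active_localization q u : unimodular e e' q -> qgap q <= m -> 0 < qmin q ->
  qmid q < qmin q -> u != 0 -> ~ open_cone e e' q u -> qmin q <= L u.
Proof.
move=> D gm min0 mid u0 nc.
move: min0 mid; rewrite !lt_min => /andP[v0 w0] /andP[uv uw].
have := quad_decomposition u D; move: nc; rewrite /open_cone.
move: (detz u (sn q)) (detz (fs q) u) => al be nc uE.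
have gE : qgap q = L (fs q) + L (sn q) - L (fs q + sn q) by [].
move: gE gm uv uw v0 w0 uE; rewrite /qmid /qmin; move: (fs q) (sn q) => v w -> gm uv uw v0 w0 uE.
(* Beyond the side of v': adding k (v' + w') to u gives (A + 1 + k) v', and each added mediant costs
   less than L v'. *)
have side v' w' (A k : nat) : L v' + L w' - L (v' + w') <= m -> 0 < L v' -> L (v' + w') < L v' ->
    u = v' *+ A.+1 - w' *+ k -> L v' <= L u.
  move=> _ v'0 v'w uE'.
  have := LD u ((v' + w') *+ k).
  rewrite (_ : u + _ = v' *+ (A.+1 + k)); last first.
    by rewrite uE' mulrnDl mulrnDr addrACA addNr addr0.
  rewrite !LM mulrnDr -!(mulr_natl (L _)) -natr1 => h.
  have kL : k%:R * L (v' + w') <= k%:R * L v' by rewrite ler_wpM2l ?ler0n// ltW.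
  have AL : 0 <= A%:R * L v' by rewrite mulr_ge0 ?ler0n// ltW.
  by nra.
(* As L (v + w) < L w and the gap is at most m, L v < m; likewise L w < m. So l is negative on v and
   w, hence nonnegative on the opposite cone, where L u >= m. *)
have opposite (A B : nat) : u + v *+ A + w *+ B = 0 -> L v <= L u.
  move=> uE'; have lv : l v < 0.
    have v00 : v != 0 by apply: contraTneq v0 => ->; rewrite L0 ltxx.
    by have := Ll v00; lra.
  have lw : l w < 0.
    have w00 : w != 0 by apply: contraTneq w0 => ->; rewrite L0 ltxx.
    by have := Ll w00; lra.
  have l0 : l 0 = 0 by have := lM 0 0; rewrite !mulr0n.
  have := congr1 l uE'; rewrite l0 !lD !lM -(mulr_natl (l v)) -(mulr_natl (l w)) => lE.
  have : A%:R * l v <= 0 by rewrite mulr_ge0_le0 ?ler0n// ltW.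
  have : B%:R * l w <= 0 by rewrite mulr_ge0_le0 ?ler0n// ltW.
  by have := Ll u0; lra.
rewrite ge_min; apply/orP.
case: al be nc uE => [[|A]|A] [[|B]|B] nc uE; rewrite ?NegzE ?mulrNz ?mulr0z -?pmulrn ?add0r ?addr0 in uE.
- by rewrite uE eqxx in u0.
- right; rewrite uE LM -mulr_natl -natr1.
  have : 0 <= B%:R * L w by rewrite mulr_ge0 ?ler0n// ltW.
  by nra.
- by left; apply: (opposite 0 B.+1); rewrite uE mulr0n addr0 addNr.
- left; rewrite uE LM -mulr_natl -natr1.
  have : 0 <= A%:R * L v by rewrite mulr_ge0 ?ler0n// ltW.
  by nra.
- by exfalso; apply: nc; split; lia.
- by left; apply: (side v w A B.+1).
- by left; apply: (opposite A.+1 0); rewrite uE mulr0n addr0 addNr.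
- right; apply: (side w v B A.+1) => //; rewrite 1?(addrC w) ?[L w + _]addrC//.
  by rewrite uE addrC.
- left; apply: (opposite A.+1 B.+1).
  by rewrite uE -addrA addrACA !addNr addr0.
Qed.

Lemma qmid_le q : Num.min (qmin q) (qmid q) = Num.min (qmin (left_child q)) (qmin (right_child q)).
Proof.
rewrite /qmin qfst_left qsnd_left qfst_right qsnd_right -/(qmid q).
by rewrite -minA (minC (L (sn q))) !minA -(minA _ (qmid q) (qmid q)) minxx.
Qed.

Lemma level_min_le n q : level_min n q <= qmin q.
Proof.
elim: n q => [|n IH] q //=.
have := lexx (Num.min (qmin q) (qmid q)); rewrite {1}qmid_le => h.
have h1 : level_min n (left_child q) <= qmin (left_child q) by [].
have h2 : level_min n (right_child q) <= qmin (right_child q) by [].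
apply: le_trans (le_trans h _); last by rewrite ge_min lexx.
by rewrite le_min !ge_min h1 h2 orbT.
Qed.

Lemma unimodular_primitive q : unimodular e e' q -> primitive (fs q) /\ primitive (sn q).
Proof.
rewrite /unimodular; move: (fs q) (sn q) => v w D; split; rewrite /primitive /=; apply/coprimezP.
  by exists (w.2, - w.1) => /=; rewrite -D /detz; ring.
by exists (- v.2, v.1) => /=; rewrite -D /detz; ring.
Qed.

Lemma level_minE n q : unimodular e e' q ->
  exists u, [/\ primitive u, closed_cone e e' q u & level_min n q = L u].
Proof.
elim: n q => [|n IH] q D /=.
  have [p1 p2] := unimodular_primitive D; rewrite /qmin /closed_cone.
  have [_|_] := leP (L (fs q)) (L (sn q)); [exists (fs q)|exists (sn q)];
    by rewrite detzz D.
have [_|_] := leP (level_min n (left_child q)) (level_min n (right_child q)).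
  have [u [pu cu ->]] := IH _ (unimodular_left D).
  by exists u; split => //; apply: closed_cone_left.
have [u [pu cu ->]] := IH _ (unimodular_right D).
by exists u; split => //; apply: closed_cone_right.
Qed.

(** Euclid's algorithm: for b <= a, a v + b w = (a - b) v + b (v + w) belongs to the left child,
    with a smaller coefficient sum; symmetrically on the right. The truncation at 0 serves at the
    end, where a multiple k v of v with L v < 0 has a smaller value than v. *)
Lemma level_min_cover n q a b : (a + b <= n)%N ->
  fs q *+ a + sn q *+ b != 0 ->
  Num.max (level_min n q) 0 <= Num.max (L (fs q *+ a + sn q *+ b)) 0.
Proof.
clear m0 Ll.
have edge (t : R) (k : nat) : (0 < k)%N -> Num.max t 0 <= Num.max (t *+ k) 0.
  move=> k0; have [t0|t0] := leP t 0; first by rewrite le_max lexx orbT.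
  by rewrite le_max -mulr_natr ler_peMr ?ler1n// ltW.
elim: n q a b => [|n IH] q a b abn u0.
  by move: abn u0; rewrite leqn0 addn_eq0 => /andP[/eqP -> /eqP ->]; rewrite !mulr0n addr0 eqxx.
case: a abn u0 => [|a] abn u0.
  have b0 : (0 < b)%N by case: b u0 {abn} => //; rewrite !mulr0n addr0 eqxx.
  rewrite mulr0n add0r LM; apply: le_trans (edge _ _ b0).
  rewrite ge_max !le_max lexx orbT andbT; apply/orP; left.
  by apply: le_trans (level_min_le _ _) _; rewrite ge_min lexx orbT.
case: b abn u0 => [|b] abn u0.
  rewrite mulr0n addr0 LM; apply: le_trans (edge _ _ (ltn0Sn a)).
  rewrite ge_max !le_max lexx orbT andbT; apply/orP; left.
  by apply: le_trans (level_min_le _ _) _; rewrite ge_min lexx.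
have [ba|ab] := leqP b.+1 a.+1.
  have uE : fs q *+ a.+1 + sn q *+ b.+1 =
      fs (left_child q) *+ (a - b) + sn (left_child q) *+ b.+1.
    rewrite qfst_left qsnd_left [(_ + sn q) *+ _]mulrnDl addrA -mulrnDr; congr (_ *+ _ + _).
    by rewrite -subSS addnC subnKC.
  rewrite uE; rewrite uE in u0.
  by apply: le_trans (IH (left_child q) _ _ _ u0); [rewrite /= ge_max !le_max ge_min !lexx orbT|lia].
have uE : fs q *+ a.+1 + sn q *+ b.+1 =
    fs (right_child q) *+ a.+1 + sn (right_child q) *+ (b - a).
  rewrite qfst_right qsnd_right [(_ + sn q) *+ _]mulrnDl -addrA -mulrnDr; congr (_ + _ *+ _).
  by rewrite -subSS subnKC// ltnW.
rewrite uE; rewrite uE in u0.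
apply: le_trans (IH (right_child q) _ _ _ u0); last by lia.
by rewrite /= ge_max !le_max ge_min !lexx !orbT.
Qed.

(** The descent follows the subtree with the smaller minimum. As long as the mediant does not lower
    the minimum, [qmin] does not decrease and the gap does not increase; [active_localization]
    applies at the first node where it does. *)
Lemma localization n q u : unimodular e e' q -> qgap q <= m -> 0 < qmin q ->
  level_min n q < qmin q -> u != 0 -> ~ open_cone e e' q u -> qmin q <= L u.
Proof.
move=> D gm q0 lt u0; elim: n q D gm q0 lt => [|n IH] q D gm q0 /=; first by rewrite ltxx.
have [mq|qm] := ltP (qmid q) (qmin q); first by move=> _; exact: active_localization.
have ql : qmin q <= qmin (left_child q).
  by rewrite {2}/qmin qfst_left qsnd_left le_min qm andbT ge_min lexx.
have qr : qmin q <= qmin (right_child q).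
  by rewrite {2}/qmin qfst_right qsnd_right le_min qm ge_min lexx orbT.
have [_|_] := leP (level_min n (left_child q)) _ => lt nc.
  apply: (le_trans ql); apply: IH.
  - exact: unimodular_left.
  - exact: le_trans (qgap_left q) gm.
  - exact: lt_le_trans ql.
  - exact: lt_le_trans ql.
  - by move=> /open_cone_left.
apply: (le_trans qr); apply: IH.
- exact: unimodular_right.
- exact: le_trans (qgap_right q) gm.
- exact: lt_le_trans qr.
- exact: lt_le_trans qr.
- by move=> /open_cone_right.
Qed.

Section telescope.
Variable G : R -> R.
Hypothesis G0 : forall t, t <= 0 -> G t = 0.

Definition qcut q : R := G (qmin q) - G (Num.min (qmin q) (qmid q)).

Let G_max0 t : G (Num.max t 0) = G t.
Proof. by have [t0|//] := leP t 0; rewrite !G0. Qed.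

(** Since G(min) + G(max) is the sum of the two values, the induction step reduces to G (max A B) =
    G (max A' B'), where the two subtrees start at A' and B' and reach A and B. If one of them
    decreases from a positive start, the other stays at or above that start, so the maximum is kept.
    Nonpositive values are harmless, [G] vanishing there. *)
Lemma sum_qcut n q : unimodular e e' q -> qgap q <= m ->
  \sum_(q' <- tree n q) qcut q' = G (qmin q) - G (level_min n q).
Proof.
elim: n q => [|n IH] q D gm /=; first by rewrite big_nil subrr.
have Dl := unimodular_left D; have Dr := unimodular_right D.
have gl := le_trans (qgap_left q) gm; have gr := le_trans (qgap_right q) gm.
rewrite big_cons big_cat /= (IH _ Dl gl) (IH _ Dr gr) /qcut qmid_le.
set A := level_min n _; set B := level_min n (right_child q).
set A' := qmin (left_child q); set B' := qmin (right_child q).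
have AA : A <= A' by exact: level_min_le.
have BB : B <= B' by exact: level_min_le.
(* The value B is attained at a normal of the closed right cone, which is outside the open left
   cone. *)
have lA : 0 < A' -> A < A' -> A' <= B.
  move=> A0 AltA; have [u [/primitive_neq0 u0 cu BE]] := level_minE n Dr.
  by rewrite /B BE; apply: localization AltA u0 _ => //; exact: cones_left_right.
have lB : 0 < B' -> B < B' -> B' <= A.
  move=> B0 BltB; have [u [/primitive_neq0 u0 cu AE]] := level_minE n Dl.
  by rewrite /A AE; apply: localization BltB u0 _ => //; exact: cones_right_left.
suff key : G (Num.max A B) = G (Num.max A' B').
  have mM t t' : G (Num.min t t') + G (Num.max t t') = G t + G t'.
    by have [//|_] := leP t t'; rewrite addrC.
  by have := mM A B; have := mM A' B'; rewrite key; lra.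
rewrite -[LHS]G_max0 -[RHS]G_max0; congr G.
case: (leP A' 0) => A0; last first.
  case: (ltP A A') => AltA.
    have AB := lA A0 AltA; have BE : B = B'.
      apply/eqP; rewrite eq_le BB leNgt; apply/negP => BltB.
      by have := lB (lt_le_trans A0 (le_trans AB BB)) BltB; lra.
    by rewrite -BE (max_idPr (le_trans (ltW AltA) AB)) (max_idPr AB).
  have AE : A = A' by apply/eqP; rewrite eq_le AA.
  case: (ltP B B') => BltB; last by rewrite AE (_ : B = B')//; apply/eqP; rewrite eq_le BB.
  have [B0|B0] := leP B' 0.
    by rewrite AE !(max_idPl _)//; lra.
  have BA := lB B0 BltB; rewrite -AE.
  by rewrite (max_idPl (le_trans BB BA)) (max_idPl BA).
have A00 : A <= 0 by exact: le_trans AA A0.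
case: (leP B' 0) => B0.
  have B00 := le_trans BB B0.
  by rewrite (max_idPr (_ : Num.max A B <= 0)) ?(max_idPr (_ : Num.max A' B' <= 0))// ge_max ?A00 ?B00 ?A0.
have BE : B = B'.
  by apply/eqP; rewrite eq_le BB leNgt; apply/negP => BltB; have := lB B0 BltB; lra.
by rewrite -BE in B0 *; rewrite (max_idPr (le_trans A00 (ltW B0))) (max_idPr (le_trans A0 (ltW B0))).
Qed.

End telescope.

End sublinear.

(** * The tree lists every unimodular quadruple once *)

Section tree_enumeration.
Local Notation fs := (qfst (1, 0) (0, 1)).
Local Notation sn := (qsnd (1, 0) (0, 1)).
Local Notation unimod := (unimodular (1, 0) (0, 1)).
Local Notation opn := (open_cone (1, 0) (0, 1)).

Lemma unimodular_quadP e e' q : detz e e' = 1 ->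
  unimodular e e' q <-> unimodular_quadruples q.
Proof.
move: q => [[[a b] c] d] D; rewrite /unimodular /unimodular_quadruples /qfst /qsnd /=.
rewrite /detz !pair_mulrn /= -![X in X = 1]/(_ - _).
have -> : (e.1 *+ a + e'.1 *+ b) * (e.2 *+ c + e'.2 *+ d) -
   (e.2 *+ a + e'.2 *+ b) * (e.1 *+ c + e'.1 *+ d) = (a * d)%N%:Z - (b * c)%N%:Z.
  rewrite !PoszM -[RHS]mulr1 -D /detz -!(mulr_natr (_.1)) -!(mulr_natr (_.2)) !natz.
  by ring.
by split; lia.
Qed.

(** The mediant of a node stays in the open cones of all its ancestors; the two children having
    disjoint open cones, no quadruple is repeated in the tree. *)
Lemma tree_open_cone n q q' : unimod q -> q' \in tree n q -> opn q (fs q' + sn q').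
Proof.
elim: n q => [|n IH] q D //=; rewrite inE => /predU1P[->|].
  by rewrite /open_cone detzDl detzDr !detzz D.
rewrite mem_cat => /orP[/(IH _ (unimodular_left D))/open_cone_left//|].
by move=> /(IH _ (unimodular_right D))/open_cone_right.
Qed.

Lemma uniq_tree n q : unimod q -> uniq (tree n q).
Proof.
elim: n q => [|n IH] q D //=.
have Dl := unimodular_left D; have Dr := unimodular_right D.
rewrite mem_cat cat_uniq (IH _ Dl) (IH _ Dr) /= andbT negb_or -andbA.
apply/and3P; split.
- apply/negP => /(tree_open_cone Dl)[].
  by rewrite qsnd_left detzz ltxx.
- apply/negP => /(tree_open_cone Dr)[_].
  by rewrite qfst_right detzz ltxx.
- apply/hasPn => q' /(tree_open_cone Dr) [h1 h2].
  apply/negP => /(tree_open_cone Dl) h; apply: cones_left_right h.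
  by split; exact: ltW.
Qed.

Lemma tree_children n q q' : q' \in tree n q ->
  left_child q' \in tree n.+1 q /\ right_child q' \in tree n.+1 q.
Proof.
elim: n q => [//|n IH] q.
have treeS k : tree k.+1 q = q :: tree k (left_child q) ++ tree k (right_child q) by [].
rewrite (treeS n) in_cons mem_cat => /predU1P[->|].
  by rewrite /= !(inE, mem_cat) !eqxx !orbT.
rewrite (treeS n.+1) !(in_cons q) !(mem_cat _ (tree n.+1 (left_child q))).
by move=> /orP[/IH[-> ->]|/IH[-> ->]]; rewrite !orbT.
Qed.

Lemma tree_le n n' q : (n <= n')%N -> {subset tree n q <= tree n' q}.
Proof.
elim: n n' q => [|n IH] [|n'] q //= nn' q'.
rewrite !inE !mem_cat => /or3P[->//|/(IH _ _ nn') ->|/(IH _ _ nn') ->]; by rewrite !orbT.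
Qed.

Lemma tree_unimodular n q' : q' \in tree n root_quad -> unimodular_quadruples q'.
Proof.
have : unimodular_quadruples root_quad by [].
elim: n root_quad => [|n IH] q Dq //=; rewrite inE => /predU1P[->//|].
rewrite mem_cat => /orP[]; apply: IH; move: q Dq => [[[a b] c] d] /=; lia.
Qed.

(* The parent is found by subtracting the smaller vector from the larger one. *)
Lemma tree_exhausts q : unimodular_quadruples q -> exists n, q \in tree n root_quad.
Proof.
move: q => [[[a b] c] d] /=.
have [N] := ubnP (a + b + c + d); elim: N a b c d => // N IH a b c d lt D.
have a0 : (0 < a)%N by lia.
have d0 : (0 < d)%N by lia.
have [ac|ca] := leqP a c.
  have bd : (b <= d)%N by nia.
  have [||n nP] := IH a b (c - a)%N (d - b)%N; [lia|nia|].
  exists n.+1; have [+ _] := tree_children nP.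
  by rewrite /= !subnKC.
have [db|bd] := leqP d b.
  have [||n nP] := IH (a - c)%N (b - d)%N c d; [lia|nia|].
  exists n.+1; have [_ +] := tree_children nP.
  by rewrite /= !subnK// ltnW.
have [b0 c0] : b = 0%N /\ c = 0%N by split; nia.
exists 1%N; rewrite b0 c0 in D *.
by have [-> ->] : a = 1%N /\ d = 1%N by split; nia.
Qed.

End tree_enumeration.

(** * Pointwise limit over the levels of the tree *)

Lemma qfst_root (e e' : int * int) : qfst e e' root_quad = e.
Proof. by rewrite /qfst /= mulr1n mulr0n addr0. Qed.

Lemma qsnd_root (e e' : int * int) : qsnd e e' root_quad = e'.
Proof. by rewrite /qsnd /= mulr1n mulr0n add0r. Qed.

Lemma unimodular_root (e e' : int * int) : detz e e' = 1 -> unimodular e e' root_quad.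
Proof. by rewrite /unimodular qfst_root qsnd_root. Qed.

Lemma closed_cone_root (e e' u : int * int) : detz e e' = 1 -> closed_cone e e' root_quad u ->
  u = e *+ `|detz u e'|%N + e' *+ `|detz e u|%N.
Proof.
move=> D; have := quad_decomposition u (unimodular_root D).
rewrite /closed_cone qfst_root qsnd_root => uE [h1 h2].
rewrite {1}uE; congr (_ + _).
  by case: (detz u e') h1.
by case: (detz e u) h2.
Qed.

Section pointwise.
Variable R : realType.
Variable K : set (plane R).
Hypothesis cK : compact K.
Hypothesis vK : convex_set K.
Hypothesis K0 : K^° !=set0.
Variables (n : nat) (T : 'I_n -> gamma_triangle R).
Hypothesis HT : gamma_decomposition K T.
Implicit Types (u w f : int * int) (x y z p d : plane R).

Let Kne : K !=set0.
Proof. by have [x /interior_subset Kx] := K0; exists x. Qed.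

Local Notation ext := (extremal K).
Local Notation hatK := (hat K).
Local Notation m := (rho_max K).
Local Notation E1 i := (normal1 (T i)).
Local Notation E2 i := (normal2 (T i)).

Let detE i : detz (E1 i) (E2 i) = 1.
Proof. exact: detz_normals. Qed.

Let uni i : unimodular (E1 i) (E2 i) root_quad.
Proof. exact: unimodular_root. Qed.

Let E1_ext i : ext (E1 i).
Proof. by have [v [_ ? _ _] _] := decomposition_corner cK vK K0 HT i. Qed.

Let E2_ext i : ext (E2 i).
Proof. by have [v [_ _ ? _] _] := decomposition_corner cK vK K0 HT i. Qed.

Let chat : compact hatK := compact_hat cK vK K0.

Let hat_gt0 y : 0 < rho hatK y -> hatK y.
Proof. by move=> r0; have := interior_subset (rho_gt0_int chat r0). Qed.

(** An extremal normal in the cone of a corner is minimal at that corner, hence is one of its two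
    normals, which span the edges of the cone. *)
Lemma extremal_open_cone i f : ext f -> ~ open_cone (E1 i) (E2 i) root_quad f.
Proof.
move=> extf [f1 f2]; have [v vc _] := decomposition_corner cK vK K0 HT i.
have [_ _ _ [hv v1 v2 _]] := vc.
have fE : f = E1 i *+ `|detz f (E2 i)|%N + E2 i *+ `|detz (E1 i) f|%N.
  by apply: closed_cone_root => //; split; exact: ltW.
have fv : lam K f v = 0.
  apply/eqP; rewrite eq_le (_ : 0 <= _) ?andbT; last exact: hv.
  rewrite fE (le_trans (lamD _ _ _ cK Kne))// !lamMn// v1 v2 !mul0rn addr0//.
rewrite qfst_root qsnd_root in f1 f2.
have [E|E] := corner_other_normal cK K0 vc extf fv.
  by rewrite E detzz ltxx in f2.
by rewrite E detzz ltxx in f1.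
Qed.

Variable x : plane R.
Let L u := lam K u x.
Let LD u w : L (u + w) <= L u + L w.
Proof. exact: lamD. Qed.
Let LM u k : L (u *+ k) = L u *+ k.
Proof. exact: lamMn. Qed.

Let low i k := level_min L (E1 i) (E2 i) k root_quad.
Let start i := qmin L (E1 i) (E2 i) root_quad.

Let startE i : start i = Num.min (L (E1 i)) (L (E2 i)).
Proof. by rewrite /start /qmin qfst_root qsnd_root. Qed.

Let gap_le i : qgap L (E1 i) (E2 i) root_quad <= m.
Proof.
rewrite /qgap /qmid qfst_root qsnd_root.
have [v vc _] := decomposition_corner cK vK K0 HT i.
by rewrite -gap_lam; exact: corner_gap_le vc.
Qed.

Let far i k u : 0 < start i -> low i k < start i -> u != 0 ->
  ~ open_cone (E1 i) (E2 i) root_quad u -> start i <= L u.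
Proof.
move=> s0 ls u0 nc.
have [p tp] := exists_top cK K0.
apply: (@localization _ L (fun u => pairing u (x - p)) m LD LM _ _ _ _ _ _ k) => //.
- by move=> v w; rewrite pairingD.
- by move=> v j; rewrite pairingMn.
- by move=> v v0; rewrite /L (lam_shift K v p x) lerD2r; exact: top_ge.
- exact: rho_max_gt0.
Qed.

(** All extremal normals are outside the open cone of the active corner, so by [far] none of them
    goes below [start i]. *)
Lemma rho_hat_active i k : 0 < start i -> low i k < start i ->
  rho hatK x = start i /\ hatK x.
Proof.
move=> s0 ls.
have ge : start i <= rho hatK x.
  apply: le_rho_hat => //; first exact: ltW.
  move=> e exte; apply: (far s0 ls) => //.
    exact/primitive_neq0/(extremal_primitive exte).
  exact: extremal_open_cone.
have hx : hatK x by exact: hat_gt0 (lt_le_trans s0 ge).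
split=> //; apply/eqP; rewrite eq_le ge andbT startE le_min.
by rewrite !(rho_hat_le cK vK K0 _ hx).
Qed.

(** The minimum of each corner is attained in its own closed cone, which misses the open cone of the
    other by [decomposition_disjoint]. Two active corners would give start i <= low j < start j <=
    low i < start i. *)
Lemma low_inactive i j k k' : i != j -> 0 < start i -> low i k < start i ->
  0 < start j -> low j k' = start j.
Proof.
move=> ij s0 ls sj; apply/eqP; rewrite eq_le level_min_le leNgt; apply/negP => lj.
have cross (a b : 'I_n) h h' : a != b -> 0 < start a -> low a h < start a -> start a <= low b h'.
  move=> ab sa la; rewrite /low; have [u [/primitive_neq0 u0 cu ->]] := level_minE L h' (uni b).
  apply: (far sa la) => // -[c1 c2]; rewrite qfst_root qsnd_root in c1 c2.
  have ca : closed_cone (E1 a) (E2 a) root_quad u by split; rewrite ?qfst_root ?qsnd_root ltW.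
  have := closed_cone_root (detE b) cu; rewrite (closed_cone_root (detE a) ca).
  by apply: (decomposition_disjoint cK vK K0 HT ab); rewrite absz_gt0 gt_eqF.
have h1 := cross i j k k' ij s0 ls; rewrite eq_sym in ij.
have h2 := cross j i k' k ij sj lj.
by lra.
Qed.

Variable G : R -> R.
Hypothesis G0 : forall t, t <= 0 -> G t = 0.

Definition level_sum (k : nat) : R :=
  \sum_(i < n) \sum_(q <- tree k root_quad) qcut L (E1 i) (E2 i) G q.

Let level_sumE k : level_sum k = \sum_(i < n) (G (start i) - G (low i k)).
Proof.
apply: eq_bigr => i _; have [p tp] := exists_top cK K0.
apply: (@sum_qcut _ L (fun u => pairing u (x - p)) m LD LM _ _ _ _ _ _ G G0) => //.
- by move=> v w; rewrite pairingD.
- by move=> v j; rewrite pairingMn.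
- by move=> v v0; rewrite /L (lam_shift K v p x) lerD2r; exact: top_ge.
- exact: rho_max_gt0.
Qed.

Let level_sum_active i k k' : 0 < start i -> low i k < start i ->
  level_sum k' = G (rho hatK x) - G (low i k').
Proof.
move=> s0 ls; rewrite level_sumE (bigD1 i)//= big1 ?addr0.
  by have [-> _] := rho_hat_active s0 ls.
move=> j ji; rewrite eq_sym in ji.
have [sj|sj] := leP (start j) 0.
  by rewrite !G0 ?subrr// (le_trans _ sj)// level_min_le.
by rewrite (low_inactive k' ji s0 ls sj) subrr.
Qed.

Lemma level_sum_cases : (exists i k, [/\ 0 < start i, low i k < start i &
    forall k', level_sum k' = G (rho hatK x) - G (low i k')]) \/
  ((forall i k, start i <= 0 \/ low i k = start i) /\ forall k', level_sum k' = 0).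
Proof.
have [[i [k [s0 ls]]]|no] := pselect (exists i k, 0 < start i /\ low i k < start i).
  by left; exists i, k; split => // k'; exact: level_sum_active s0 ls.
have H i k : start i <= 0 \/ low i k = start i.
  have [|s0] := leP (start i) 0; [by left|right].
  apply/eqP; rewrite eq_le level_min_le leNgt; apply/negP => ls.
  by apply: no; exists i, k.
right; split => // k'; rewrite level_sumE big1// => i _.
have [s0|->] := H i k'; last by rewrite subrr.
by rewrite !G0 ?subrr// (le_trans _ s0)// level_min_le.
Qed.

(** At most one corner contributes, so the bound depends neither on the level nor on the point; it
    is the domination for the passage to the limit. *)
Lemma level_sum_bound (C : R) k : (forall t, `|G t| <= C) -> `|level_sum k| <= C *+ 2.
Proof.
move=> GC; have C0 : 0 <= C by exact: le_trans (GC 0).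
case: level_sum_cases => [[i [k' [_ _ ->]]]|[_ ->]].
  by rewrite (le_trans (ler_normB _ _))// mulr2n lerD.
by rewrite normr0 mulrn_wge0.
Qed.

Lemma level_sum_out k : ~ hatK x -> level_sum k = 0.
Proof.
move=> nx; case: level_sum_cases => [[i [k' [s0 ls _]]]|[_ ->//]].
by case: nx; have [] := rho_hat_active s0 ls.
Qed.

Hypothesis Gc : continuous G.

Let rho_low i k : rho K x <= Num.max (low i k) 0.
Proof.
have [Kx|nKx] := pselect (K x); last by rewrite rho_out ?le_max ?lexx ?orbT// => /interior_subset.
rewrite /low; have [u [pu _ ->]] := level_minE L k (uni i).
by rewrite le_max (rho_le_lam cK pu Kx).
Qed.

(** At an active point, a normal nearly realizing [rho K x] either is in the open cone of the active
    corner, and is reached at a finite level, or is at least [start i], hence above every level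
    minimum. If no corner is active and the model distance is positive, a normal in the cone of a
    corner is at least [start i] and any other has the same support on both bodies, so the two
    distances agree. *)
Lemma level_sum_cvg : level_sum k @[k --> \oo] --> G (rho hatK x) - G (rho K x).
Proof.
have closed_cover i u : u != 0 -> closed_cone (E1 i) (E2 i) root_quad u ->
    exists N, forall k, (N <= k)%N -> Num.max (low i k) 0 <= Num.max (L u) 0.
  move=> u0 cu; have uE := closed_cone_root (detE i) cu.
  exists (`|detz u (E2 i)| + `|detz (E1 i) u|)%N => k Nk.
  have := @level_min_cover _ L LM (E1 i) (E2 i) k root_quad _ _ Nk.
  by rewrite qfst_root qsnd_root -uE; exact.
case: level_sum_cases => [[i [k0 [s0 ls lE]]]|[H lE]].
  rewrite (funext lE); apply: cvgB; first exact: cvg_cst.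
  have -> : (fun k => G (low i k)) = G \o (fun k => Num.max (low i k) 0).
    by apply/funext => k /=; have [t0|//] := leP (low i k) 0; rewrite !G0.
  suff cv : (fun k => Num.max (low i k) 0) @ \oo --> rho K x.
    exact: (cvg_comp _ G cv (@Gc (rho K x))).
  apply/cvgrPdist_lt => eps eps0.
  have [u pu uE] := rho_adherent x cK vK Kne eps0.
  have [N HN] : exists N, forall k, (N <= k)%N -> Num.max (low i k) 0 < rho K x + eps.
    have r0 := rho_ge0 x cK.
    have [cu|nc] := pselect (open_cone (E1 i) (E2 i) root_quad u).
      have cu' : closed_cone (E1 i) (E2 i) root_quad u by case: cu => ? ?; split; exact: ltW.
      have [N HN] := closed_cover i u (primitive_neq0 pu) cu'.
      exists N => k /HN/le_lt_trans; apply.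
      by rewrite gt_max uE/= ltr_pwDr.
    exists 0%N => k _; have := far s0 ls (primitive_neq0 pu) nc => su.
    rewrite gt_max; apply/andP; split; last by rewrite ltr_pwDr.
    exact: le_lt_trans (le_trans (level_min_le _ _ _ _ _) su) uE.
  exists N => // k /= /HN h; have := rho_low i k.
  by rewrite distrC ger0_norm ?subr_ge0//; move: h; rewrite -ltrBlDl.
rewrite (funext lE) (_ : rho hatK x = rho K x) ?subrr; first exact: cvg_cst.
apply/eqP; rewrite eq_le; apply/andP; split; last first.
  have [Kx|nKx] := pselect (K x); last first.
    by rewrite rho_out; [exact: rho_ge0|move=> /interior_subset].
  apply: le_rho_hat => //; first exact: rho_ge0 cK.
  by move=> e /extremal_primitive pe; exact: rho_le_lam.
have [r0|r0] := leP (rho hatK x) 0; first by apply: (le_trans r0); exact: rho_ge0 cK.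
have hx : hatK x by exact: hat_gt0.
apply: le_rho => //; first exact: ltW.
move=> u pu; have u0 := primitive_neq0 pu.
have [sE|[i [a [b uE]]]] := decomposition_cover cK vK K0 HT u0.
  have <- : lam hatK u x = lam K u x by rewrite /lam sE.
  exact: rho_le_lam chat pu hx.
have rs : rho hatK x <= start i by rewrite startE le_min !(rho_hat_le cK vK K0 _ hx).
apply: (le_trans rs).
have lowE : low i (a + b) = start i.
  by have [s0|] := H i (a + b)%N; first by have := lt_le_trans r0 (le_trans rs s0); rewrite ltxx.
have := @level_min_cover _ L LM (E1 i) (E2 i) (a + b) root_quad a b (leqnn _).
rewrite qfst_root qsnd_root -uE -/(low i (a + b)) lowE => /(_ u0).
have s0 := lt_le_trans r0 rs.
by rewrite ge_max le_max => /andP[/orP[//|]]; rewrite leNgt s0.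
Qed.

End pointwise.

(** * Integration over the levels of the tree *)

Section measurability.
Variable R : realType.
Notation mT := (measurableTypeR R).
Notation mu2 := (lebesgue_plane R).
Implicit Types (u : int * int).

Lemma measurable_lam (K : set (plane R)) u :
  measurable_fun setT (fun x : mT * mT => lam K u x).
Proof.
apply: measurable_funB; last exact: measurable_cst.
by apply: measurable_funD; apply: measurable_funM => //; exact: measurable_cst.
Qed.

Lemma countable_bigcap_measurable d (S : measurableType d) (P : set (int * int))
    (F : int * int -> set S) : (forall u, measurable (F u)) ->
  measurable (\bigcap_(u in P) F u).
Proof.
move=> mF; rewrite -[X in measurable X]setCK setC_bigcap; apply: measurableC.
rewrite bigcup_mkcond; apply: countable_bigcupT_measurable => [|u]; first exact: countableP.
by case: ifP => // _; exact: measurableC.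
Qed.

Section body.
Variable K : set (plane R).
Hypothesis cK : compact K.
Hypothesis vK : convex_set K.
Hypothesis K0 : K^° !=set0.

Let Kne : K !=set0.
Proof. by have [x /interior_subset Kx] := K0; exists x. Qed.

Let measurable_lam_ge u t : measurable [set x : mT * mT | t <= lam K u x].
Proof.
have := measurable_lam K u measurableT (measurable_itv `[t, +oo[).
rewrite setTI; congr measurable; apply/seteqP; split=> x /=; by rewrite in_itv/= andbT.
Qed.

Lemma measurable_body : measurable (K : set (mT * mT)).
Proof.
have -> : K = \bigcap_(u in [set: int * int]) [set x : mT * mT | 0 <= lam K u x].
  apply/seteqP; split=> [x Kx u _|x H]; first exact: lam_ge0.
  by apply: lam_ge0_mem => // u; exact: H.
by exact: countable_bigcap_measurable.
Qed.

(** By [le_rho], for t > 0 the set t <= rho is a countable intersection of half-planes. *)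
Lemma measurable_rho : measurable_fun setT (rho K : mT * mT -> R).
Proof.
apply: (measurability (@RGenCInfty.G R)) => [|/= _ [_] [t] -> <-].
  exact: RGenCInfty.measurableE.
rewrite setTI; have [t0|t0] := leP t 0.
  rewrite (_ : _ @^-1` _ = setT)//; apply/seteqP; split=> // x _ /=.
  by rewrite in_itv/= andbT (le_trans t0)// rho_ge0.
rewrite (_ : _ @^-1` _ = \bigcap_(u in primitive) [set x : mT * mT | t <= lam K u x]).
  by exact: countable_bigcap_measurable.
apply/seteqP; split=> x /=; rewrite in_itv/= andbT => H.
  move=> u pu; apply: (le_trans H); apply: rho_le_lam => //.
  by have := interior_subset (rho_gt0_int cK (lt_le_trans t0 H)).
by apply: le_rho => //; exact: ltW.
Qed.

Lemma body_finite_measure : (mu2 K < +oo)%E.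
Proof.
have [B B0 HB] := compact_coord_bound cK Kne; have [z Kz] := Kne.
pose A : set (mT * mT) := `[z.1 - B, z.1 + B]%classic `*` `[z.2 - B, z.2 + B]%classic.
apply: (@le_lt_trans _ _ (mu2 A)).
  apply: le_measure; rewrite ?inE; [exact: measurable_body|by apply: measurableX|].
  move=> x Kx; have [] := HB _ _ Kx Kz; rewrite !ler_norml => /andP[a b] /andP[c d].
  by split => /=; rewrite in_itv/=; apply/andP; split; lra.
rewrite /A (_ : mu2 _ = (lebesgue_measure `[(z.1 - B)%R, (z.1 + B)%R]%classic *
  lebesgue_measure `[(z.2 - B)%R, (z.2 + B)%R]%classic)%E); last exact: product_measure1E.
by rewrite !lebesgue_measure_itv/= !lte_fin; do 2?case: ifP => _; rewrite ?mule0 ?mul0e ?ltry// -!EFinB -EFinM ltry.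
Qed.

Lemma integrable_on_body (f : mT * mT -> R) (C : R) : measurable_fun setT f ->
  (forall x, ~ K x -> f x = 0) -> (forall x, `|f x| <= C) ->
  mu2.-integrable setT (EFin \o f).
Proof.
move=> mf f0 fC.
have -> : EFin \o f = (EFin \o f) \_ K.
  apply/funext => z; rewrite /= patchE; case: ifPn => // /negP zA.
  by rewrite f0// => Kz; apply: zA; rewrite inE.
apply/(integrable_mkcond _ measurable_body); apply: measurable_bounded_integrable => //.
- exact: measurable_body.
- exact: body_finite_measure.
- by apply: measurable_funTS.
- exists C; split; first exact: num_real.
  by move=> M CM z _; apply: le_trans (ltW CM).
Qed.

End body.
End measurability.

Section level_integral.
Variable R : realType.
Notation mT := (measurableTypeR R).
Notation mu := (@lebesgue_measure R).
Notation mu2 := (lebesgue_plane R).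
Variable G : R -> R.
Hypothesis G0 : forall t, t <= 0 -> G t = 0.
Hypothesis Gc : continuous G.
Variable C : R.
Hypothesis GC : forall t, `|G t| <= C.
Variable K : set (plane R).
Hypothesis cK : compact K.
Hypothesis vK : convex_set K.
Hypothesis K0 : K^° !=set0.

Let Kne : K !=set0.
Proof. by have [x /interior_subset Kx] := K0; exists x. Qed.

Local Notation hatK := (hat K).

Definition weight (f : R) : R := \int[mu]_(t in `[0, f]) ((f - t) * G t).

Lemma weightE f : (weight f)%:E = (\int[mu]_(t in `[0%R, f]) ((f - t) * G t)%:E)%E.
Proof.
rewrite /weight /Rintegral fineK//; apply: integrable_fin_num => //.
apply: continuous_compact_integrable; first exact: segment_compact.
apply: continuous_subspaceT => t; apply: cvgM; last exact: Gc.
by apply: cvgB; [exact: cvg_cst|exact: cvg_id].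
Qed.

Lemma qcut_corner_cut (e e' : int * int) q x :
  qcut (fun u => lam K u x) e e' G q = corner_cut G
    (gap K (qfst e e' q) (qsnd e e' q)) (lam K (qfst e e' q) x, lam K (qsnd e e' q) x).
Proof.
rewrite /qcut /corner_cut /qmin /qmid /=; congr (_ - G (Num.min _ _)).
by rewrite (gap_lam K _ _ x); lra.
Qed.

Lemma integral_qcut (e e' : int * int) q : unimodular e e' q ->
  mu2.-integrable setT (fun x => (qcut (fun u => lam K u x) e e' G q)%:E) /\
  (\int[mu2]_x (qcut (fun u => lam K u x) e e' G q)%:E =
   (weight (gap K (qfst e e' q) (qsnd e e' q)))%:E)%E.
Proof.
set f := gap K _ _ => D.
have f0 : 0 <= f by exact: gap_ge0.
set v := qfst e e' q in f f0 *; set w := qsnd e e' q in f f0 *.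
have cE x : qcut (fun u => lam K u x) e e' G q = corner_cut G f
    ((v.1)%:~R * x.1 + (v.2)%:~R * x.2 + - supp K v, (w.1)%:~R * x.1 + (w.2)%:~R * x.2 + - supp K w).
  by rewrite qcut_corner_cut.
have mp : measure_invariant (fun x : mT * mT =>
    (((v.1)%:~R * x.1 + (v.2)%:~R * x.2 + - supp K v)%R, ((w.1)%:~R * x.1 + (w.2)%:~R * x.2 + - supp K w)%R)).
  apply: measure_invariant_affine.
  by rewrite -!intrM -intrB; move: D; rewrite /unimodular /detz -/v -/w => ->.
have mc : measurable_fun setT (corner_cut G f) by exact: measurable_corner_cut.
split.
  under eq_fun do rewrite cE.
  apply/integrableP; split.
    by apply/measurable_EFinP; apply: (measurableT_comp mc); exact: mp.1.
  have /integrableP[_] := integrable_corner_cut Gc G0 f0.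
  rewrite -(integral_invariant mp) //.
  by apply/measurable_EFinP; apply: measurableT_comp => //; exact: mc.
under eq_integral do rewrite cE.
rewrite weightE -integral_corner_cut// -(integral_invariant mp)//.
by apply/measurable_EFinP.
Qed.

Lemma measurable_G : measurable_fun setT (G : mT -> R).
Proof. exact: continuous_measurable_fun. Qed.

Lemma rho_comp_out A x : ~ A x -> G (rho A x) = 0.
Proof. by move=> nA; rewrite rho_out ?G0// => /interior_subset. Qed.

Lemma integrable_rho_comp : mu2.-integrable setT (EFin \o (fun x => G (rho K x))).
Proof.
apply: (@integrable_on_body _ K cK vK K0 _ C) => //.
- by apply: measurableT_comp; [exact: measurable_G|exact: measurable_rho].
- by move=> x; exact: rho_comp_out.
Qed.

End level_integral.

Lemma integral_sum_seq d (S : measurableType d) (R : realType)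
    (nu : {measure set S -> \bar R}) (I : eqType) (s : seq I) (f : I -> S -> \bar R) :
  (forall q, q \in s -> nu.-integrable setT (f q)) ->
  nu.-integrable setT (fun x => \sum_(q <- s) f q x)%E /\
  (\int[nu]_x (\sum_(q <- s) f q x) = \sum_(q <- s) \int[nu]_x f q x)%E.
Proof.
elim: s => [|q s IH] fi.
  under eq_fun do rewrite big_nil.
  by rewrite integral0 big_nil; split => //; exact: integrable0.
have [i1 e1] := IH (fun q' qs => fi q' (@mem_behead _ (q :: s) q' qs)).
have i2 := fi q (mem_head _ _).
under eq_fun do rewrite big_cons.
by rewrite integralD// big_cons e1; split => //; exact: integrableD.
Qed.

Section level_limit.
Variable R : realType.
Notation mT := (measurableTypeR R).
Notation mu := (@lebesgue_measure R).
Notation mu2 := (lebesgue_plane R).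
Variable G : R -> R.
Hypothesis G0 : forall t, t <= 0 -> G t = 0.
Hypothesis Gc : continuous G.
Variable C : R.
Hypothesis GC : forall t, `|G t| <= C.
Variable K : set (plane R).
Hypothesis cK : compact K.
Hypothesis vK : convex_set K.
Hypothesis K0 : K^° !=set0.
Variables (n : nat) (T : 'I_n -> gamma_triangle R).
Hypothesis HT : gamma_decomposition K T.
Local Notation hatK := (hat K).
Local Notation E1 i := (normal1 (T i)).
Local Notation E2 i := (normal2 (T i)).

Definition level_weight k : R := \sum_(i < n) \sum_(q <- tree k root_quad)
  weight G (gap K (qfst (E1 i) (E2 i) q) (qsnd (E1 i) (E2 i) q)).

Let Kne : K !=set0.
Proof. by have [x /interior_subset Kx] := K0; exists x. Qed.

Let chat := compact_hat cK vK K0.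
Let vhat : convex_set hatK := @convex_hat _ K.
Let hat0 := interior_hat cK K0.

Let tree_uni k q i : q \in tree k root_quad -> unimodular (E1 i) (E2 i) q.
Proof. by move=> /tree_unimodular; apply: (unimodular_quadP _ (detz_normals _)).2. Qed.

Let level_integral k : mu2.-integrable setT (fun x => (level_sum K T x G k)%:E) /\
  (\int[mu2]_x (level_sum K T x G k)%:E = (level_weight k)%:E)%E.
Proof.
have D i := @integral_sum_seq _ _ R mu2 _ (tree k root_quad)
  (fun q x => (qcut (fun u => lam K u x) (E1 i) (E2 i) G q)%:E)
  (fun q qt => (integral_qcut G0 Gc cK K0 (tree_uni i qt)).1).
have [] := @integral_sum_seq _ _ R mu2 _ (index_enum 'I_n)
  (fun i x => \sum_(q <- tree k root_quad) (qcut (fun u => lam K u x) (E1 i) (E2 i) G q)%:E)%E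
  (fun i _ => (D i).1).
have E x : (\sum_(i < n) \sum_(q <- tree k root_quad)
    (qcut (fun u => lam K u x) (E1 i) (E2 i) G q)%:E = (level_sum K T x G k)%:E)%E.
  by rewrite /level_sum -sumEFin; apply: eq_bigr => i _; rewrite -sumEFin.
under eq_fun do rewrite E.
move=> h ->; split => //; rewrite /level_weight -sumEFin; apply: eq_bigr => i _.
rewrite (D i).2 -sumEFin; apply: eq_big_seq => q qt.
by have [_ ->] := integral_qcut G0 Gc cK K0 (tree_uni i qt).
Qed.

Lemma level_weight_cvg : level_weight k @[k --> \oo] -->
  \int[mu2]_x G (rho hatK x) - \int[mu2]_x G (rho K x).
Proof.
have C0 : 0 <= C by exact: le_trans (GC 0).
have mh : measurable (hatK : set (mT * mT)) by exact: measurable_body.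
have ig : mu2.-integrable setT ((fun=> (C *+ 2)%:E) \_ hatK).
  apply/(integrable_mkcond _ mh); apply: measurable_bounded_integrable => //.
  - exact: body_finite_measure.
  - by exists (C *+ 2); split; [exact: num_real|move=> M CM z _ /=; rewrite ger0_norm ?mulrn_wge0// ltW].
have [||||_ _] := @dominated_convergence _ _ R mu2 setT measurableT
  (fun k x => (level_sum K T x G k)%:E) (fun x => (G (rho hatK x) - G (rho K x))%:E) _ _ _ _ ig.
- by move=> k; have [/integrableP[]] := level_integral k.
- apply/measurable_EFinP; apply: measurable_funB;
    (apply: measurableT_comp; [exact: measurable_G|exact: measurable_rho]).
- apply: aeW => x _; apply: cvg_EFin; first by apply: nearW.
  exact: level_sum_cvg.
- apply: aeW => x k _; rewrite patchE; case: ifPn => xh.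
    by rewrite lee_fin; exact: level_sum_bound.
  by rewrite level_sum_out ?abse0 ?lexx// => hx; case/negP: xh; rewrite inE.
rewrite (_ : (fun k => _) = EFin \o level_weight); last first.
  by apply/funext => k; have [] := level_integral k.
have i1 := integrable_rho_comp G0 Gc GC chat vhat hat0.
have i2 := integrable_rho_comp G0 Gc GC cK vK K0.
rewrite (_ : (\int[mu2]_x _)%E = (\int[mu2]_x G (rho hatK x) - \int[mu2]_x G (rho K x))%:E).
  by move/fine_cvgP => [].
under eq_integral do rewrite EFinB.
rewrite integralB// /Rintegral EFinB !fineK//; exact: integrable_fin_num.
Qed.

End level_limit.

(** * Integral over the minimal model *)

Lemma detzMn (u w : int * int) (k : nat) : detz (u *+ k) w = detz u w *+ k.
Proof. by elim: k => [|k IH]; rewrite ?mulr0n ?detz0// !mulrS detzDl IH. Qed.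

Section edge_neighbours.
Variable R : realType.
Variable K : set (plane R).
Hypothesis cK : compact K.
Hypothesis vK : convex_set K.
Hypothesis K0 : K^° !=set0.
Implicit Types (u w f : int * int) (x y z p q d : plane R).

Let Kne : K !=set0.
Proof. by have [x /interior_subset Kx] := K0; exists x. Qed.

Local Notation ext := (extremal K).
Local Notation m := (rho_max K).
Let m0 : 0 < m := rho_max_gt0 cK vK K0.

Lemma primitive_det e u (c : int) : c * detz e u = 1 -> primitive u.
Proof.
move=> D; rewrite /primitive /=; apply/coprimezP.
by exists (- (c * e.2), c * e.1) => /=; rewrite -D /detz; ring.
Qed.

(** The sign [sg] treats both ends of a side at once. Without such a normal, p could be moved along
    the line on which lam e = m, remaining a maximum point and lowering [sg] f, against the choice
    of p. *)
Lemma exists_side_normal (sg : int) e f p : sg * sg = 1 -> detz e f = 1 -> tight K e p ->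
  (forall q, tight K e q -> sg%:~R * pairing f p <= sg%:~R * pairing f q) ->
  exists2 u, tight K u p & 0 < sg * detz e u.
Proof.
move=> sg2 D [pe tp ep] pmin; apply: contrapT => H.
have H' u : tight K u p -> sg * detz e u <= 0.
  by move=> ut; rewrite leNgt; apply/negP => h; apply: H; exists u.
pose d : plane R := ((sg * e.2)%:~R, - (sg * e.1)%:~R).
have ud u : pairing u d = - (sg * detz e u)%:~R.
  by rewrite /pairing /d /detz /= !rmorphM rmorphB /= !rmorphM /=; ring.
have [u ut|c c0 tpc] := @tight_move _ K cK vK K0 p d tp.
  by rewrite ud oppr_ge0 lerz0; exact: H'.
have := pmin (p + scaled c d); rewrite -subr_ge0 => /(_ _).
have -> : pairing f (p + scaled c d) = pairing f p + c * pairing f d.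
  by rewrite /pairing /scaled /=; ring.
rewrite ud D mulr1 => h.
have : tight K e (p + scaled c d).
  by split => //; rewrite lam_move ep ud detzz mulr0 oppr0 mulr0 addr0.
move=> /h; rewrite [X in 0 <= X](_ : _ = - c * (sg * sg)%:~R); last by rewrite rmorphM /=; ring.
by rewrite sg2 mulr1 oppr_ge0 leNgt c0.
Qed.

(** Descent on the determinant: as long as it is not a unit, a lattice point of the triangle 0, e, u
    is again tight at p, with a smaller determinant of the same sign. *)
Lemma exists_unit_normal (sg : int) e p u : sg * sg = 1 -> tight K e p -> tight K u p ->
  0 < sg * detz e u -> exists2 w, tight K w p & detz e w = sg.
Proof.
move=> sg2 et; have [N] := ubnP `|detz e u|%N; elim: N u => // N IH u lt ut du.
have [d1|d1] := eqVneq `|detz e u| 1; first by exists u => //; nia.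
have D0 : detz e u != 0 by apply: contraTneq du => ->; rewrite mulr0 ltxx.
have [pe _ _] := et.
have [z [a [b [zE a0 /andP[b0 b1] ab]]]] := exists_lattice_point_in_triangle R pe D0 d1.
have [_ dz] := combination_det zE.
have z0 : z != 0.
  apply: contraTneq isT => z0; move: dz; rewrite z0 detzC detz0 oppr0 => /esym/eqP.
  by rewrite mulf_eq0 intr_eq0 (negbTE D0) orbF gt_eqF.
have [zt _] := tight_combination cK vK K0 zE a0 (ltW b0) ab z0 et ut.
have sz : (sg * detz e z)%:~R = b * (sg * detz e u)%:~R :> R by rewrite !rmorphM /= dz; ring.
have dz0 : 0 < sg * detz e z by rewrite -(ltr0z R) sz mulr_gt0 ?ltr0z.
apply: (IH z) => //.
have : sg * detz e z < sg * detz e u by rewrite -(ltr_int R) sz gtr_pMl// ltr0z.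
have [sE|sE] : sg = 1 \/ sg = -1 by nia.
  by rewrite sE in dz0 du *; lia.
by rewrite sE in dz0 du *; lia.
Qed.

(** The point p is an end of the set of maximum points where e is tight. Among w + k e the last one
    tight at p before the first failure is taken; it exists as there are finitely many extremal
    normals. *)
Lemma exists_neighbour (sg : int) e f : sg * sg = 1 -> detz e f = 1 -> ext e ->
  exists p w, [/\ tight K e p, tight K w p, detz e w = sg & ~ tight K (w + e) p].
Proof.
move=> sg2 D /(extremalP cK vK K0)[p0 ep0].
pose S := top K `&` [set q | lam K e q = m].
have tightE q : tight K e q <-> S q.
  have [pe _ _] := ep0.
  by split => [[_ tq eq]|[tq eq]].
have cS : compact S.
  apply: compact_closedI; first exact: compact_top.
  have /continuous_closedP h := @continuous_lam _ K e.
  by apply: (h [set t : R | t = m]); exact: closed_eq.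
have [p Sp pmin] := compact_rpairing_min (vec R (sg * f.1, sg * f.2)) cS (ex_intro _ p0 ((tightE p0).1 ep0)).
have sfE x : pairing (sg * f.1, sg * f.2) x = sg%:~R * pairing f x.
  by rewrite /pairing /= !rmorphM /=; ring.
have et : tight K e p by apply/tightE.
have [q /tightE/pmin|u ut du] := @exists_side_normal sg e f p sg2 D et.
  by rewrite -!pairingE !sfE.
have [w wt wD] := exists_unit_normal sg2 et ut du.
have wkD k : detz e (w + e *+ k) = sg.
  rewrite detzDr wD; by rewrite detzC detzMn detzz mul0rn oppr0 addr0.
have [k [kt nkt]] : exists k, tight K (w + e *+ k) p /\ ~ tight K (w + e *+ k.+1) p.
  apply: contrapT => H.
  have tk k : tight K (w + e *+ k) p.
    elim: k => [|k IH]; first by rewrite mulr0n addr0.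
    by apply: contrapT => nk; apply: H; exists k.
  have [s sP] := extremal_seq cK vK K0.
  have := @uniq_leq_size _ [seq w + e *+ k | k <- iota 0 (size s).+1] s.
  rewrite size_map size_iota ltnn map_inj_uniq ?iota_uniq.
    have HH : {subset [seq w + e *+ k | k <- iota 0 (size s).+1] <= s}.
      by move=> _ /mapP[k _ ->]; apply/sP/(extremalP cK vK K0); exists p.
    by move=> /(_ isT HH).
  by move=> k k' /addrI/(congr1 (fun v => detz v f)); rewrite !detzMn D !natz => -[].
exists p, (w + e *+ k); split => //.
by rewrite -addrA -mulrSr.
Qed.

(* With [u = a e + b w]: for [a + b <= 1] use the common point [p], for [a <= 0] use
   subadditivity; [a, b > 0] would make [w + e] tight at [p]. *)
Lemma neighbour_dominates (sg : int) e w p u x : sg * sg = 1 ->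
  tight K e p -> tight K w p -> detz e w = sg -> ~ tight K (w + e) p ->
  ext u -> 0 < sg * detz e u -> 0 < lam K e x <= m -> lam K e x < lam K w x ->
  lam K e x < lam K u x.
Proof.
move=> sg2 et wt wD nwt extu du /andP[x0 xm] xw.
have [pe tp ep] := et; have [_ _ wp] := wt.
pose al : R := (sg * detz u w)%:~R; pose be : R := (sg * detz e u)%:~R.
have be1 : 1 <= be by rewrite /be ler1z; lia.
have uC y : pairing u y = al * pairing e y + be * pairing w y.
  rewrite -[LHS]mul1r (_ : 1 = (sg * detz e w)%:~R :> R); last by rewrite wD sg2.
  by rewrite /al /be /pairing /detz !rmorphM !rmorphB /= !rmorphM /=; ring.
have uL y z : lam K u y = lam K u z + al * (lam K e y - lam K e z) + be * (lam K w y - lam K w z).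
  by rewrite /lam !uC; ring.
have [pu u0] : primitive u /\ u != 0.
  by have pu := extremal_primitive extu; split => //; exact: primitive_neq0.
have [ab1|ab1] := leP (al + be) 1.
  have := uL x p; have := tp _ pu; rewrite ep wp; nra.
have [al0|al0] := leP al 0.
  have [y Ky yE] := support_attained w cK Kne.
  have h1 : supp K u <= pairing u y by exact: support_le.
  have h2 : supp K e <= pairing e y by exact: support_le.
  have : be * lam K w x + al * lam K e x <= lam K u x.
    by move: h1; rewrite /lam yE !uC; nra.
  nra.
have al1 : 1 <= al by move: al0; rewrite /al ltr0z ler1z; lia.
have up : lam K u p = m.
  have [p' [_ tp' up']] := (extremalP cK vK K0 u).1 extu.
  apply/eqP; rewrite eq_le tp// andbT.
  have := uL p' p; rewrite up' ep wp.
  have := tp' _ pe; have [pw _ _] := wt; have := tp' _ pw; nra.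
case: nwt; have pwe : primitive (w + e).
  by apply: (@primitive_det e _ sg); rewrite detzDr wD detzz addr0.
split => //; apply/eqP; rewrite eq_le tp// andbT.
have [y Ky yE] := support_attained (w + e) cK Kne.
have h1 : supp K u <= pairing u y by exact: support_le.
have h2 : supp K e <= pairing e y by exact: support_le.
have h3 : supp K w <= pairing w y by exact: support_le.
rewrite /lam yE !pairingD; move: up ep wp h1; rewrite /lam !uC => up ep wp h1.
have : (be - 1) * (pairing e p - pairing e y) <= (be - 1) * m by apply: ler_wpM2l; lra.
have : (al - 1) * (pairing w p - pairing w y) <= (al - 1) * m by apply: ler_wpM2l; lra.
have ab0 : 0 < al + be - 1 by lra.
move=> h4 h5; rewrite -(ler_pM2l ab0); lra.
Qed.

End edge_neighbours.

(** * Integrals over a region between two lines *)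

Section strip_integral.
Variable R : realType.
Notation mT := (measurableTypeR R).
Notation mu := (@lebesgue_measure R).
Notation mu2 := (lebesgue_plane R).
Variable G : R -> R.
Hypothesis G0 : forall t, t <= 0 -> G t = 0.
Hypothesis Gc : continuous G.
Variables (m c0 c1 d0 d1 : R) (S : set (mT * mT)).
Hypothesis m0 : 0 < m.
Hypothesis mS : measurable S.
Hypothesis S_strip : forall t y, S (t, y) -> 0 < t -> t <= m /\ c0 + c1 * t <= y <= d0 + d1 * t.
Hypothesis strip_S : forall t y, 0 < t < m -> c0 + c1 * t < y < d0 + d1 * t -> S (t, y).
Hypothesis strip_le : forall t, 0 < t < m -> c0 + c1 * t <= d0 + d1 * t.

Definition strip_fun (z : mT * mT) : R := G z.1 * \1_S z.

Lemma measurable_strip : measurable_fun setT strip_fun.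
Proof.
apply: measurable_funM => //.
exact: (measurableT_comp (continuous_measurable_fun Gc) measurable_fst).
Qed.

Lemma strip_section t : 0 < t < m ->
  mu (xsection S t) = (d0 - c0 + (d1 - c1) * t)%:E.
Proof.
move=> tm; have le := strip_le tm; have /andP[t0 t1] := tm.
have mSt : measurable (xsection S t) by exact: measurable_xsection.
apply/eqP; rewrite eq_le; apply/andP; split.
  apply: (@le_trans _ _ (mu `[c0 + c1 * t, d0 + d1 * t]%classic)).
    apply: le_measure; rewrite ?inE//.
    move=> y; rewrite xsectionE /= in_itv/= => Sy.
    by have [] := S_strip Sy t0.
  by rewrite lebesgue_measure_itv/= lte_fin; case: ifP => _; rewrite -?EFinB lee_fin; lra.
apply: (@le_trans _ _ (mu `]c0 + c1 * t, d0 + d1 * t[%classic)).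
  rewrite lebesgue_measure_itv/= lte_fin; case: ltP => [_|h]; rewrite -?EFinB lee_fin; lra.
apply: le_measure; rewrite ?inE//.
by move=> y; rewrite xsectionE /= in_itv/=; exact: strip_S.
Qed.

Lemma strip_fun_integrable : mu2.-integrable setT (EFin \o strip_fun).
Proof.
have [C [C0 HC]] := continuous_bounded_itv Gc 0 m.
pose B := `|c0| + `|c1| * m + `|d0| + `|d1| * m.
pose A : set (mT * mT) := `[0, m]%classic `*` `[- B, B]%classic.
have mA : measurable A by apply: measurableX.
have -> : EFin \o strip_fun = (EFin \o strip_fun) \_ A.
  apply/funext => -[t y]; rewrite /= patchE; case: ifPn => // /negP zA.
  rewrite /strip_fun /= indicE; have [/set_mem Sz|_] := boolP ((t, y) \in S); last by rewrite mulr0.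
  have [t0|t0] := leP t 0; first by rewrite G0// mul0r.
  exfalso; apply: zA; rewrite inE; have [tm /andP[h1 h2]] := S_strip Sz t0.
  have c1t : `|c1 * t| <= `|c1| * m by rewrite normrM ler_wpM2l// ger0_norm// ltW.
  have d1t : `|d1 * t| <= `|d1| * m by rewrite normrM ler_wpM2l// ger0_norm// ltW.
  have := ler_norm d0; have := ler_norm (- c0); rewrite normrN.
  move: c1t d1t; rewrite !ler_norml => /andP[? ?] /andP[? ?] ? ?.
  have := normr_ge0 d0; have := normr_ge0 c0 => ? ?.
  have ? : 0 <= `|c1| * m by rewrite mulr_ge0// ltW.
  have ? : 0 <= `|d1| * m by rewrite mulr_ge0// ltW.
  by split => /=; rewrite in_itv/=; apply/andP; split; rewrite /B; lra.
apply/(integrable_mkcond _ mA); apply: measurable_bounded_integrable => //.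
- rewrite /A (_ : mu2 _ = (mu `[0%R, m]%classic * mu `[(- B)%R, B]%classic)%E); last exact: product_measure1E.
  by rewrite !lebesgue_measure_itv/= !lte_fin; do 2?case: ifP => _; rewrite ?mule0 ?mul0e ?ltry// -!EFinB -EFinM ltry.
- by apply: measurable_funTS; exact: measurable_strip.
- exists C; split; first exact: num_real.
  move=> M CM [t y] [/= t0 _]; rewrite in_itv/= in t0; apply: le_trans (ltW CM).
  rewrite /strip_fun /= normrM (ger0_norm (x := \1_S _)) ?indicE// -[leRHS]mulr1.
  by apply: ler_pM => //; [exact: HC|case: (_ \in _)].
Qed.

Lemma integral_strip : (\int[mu2]_z (strip_fun z)%:E =
  \int[mu]_(t in `[0%R, m]) (G t * (d0 - c0 + (d1 - c1) * t))%:E)%E.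
Proof.
rewrite -(integral12_prod_meas1 strip_fun_integrable) [RHS]integral_mkcond.
have cH : continuous (fun t => G t * (d0 - c0 + (d1 - c1) * t)).
  move=> t; apply: cvgM; first exact: Gc.
  by apply: cvgD; [exact: cvg_cst|apply: cvgM; [exact: cvg_cst|exact: cvg_id]].
apply: ae_eq_integral => //.
- exact: measurable_fubini_F strip_fun_integrable.
- have mH : measurable_fun setT (fun t : mT => (G t * (d0 - c0 + (d1 - c1) * t))%:E).
    by apply/measurable_EFinP; exact: continuous_measurable_fun.
  exact: ((measurable_restrictT _ (measurable_itv `[0, m])).1 (measurable_funTS mH)).
(* At t = m the hypotheses do not determine the section of [S]; a single abscissa is negligible. *)
exists [set m]; split => //; first exact: lebesgue_measure_set1.
move=> t /= H; apply: contrapT => tm; apply: H => _.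
rewrite /fubini_F patchE.
transitivity (\int[mu]_(y in xsection S t) (G t)%:E)%E.
  rewrite [RHS]integral_mkcond; apply: eq_integral => y _.
  by rewrite /= patchE mem_xsection /strip_fun indicE /=; case: (_ \in _); rewrite ?mulr1 ?mulr0.
have mSt : measurable (xsection S t) by exact: measurable_xsection.
have [t0|t0] := leP t 0.
  rewrite G0// integral0; case: ifP => //; rewrite mul0r//.
rewrite integral_cst//; have [tm'|mt] := ltP t m.
  have tm2 : 0 < t < m by rewrite t0.
  rewrite [X in (_ * X)%E](strip_section tm2) mem_set/= ?in_itv/= ?(ltW t0) ?(ltW tm')// EFinM//.
have mt' : m < t by rewrite lt_neqAle mt andbT eq_sym; apply/eqP.
have S0 : xsection S t = set0.
  by apply/seteqP; split => // y; rewrite xsectionE /= => /S_strip/(_ t0)[]; lra.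
rewrite S0 measure0 mule0; case: ifPn => //.
by rewrite inE/= in_itv/= => /andP[_ h]; have := lt_le_trans mt' h; rewrite ltxx.
Qed.

End strip_integral.

Section hat_integral.
Variable R : realType.
Notation mT := (measurableTypeR R).
Notation mu := (@lebesgue_measure R).
Notation mu2 := (lebesgue_plane R).
Variable K : set (plane R).
Hypothesis cK : compact K.
Hypothesis vK : convex_set K.
Hypothesis K0 : K^° !=set0.
Implicit Types (u w f : int * int) (x y z p q d : plane R).

Let Kne : K !=set0.
Proof. by have [x /interior_subset Kx] := K0; exists x. Qed.

Local Notation ext := (extremal K).
Local Notation hatK := (hat K).
Local Notation m := (rho_max K).
Let m0 : 0 < m := rho_max_gt0 cK vK K0.

Variable s : seq (int * int).
Hypothesis sP : forall u, u \in s <-> ext u.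

(* Ties are broken by the order of [s], so that the territories partition the plane. *)
Definition territory e : set (plane R) := [set x | forall u, u \in s ->
  lam K e x <= lam K u x /\ ((index u s < index e s)%N -> lam K e x < lam K u x)].

Lemma measurable_territory e : measurable (territory e : set (mT * mT)).
Proof.
have mle u w : measurable [set x : mT * mT | lam K u x <= lam K w x].
  have := measurable_fun_le measurableT (measurable_lam K u) (measurable_lam K w).
  by rewrite setTI.
have mlt u : measurable [set x : mT * mT | lam K e x < lam K u x].
  rewrite (_ : mkset _ = ~` [set x : mT * mT | lam K u x <= lam K e x]); first exact: measurableC.
  by apply/seteqP; split => x /=; rewrite ltNge => /negP.
rewrite (_ : territory e = (\bigcap_(u in [set` s]) [set x : mT * mT | lam K e x <= lam K u x]) `&`
  \bigcap_(u in [set u | u \in s /\ (index u s < index e s)%N]) [set x : mT * mT | lam K e x < lam K u x]).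
  by apply: measurableI; exact: countable_bigcap_measurable.
apply/seteqP; split => [x H|x [H1 H2] u us].
  by split=> [u us|u [us ui]]; have [h1 h2] := H u us; [exact: h1|exact: h2].
by split; [exact: H1|move=> ui; exact: H2].
Qed.

(** The owner of x is the first normal of [s] that minimizes [lam] at x. *)
Lemma exists_territory x : exists e, [/\ e \in s, territory e x &
  forall e', e' \in s -> territory e' x -> e' = e].
Proof.
have [e0 [e0s e0min]] : exists e0, e0 \in s /\ forall u, u \in s -> lam K e0 x <= lam K u x.
  have : s != [::].
    have [p tp] := exists_top cK K0; have [u ut] := exists_tight cK vK K0 tp.
    have : u \in s by apply/sP/(extremalP cK vK K0); exists p.
    by apply: contraTneq => ->.
  elim: (s) => // u r IH _; have [->|/IH[e0 [e0r e0min]]] := eqVneq r [::].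
    by exists u; rewrite inE eqxx; split => // w; rewrite inE => /eqP ->.
  have [h|h] := leP (lam K u x) (lam K e0 x).
    exists u; rewrite inE eqxx; split => // w; rewrite inE => /predU1P[->//|wr].
    exact: le_trans h (e0min _ wr).
  exists e0; rewrite inE e0r orbT; split => // w; rewrite inE => /predU1P[->|]; last exact: e0min.
  exact: ltW.
pose P u := lam K u x == lam K e0 x.
have hP : has P s by apply/hasP; exists e0 => //; rewrite /P.
pose e := nth e0 s (find P s).
have fs : (find P s < size s)%N by rewrite -has_find.
have es : e \in s by exact: mem_nth.
have eE : lam K e x = lam K e0 x by apply/eqP; exact: (nth_find e0 hP).
exists e; split => //.
  move=> u us; rewrite eE; split; first exact: e0min.
  move=> ui; rewrite lt_neqAle e0min// andbT.
  have uf : (index u s < find P s)%N.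
    apply: (leq_trans ui); rewrite leqNgt; apply/negP => fi.
    by have := before_find e0 fi; rewrite /= -/e eqxx.
  by have := before_find e0 uf; rewrite nth_index// /P eq_sym => ->.
move=> e' e's Te'.
have E : lam K e' x = lam K e0 x.
  by apply/eqP; rewrite eq_le e0min// andbT -eE; have [] := Te' _ es.
have h1 : ~~ (index e s < index e' s)%N.
  by apply/negP => h; have [_ /(_ h)] := Te' _ es; rewrite E eE ltxx.
have h2 : ~~ (index e' s < index e s)%N.
  apply/negP => h; have uf : (index e' s < find P s)%N.
    apply: (leq_trans h); rewrite leqNgt; apply/negP => fi.
    by have := before_find e0 fi; rewrite /= -/e eqxx.
  by have := before_find e0 uf; rewrite nth_index// /P E eqxx.
have ii : index e s = index e' s by lia.
by rewrite -(nth_index e0 es) ii nth_index.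
Qed.

Lemma sum_territory (G : R -> R) x : (forall t, t <= 0 -> G t = 0) -> uniq s ->
  G (rho hatK x) = \sum_(e <- s) G (lam K e x) * \1_(territory e) x.
Proof.
move=> G0 us; have [e [es ex eu]] := exists_territory x.
rewrite (bigD1_seq e)//= indicE mem_set// mulr1 big1_seq ?addr0; last first.
  move=> e' /andP[e'e e's]; rewrite indicE memNset ?mulr0// => e'x.
  by rewrite (eu _ e's e'x) eqxx in e'e.
have exte := (sP e).1 es.
have [l0|l0] := ltP 0 (lam K e x).
  congr G; have ge : lam K e x <= rho hatK x.
    apply: le_rho_hat => //; first exact: ltW.
    by move=> u /sP us'; have [] := ex u us'.
  apply/eqP; rewrite eq_le ge andbT; apply: rho_hat_le => //.
  have := interior_subset (rho_gt0_int (compact_hat cK vK K0) (lt_le_trans l0 ge)).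
  exact.
rewrite !G0//; have [hx|nhx] := pselect (hatK x).
  by apply: le_trans l0; exact: rho_hat_le.
by rewrite rho_out// => /interior_subset.
Qed.

Section one_edge.
Variable e : int * int.
Hypothesis es : e \in s.

(** In the coordinates (lam e, <f, .>), where detz e f = 1, the part lam e > 0 of the territory is,
    up to its edges, the strip between the lines on which the two neighbours [w1] and [w2] take the
    same value as e. The constants are chosen before [G], so that they do not depend on the
    exponent. *)
Lemma integral_territory : exists (A : R) (k : int), forall G : R -> R,
  (forall t, t <= 0 -> G t = 0) -> continuous G ->
  mu2.-integrable setT (fun x => (G (lam K e x) * \1_(territory e) x)%:E) /\
  (\int[mu2]_x (G (lam K e x) * \1_(territory e) x)%:E =
   \int[mu]_(t in `[0%R, m]) (G t * (A + k%:~R * (m - t)))%:E)%E.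
Proof.
have exte := (sP e).1 es.
have [f D] : exists f, detz e f = 1.
  have /coprimezP[[a b] /= ab] := extremal_primitive exte.
  by exists (- b, a); rewrite -ab /detz /=; ring.
have [p1 [w1 [ep1 wp1 D1 n1]]] := exists_neighbour cK vK K0 (sg := 1) (mulr1 1) D exte.
have [p2 [w2 [ep2 wp2 D2 n2]]] := exists_neighbour cK vK K0 (sg := -1) (mulrNN 1 1) D exte.
pose a1 : R := (detz w1 f)%:~R; pose a2 : R := (detz w2 f)%:~R.
pose y1 := pairing f p1; pose y2 := pairing f p2.
have lamE u p x : lam K u x = lam K u p + (detz u f)%:~R * (lam K e x - lam K e p)
    + (detz e u)%:~R * (pairing f x - pairing f p).
  have pE z : pairing u z = (detz u f)%:~R * pairing e z + (detz e u)%:~R * pairing f z.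
    transitivity ((detz e f)%:~R * pairing u z); first by rewrite D mul1r.
    by rewrite /pairing /detz !rmorphB /= !rmorphM /=; ring.
  by rewrite /lam !pE; ring.
have [pe tp1 e1] := ep1; have [pw1 _ w1p] := wp1.
have [_ tp2 e2] := ep2; have [pw2 _ w2p] := wp2.
have lam1 x : lam K w1 x = m + a1 * (lam K e x - m) + (pairing f x - y1).
  by rewrite (lamE w1 p1 x) w1p e1 D1 mul1r.
have lam2 x : lam K w2 x = m + a2 * (lam K e x - m) - (pairing f x - y2).
  by rewrite (lamE w2 p2 x) w2p e2 D2 mulN1r.
pose inv (z : mT * mT) : plane R := ((z.1 + supp K e) * f.2%:~R - z.2 * e.2%:~R,
  - (z.1 + supp K e) * f.1%:~R + z.2 * e.1%:~R).
pose psi (x : mT * mT) : mT * mT := (lam K e x, pairing f x).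
have DR : e.1%:~R * f.2%:~R - e.2%:~R * f.1%:~R = 1 :> R.
  by rewrite -!rmorphM -rmorphB /= -[X in X%:~R]/(detz e f) D.
have inv1 z : lam K e (inv z) = z.1.
  by rewrite -[RHS]mul1r -[1 in RHS]DR /lam /pairing /inv /= -[supp K e in X in _ - X]mul1r -[1 in X in _ - X]DR; ring.
have inv2 z : pairing f (inv z) = z.2.
  by rewrite -[RHS]mul1r -[1 in RHS]DR /pairing /inv /=; ring.
have psiK x : inv (psi x) = x.
  case: x => X Y; rewrite /inv /psi /= /lam subrK /pairing /=; congr pair.
    by transitivity ((e.1%:~R * f.2%:~R - e.2%:~R * f.1%:~R) * (X : R)); [ring|rewrite DR mul1r].
  by transitivity ((e.1%:~R * f.2%:~R - e.2%:~R * f.1%:~R) * (Y : R)); [ring|rewrite DR mul1r].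
pose S : set (mT * mT) := inv @^-1` territory e.
(* The width at t = m is y2 - y1, and the edges have the integral slopes 1 - a1 and a2 - 1. *)
exists (y2 - y1), (2 - detz w1 f - detz w2 f) => G G0 Gc.
have mS : measurable S.
  have minv : measurable_fun setT (inv : mT * mT -> mT * mT).
    have h (a b c : R) : measurable_fun setT (fun z : mT * mT => (z.1 + c) * a + z.2 * b).
      apply: measurable_funD; apply: measurable_funM; try exact: measurable_cst.
        by apply: measurable_funD => //; exact: measurable_cst.
      exact: measurable_snd.
    apply: measurable_fun_pair.
      by under eq_fun do rewrite -mulrN; exact: h.
    by under eq_fun do rewrite mulNr -mulrN; exact: h.
  by rewrite /S -[_ @^-1` _]setTI; apply: minv => //; exact: measurable_territory.
have S_strip (t y : R) : S (t, y) -> 0 < t -> t <= m /\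
    (y1 - (1 - a1) * m) + (1 - a1) * t <= y <= (y2 - (a2 - 1) * m) + (a2 - 1) * t.
  move=> Sty t0; have := inv1 (t, y); have := inv2 (t, y) => /= i2 i1.
  split.
    apply: le_trans (rho_hat_le_max cK vK K0 (inv (t, y))).
    apply: le_rho_hat => //; first exact: ltW.
    by move=> u /sP us; have [] := Sty u us; rewrite i1.
  have ws1 : w1 \in s by apply/sP/(extremalP cK vK K0); exists p1.
  have ws2 : w2 \in s by apply/sP/(extremalP cK vK K0); exists p2.
  have [+ _] := Sty _ ws1; have [+ _] := Sty _ ws2.
  rewrite lam1 lam2 i1 i2 => h2 h1; apply/andP; split; lra.
have strip_S (t y : R) : 0 < t < m ->
    (y1 - (1 - a1) * m) + (1 - a1) * t < y < (y2 - (a2 - 1) * m) + (a2 - 1) * t -> S (t, y).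
  move=> /andP[t0 tm] /andP[h1 h2] u us; have := inv1 (t, y); have := inv2 (t, y) => /= i2 i1.
  have [->|ue] := eqVneq u e; first by rewrite lexx ltnn.
  suff lt : lam K e (inv (t, y)) < lam K u (inv (t, y)) by split => //; exact: ltW.
  have extu := (sP u).1 us.
  have lt1 : lam K e (inv (t, y)) < lam K w1 (inv (t, y)) by rewrite lam1 i1 i2; lra.
  have lt2 : lam K e (inv (t, y)) < lam K w2 (inv (t, y)) by rewrite lam2 i1 i2; lra.
  have tm' : 0 < lam K e (inv (t, y)) <= m by rewrite i1 t0 ltW.
  have [d0|d0|d0] := ltgtP (detz e u) 0.
  - by apply: (neighbour_dominates cK vK K0 (mulrNN 1 1) ep2 wp2 D2 n2 extu _ tm' lt2); rewrite mulN1r oppr_gt0.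
  - by apply: (neighbour_dominates cK vK K0 (mulr1 1) ep1 wp1 D1 n1 extu _ tm' lt1); rewrite mul1r.
  have [uE|uE] := primitive_parallel pe (extremal_primitive extu) d0.
    by rewrite uE eqxx in ue.
  have := tp1 _ (extremal_primitive extu).
  rewrite (lamE u p1 (inv (t, y))) d0 mul0r addr0 e1 i1.
  have -> : detz u f = -1 by rewrite -D uE /detz /=; ring.
  by rewrite mulN1r; lra.
have strip_le (t : R) : 0 < t < m ->
    (y1 - (1 - a1) * m) + (1 - a1) * t <= (y2 - (a2 - 1) * m) + (a2 - 1) * t.
  (* The width is affine in t. It is nonnegative at t = m since [w1] is at least m at [p2], and at t
     = 0 thanks to a point of K on the side of e. *)
  move=> /andP[t0 tm].
  have h1 : y1 <= y2 by have := tp2 _ pw1; rewrite lam1 e2 -/y2; lra.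
  have [q Kq qE] := support_attained e cK Kne.
  have q0 : lam K e q = 0 by rewrite /lam qE subrr.
  have := lam_ge0 w1 cK Kq; have := lam_ge0 w2 cK Kq; rewrite lam1 lam2 q0 => h2 h3.
  by have [n0|n0] := leP 0 (2 - a1 - a2); nra.
have psiE x : G (lam K e x) * \1_(territory e) x = strip_fun G S (psi x).
  by rewrite /strip_fun /= !indicE /S; congr (_ * (_ : bool)%:R); rewrite -[in LHS](psiK x).
have mp : measure_invariant psi.
  rewrite (_ : psi = (fun x : mT * mT => (e.1%:~R * x.1 + e.2%:~R * x.2 + - supp K e, f.1%:~R * x.1 + f.2%:~R * x.2 + 0))); last first.
    by apply/funext => x; rewrite addr0.
  exact: measure_invariant_affine.
have si := strip_fun_integrable G0 Gc m0 mS S_strip.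
have msf := measurable_strip Gc mS.
split.
  under eq_fun do rewrite psiE.
  apply/integrableP; split.
    by apply/measurable_EFinP; apply: (measurableT_comp msf); exact: mp.1.
  have /integrableP[_] := si.
  rewrite -(integral_invariant mp) //.
  by apply/measurable_EFinP; apply: measurableT_comp => //; exact: msf.
under eq_integral do rewrite psiE.
rewrite (integral_invariant mp (F := EFin \o strip_fun G S)); last exact/measurable_EFinP.
rewrite (integral_strip G0 Gc m0 mS S_strip strip_S strip_le).
apply: eq_integral => t _; congr (_ * _)%:E.
have -> : (2 - detz w1 f - detz w2 f)%:~R = 2 - a1 - a2 :> R.
  by rewrite 2!rmorphB /= /a1 /a2; congr (_ - _ - _); rewrite -[2]/(2%:Z) -pmulrn.
by move: (t : R) => t'; ring.
Qed.

End one_edge.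

End hat_integral.

Section hat_formula.
Variable R : realType.
Notation mT := (measurableTypeR R).
Notation mu := (@lebesgue_measure R).
Notation mu2 := (lebesgue_plane R).

Lemma integral_rho_hat (K : set (plane R)) : compact K -> convex_set K -> K^° !=set0 ->
  exists (l : R) (k : int), forall G : R -> R,
  (forall t, t <= 0 -> G t = 0) -> continuous G ->
  \int[mu2]_x G (rho (hat K) x) =
  \int[mu]_(t in `[0, rho_max K]) (G t * (2 * l + k%:~R * (rho_max K - t))).
Proof.
move=> cK vK K0; have [s0 s0P] := extremal_seq cK vK K0; pose s := undup s0.
have us : uniq s by exact: undup_uniq.
have sP u : u \in s <-> extremal K u by rewrite mem_undup.
have edge e : exists Ak : R * int, e \in s -> forall G : R -> R,
  (forall t, t <= 0 -> G t = 0) -> continuous G ->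
  mu2.-integrable setT (fun x => (G (lam K e x) * \1_(territory K s e) x)%:E) /\
  (\int[mu2]_x (G (lam K e x) * \1_(territory K s e) x)%:E =
   \int[mu]_(t in `[0%R, rho_max K]) (G t * (Ak.1 + Ak.2%:~R * (rho_max K - t)))%:E)%E.
  have [es|nes] := boolP (e \in s); last by exists (0, 0).
  by have [A [k H]] := integral_territory cK vK K0 sP es; exists (A, k).
have [Ak HAk] := choice edge.
(* Halved because [H_form] contains 2 l. *)
exists ((\sum_(e <- s) (Ak e).1) / 2), (\sum_(e <- s) (Ak e).2) => G G0 Gc.
congr fine; under eq_integral do rewrite (sum_territory cK vK K0 sP _ G0 us) -sumEFin.
have [_ ->] := @integral_sum_seq _ _ R mu2 _ s
  (fun e x => (G (lam K e x) * \1_(territory K s e) x)%:E)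
  (fun e es => (HAk e es G G0 Gc).1).
pose J e (t : mT) := (G t * ((Ak e).1 + (Ak e).2%:~R * (rho_max K - t)))%:E.
have Ji e : mu.-integrable `[0, rho_max K] (J e).
  apply: continuous_compact_integrable; first exact: segment_compact.
  apply: continuous_subspaceT => t; apply: cvgM; first exact: Gc.
  apply: cvgD; first exact: cvg_cst.
  by apply: cvgM; [exact: cvg_cst|apply: cvgB; [exact: cvg_cst|exact: cvg_id]].
transitivity (\sum_(e <- s) \int[mu]_(t in `[0%R, rho_max K]) J e t)%E.
  by apply: eq_big_seq => e es; have [_ ->] := HAk e es G G0 Gc.
have mI : measurable (`[0, rho_max K]%classic : set mT) by exact: measurable_itv.
rewrite -(@integral_sum _ mT R mu _ mI _ J Ji s predT).
apply: eq_integral => t _; rewrite /J sumEFin -mulr_sumr big_split -mulr_suml /=.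
by rewrite rmorph_sum /= [2 * _]mulrC divfK.
Qed.

End hat_formula.

(** * Complex powers *)

Section cpow_real.
Variable R : realType.
Notation mu := (@lebesgue_measure R).
Implicit Types (c w : R[i]) (t : R).

(** The real part of c t^w. The constant c makes the family stable under differentiation, and c = 1,
    -i recover both parts of t^w. *)
Definition rpart c w t : R := complex.Re (c * cpow t w).

Lemma rpart_le0 c w t : t <= 0 -> rpart c w t = 0.
Proof. by move=> t0; rewrite /rpart /cpow ltNge t0 /= mulr0. Qed.

Lemma rpartE c w t : 0 < t -> rpart c w t = t `^ (complex.Re w) *
  (complex.Re c * cos (complex.Im w * ln t) - complex.Im c * sin (complex.Im w * ln t)).
Proof.
move=> t0; rewrite /rpart /cpow t0; case: c => c1 c2; case: w => a b /=.
by rewrite !mul0r !subr0 !addr0; ring.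
Qed.

Lemma rpart_succ c w t : rpart c (w + 1) t = t * rpart c w t.
Proof.
have [t0|t0] := leP t 0; first by rewrite !rpart_le0// mulr0.
have tS (a : R) : t `^ (a + 1) = t * t `^ a.
  by rewrite powRD; [by rewrite (powRr1 (ltW t0)) mulrC|by rewrite (gt_eqF t0) implybT].
rewrite !rpartE//; case: w => a b; rewrite [complex.Re (_ + _)]/= [complex.Im (_ + _)]/=.
by rewrite addr0 tS mulrA.
Qed.

Lemma is_derive_rpart c w t : 0 < t ->
  is_derive t 1 (rpart c w) (rpart (c * w) (w - 1) t).
Proof.
move=> t0.
have ne : \forall y \near t, y `^ (complex.Re w) *
  (complex.Re c * cos (complex.Im w * ln y) - complex.Im c * sin (complex.Im w * ln y)) = rpart c w y.
  by near=> y; rewrite rpartE//; near: y; exact: lt_nbhsr.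
apply: (near_eq_is_derive ne).
  have dl := is_derive1_ln t0.
  have dp := is_derive1_powR (complex.Re w) t0.
  have dbl : is_derive t 1 (fun t => complex.Im w * ln t) (complex.Im w * t^-1).
    exact: is_deriveZ.
  have dc : is_derive t 1 (fun t => cos (complex.Im w * ln t)) (- sin (complex.Im w * ln t) * (complex.Im w * t^-1)).
    exact: (is_derive1_comp (is_derive_cos _) dbl).
  have ds : is_derive t 1 (fun t => sin (complex.Im w * ln t)) (cos (complex.Im w * ln t) * (complex.Im w * t^-1)).
    exact: (is_derive1_comp (is_derive_sin _) dbl).
  have dd := is_deriveB (is_deriveZ (complex.Re c) dc) (is_deriveZ (complex.Im c) ds).
  have dM := is_deriveM dp dd.
  rewrite (_ : rpart (c * w) (w - 1) t = t `^ complex.Re w *: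
     (complex.Re c *: (- sin (complex.Im w * ln t) * (complex.Im w / t)) -
      complex.Im c *: (cos (complex.Im w * ln t) * (complex.Im w / t))) +
     (complex.Re c * cos (complex.Im w * ln t) - complex.Im c * sin (complex.Im w * ln t)) *:
     (complex.Re w * t `^ (complex.Re w - 1))); first exact: dM.
  rewrite rpartE//; case: c {dM dd dc ds dbl dp ne} => c1 c2; case: w => a b.
  rewrite [complex.Re (_ - _)]/= [complex.Im (_ - _)]/= subr0.
  have -> : t `^ a = t * t `^ (a - 1).
    by rewrite -{2}[t](powRr1 (ltW t0)) -powRD ?(gt_eqF t0) ?implybT// addrC subrK.
  rewrite /GRing.scale /=.
  by field; rewrite gt_eqF.
Unshelve. all: end_near. Qed.
Lemma rpart_bound c w t : 0 < t ->
  `|rpart c w t| <= (`|complex.Re c| + `|complex.Im c|) * t `^ (complex.Re w).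
Proof.
move=> t0; rewrite rpartE// normrM mulrC (ger0_norm (powR_ge0 t _)) ler_wpM2r ?powR_ge0//.
apply: le_trans (ler_normB _ _) _; rewrite !normrM lerD// ler_piMr// ?cos_max ?sin_max//.
Qed.

(** Only t = 0 needs Re w > 0, through the bound by a multiple of t^(Re w). With w = s - 2 this is
    the condition Re s > 2. *)
Lemma continuous_rpart c w : 0 < complex.Re w -> continuous (rpart c w).
Proof.
move=> w0 t; have [t0|t0|t0] := ltgtP 0 t.
- have [d _] := is_derive_rpart c w t0.
  by apply: differentiable_continuous; apply/derivable1_diffP.
- have ne : \forall y \near t, 0 = rpart c w y.
    by near=> y; rewrite rpart_le0//; apply: ltW; near: y; exact: lt_nbhsl.
  rewrite /continuous_at (rpart_le0 _ _ (ltW t0)).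
  exact: (cvg_trans (near_eq_cvg (f := fun=> 0) ne) (cvg_cst _)).
rewrite -t0 /continuous_at rpart_le0//.
pose C := `|complex.Re c| + `|complex.Im c| + 1.
have C0 : 0 < C by rewrite ltr_wpDl// addr_ge0.
apply/cvgrPdist_lt => eps eps0.
have d0 : 0 < (eps / C) `^ (complex.Re w)^-1 by rewrite powR_gt0// divr_gt0.
near=> y; rewrite sub0r normrN.
have [y0|y0] := leP y 0; first by rewrite rpart_le0// normr0.
apply: le_lt_trans (rpart_bound c w y0) _.
have yd : y < (eps / C) `^ (complex.Re w)^-1 by near: y; exact: lt_nbhsl.
have yp : 0 < y `^ complex.Re w by exact: powR_gt0.
apply: (@lt_trans _ _ (C * y `^ complex.Re w)).
  by rewrite ltr_pM2r// ltrDl.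
rewrite mulrC -ltr_pdivlMr//.
have -> : eps / C = ((eps / C) `^ (complex.Re w)^-1) `^ (complex.Re w).
  by rewrite -powRrM mulVf ?gt_eqF// powRr1// ltW// divr_gt0.
by rewrite gt0_ltr_powR// ?nnegrE ltW.
Unshelve. all: end_near. Qed.

Lemma integral_from0 (F g : R -> R) f : 0 <= f -> continuous F -> continuous g ->
  (forall t, 0 < t -> is_derive t 1 F (g t)) ->
  \int[mu]_(t in `[0, f]) g t = F f - F 0.
Proof.
rewrite le_eqVlt => /predU1P[<-|f0] cF cg dF.
  by rewrite subrr set_itv1 Rintegral_set1.
rewrite /Rintegral (continuous_FTC2 f0 (F := F))//.
- exact: continuous_subspaceT.
- split; [|exact: cvg_at_right_filter (cF 0)|exact: cvg_at_left_filter (cF f)].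
  by move=> t; rewrite in_itv/= => /andP[t0 _]; have [] := dF t t0.
- by move=> t; rewrite in_itv/= => /andP[t0 _]; rewrite derive1E; have [_ ->] := dF t t0.
Qed.

Lemma integral_rpart c w f : 0 < complex.Re w -> 0 <= f ->
  \int[mu]_(t in `[0, f]) rpart c w t = rpart (c / (w + 1)) (w + 1) f.
Proof.
move=> w0 f0; have w1 : w + 1 != 0.
  apply/eqP => /(congr1 (@complex.Re R)); case: (w) w0 => a b /= a0 /eqP.
  by rewrite gt_eqF// ltr_wpDr.
have w10 : 0 < complex.Re (w + 1) by case: (w) w0 => a b /= a0; rewrite ltr_wpDr.
have dF t : 0 < t -> is_derive t 1 (rpart (c / (w + 1)) (w + 1)) (rpart c w t).
  by move=> t0; have := is_derive_rpart (c / (w + 1)) (w + 1) t0; rewrite divfK// addrK.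
rewrite (integral_from0 f0 (@continuous_rpart _ _ w10) (@continuous_rpart c _ w0) dF).
by rewrite (rpart_le0 _ _ (lexx 0)) subr0.
Qed.

Lemma weight_rpart c w f : 0 < complex.Re w -> 0 <= f ->
  weight (rpart c w) f = rpart (c / ((w + 1) * (w + 2))) (w + 2) f.
Proof.
move=> w0 f0; have w1 : w + 1 != 0.
  apply/eqP => /(congr1 (@complex.Re R)); case: (w) w0 => a b /= a0 /eqP.
  by rewrite gt_eqF// ltr_wpDr.
have w2 : w + 2 != 0.
  apply/eqP => /(congr1 (@complex.Re R)); case: (w) w0 => a b /= a0 /eqP.
  by rewrite gt_eqF// ltr_wpDr// addr_ge0.
have w10 : 0 < complex.Re (w + 1) by case: (w) w0 => a b /= a0; rewrite ltr_wpDr.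
have w20 : 0 < complex.Re (w + 2) by case: (w) w0 => a b /= a0; rewrite ltr_wpDr// addr_ge0.
have c1 := @continuous_rpart (c / (w + 1)) _ w10.
have c2 := @continuous_rpart (c / (w + 2)) _ w20.
have c0 := @continuous_rpart c _ w0.
(* The antiderivative f t^(w+1) / (w+1) - t^(w+2) / (w+2) of (f - t) t^w. *)
pose F t := f * rpart (c / (w + 1)) (w + 1) t - rpart (c / (w + 2)) (w + 2) t.
have cF : continuous F.
  move=> t; apply: cvgB; last exact: c2.
  by apply: cvgM; [exact: cvg_cst|exact: c1].
have cg : continuous (fun t => (f - t) * rpart c w t).
  move=> t; apply: cvgM; last exact: c0.
  by apply: cvgB; [exact: cvg_cst|exact: cvg_id].
have dF t : 0 < t -> is_derive t 1 F ((f - t) * rpart c w t).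
  move=> t0; have d1 := is_derive_rpart (c / (w + 1)) (w + 1) t0.
  have d2 := is_derive_rpart (c / (w + 2)) (w + 2) t0.
  rewrite divfK// addrK in d1.
  have e2 : w + 2 - 1 = w + 1 by rewrite -[2]/(1 + 1) addrA addrK.
  rewrite divfK// e2 rpart_succ in d2.
  rewrite mulrBl; exact: (is_deriveB (is_deriveZ f d1) d2).
rewrite /weight (integral_from0 f0 cF cg dF) /F.
rewrite !(rpart_le0 _ _ (lexx 0)) mulr0 subrr subr0.
have e2 : w + 2 = w + 1 + 1 by rewrite -addrA.
rewrite e2 -rpart_succ -e2 /rpart -raddfB /= -mulrBl; congr (complex.Re (_ * _)).
by field; rewrite w1 w2.
Qed.

End cpow_real.

(** * Sums over a set exhausted by finite lists *)

Section exhaustion.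
Variables (R : realType) (I : choiceType) (D : set I) (t : nat -> seq I).
Hypothesis ut : forall k, uniq (t k).
Hypothesis tD : forall k q, q \in t k -> D q.
Hypothesis tcover : forall q, D q -> exists k, q \in t k.
Hypothesis tle : forall k k', (k <= k')%N -> {subset t k <= t k'}.

Let tfin k : fsets D [set` t k].
Proof. by split; [exact: finite_seq|move=> q; exact: tD]. Qed.

Let sumE (h : I -> R) k : (\sum_(q \in [set` t k]) (h q)%:E = (\sum_(q <- t k) h q)%:E)%E.
Proof. by rewrite -fsbig_seq// sumEFin. Qed.

Let finite_cover A : fsets D A -> exists k, A `<=` [set` t k].
Proof.
move=> [/finite_seqP[r ->]]; elim: r => [|q r IH] rD; first by exists 0%N.
have [k kP] : exists k, [set` r] `<=` [set` t k].
  by apply: IH => q' q'r; apply: rD; rewrite /= inE q'r orbT.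
have [k' k'P] := tcover (rD q (mem_head _ _)).
exists (maxn k k') => q' /=; rewrite inE => /predU1P[->|/kP].
  exact: tle (leq_maxr _ _) _ k'P.
exact: tle (leq_maxl _ _) _.
Qed.

(** Every finite subset of [D] is contained in some list, so the supremum over finite subsets is the
    limit of the increasing list sums. *)
Lemma esum_exhaustion (h : I -> R) B : (forall q, 0 <= h q) ->
  (forall k, \sum_(q <- t k) h q <= B) ->
  (\esum_(q in D) (h q)%:E <= B%:E)%E /\
  \sum_(q <- t k) h q @[k --> \oo] --> fine (\esum_(q in D) (h q)%:E)%E.
Proof.
move=> h0 hB.
have below A : fsets D A -> exists k, (\sum_(q \in A) (h q)%:E <= (\sum_(q <- t k) h q)%:E)%E.
  move=> fA; have [k Ak] := finite_cover fA; exists k; rewrite -sumE.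
  apply: lee_fsum_nneg_subset; [exact: fA.1|exact: (tfin k).1| |].
    by move=> q; rewrite !inE; exact: Ak.
  by move=> q _; rewrite lee_fin.
have leB : (\esum_(q in D) (h q)%:E <= B%:E)%E.
  apply: ge_ereal_sup => _ [A fA <-]; have [k kP] := below A fA.
  by apply: (le_trans kP); rewrite lee_fin.
split => //.
have ge0 : (0 <= \esum_(q in D) (h q)%:E)%E by apply: esum_ge0 => q _; rewrite lee_fin.
have fin : (\esum_(q in D) (h q)%:E)%E \is a fin_num.
  by rewrite ge0_fin_numE// (le_lt_trans leB)// ltry.
have part k : \sum_(q <- t k) h q <= fine (\esum_(q in D) (h q)%:E)%E.
  rewrite -lee_fin fineK// -sumE; apply: ereal_sup_ubound.
  by exists [set` t k] => //; exact: tfin.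
apply/cvgrPdist_lt => e e0.
have [_ [A fA <-] lt] := ub_ereal_sup_adherent e0 fin.
have [k kP] := below A fA.
exists k => // k' /= kk'; rewrite ger0_norm ?subr_ge0//.
have h1 := lt_le_trans lt kP.
have h2 : \sum_(q <- t k) h q <= \sum_(q <- t k') h q.
  rewrite -lee_fin -!sumE; apply: lee_fsum_nneg_subset; [exact: (tfin k).1|exact: (tfin k').1| |].
    by move=> q; rewrite !inE; exact: tle.
  by move=> q _; rewrite lee_fin.
move: h1; rewrite -[ereal_sup _]/(\esum_(q in D) (h q)%:E)%E -(fineK fin) -EFinB lte_fin.
by lra.
Qed.

Lemma rsum_exhaustion (f g : I -> R) B : (forall q, `|f q| <= g q) ->
  (forall k, \sum_(q <- t k) g q <= B) ->
  summable D (fun q => (f q)%:E) /\ \sum_(q <- t k) f q @[k --> \oo] --> rsum D f.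
Proof.
move=> fg gB.
have dom (h : I -> R) : (forall q, h q <= g q) -> forall k, \sum_(q <- t k) h q <= B.
  by move=> hg k; apply: le_trans (gB k); apply: ler_sum => q _.
split.
  have [+ _] := @esum_exhaustion (fun q => `|f q|) B (fun q => normr_ge0 _) (dom _ fg).
  by move=> /le_lt_trans; apply; exact: ltry.
pose fp q := Num.max (f q) 0; pose fn q := Num.max (- f q) 0.
have [_ cp] := @esum_exhaustion fp B (fun q => ltac:(by rewrite /fp le_max lexx orbT))
  (dom fp (fun q => ltac:(by rewrite /fp ge_max (le_trans (ler_norm _) (fg q)) (le_trans (normr_ge0 _) (fg q))))).
have [_ cn] := @esum_exhaustion fn B (fun q => ltac:(by rewrite /fn le_max lexx orbT))
  (dom fn (fun q => ltac:(by rewrite /fn ge_max (le_trans _ (fg q)) ?(le_trans (normr_ge0 _) (fg q))// -normrN ler_norm))).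
have -> : rsum D f = fine (\esum_(q in D) (fp q)%:E)%E - fine (\esum_(q in D) (fn q)%:E)%E.
  rewrite /rsum; congr (fine _ - fine _); apply: eq_esum => q _.
    by rewrite funeposE /= /fp EFin_max.
  by rewrite funenegE /= /fn EFin_max.
rewrite (_ : (fun k => _) = (fun k => \sum_(q <- t k) fp q) \- (fun k => \sum_(q <- t k) fn q)).
  exact: cvgB cp cn.
apply/funext => k /=; rewrite -sumrB; apply: eq_bigr => q _; rewrite /fp /fn.
by have [?|?] := leP (f q) 0; [rewrite max_l; lra|rewrite max_r; lra].
Qed.

End exhaustion.

(** * Zeta functions and series *)

Lemma eq_from_re (R : realType) (z z' : R[i]) :
  (forall c : R[i], complex.Re (c * z) = complex.Re (c * z')) -> z = z'.
Proof.
move=> H; case: z z' H => a b [a' b'] H.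
have := H 1; rewrite !mul1r /= => ->.
by have := H (0 +i* (-1)); rewrite /= !mul0r !sub0r !mulN1r !opprK => ->.
Qed.

Lemma re_mul (R : realType) (c z : R[i]) :
  complex.Re (c * z) = complex.Re c * complex.Re z - complex.Im c * complex.Im z.
Proof. by case: c z => a b [x y]. Qed.

Section zeta_integral.
Variable R : realType.
Notation mT := (measurableTypeR R).
Notation mu := (@lebesgue_measure R).
Notation mu2 := (lebesgue_plane R).
Variable K : set (plane R).
Hypothesis cK : compact K.
Hypothesis vK : convex_set K.
Hypothesis K0 : K^° !=set0.
Variable w : R[i].
Hypothesis w0 : 0 < complex.Re w.
Implicit Types c : R[i].

(** Bounded and continuous on the whole line, as the level theorem requires. With the maximum of the
    distance as [m], the truncation is invisible on all values taken. *)
Definition truncated (m : R) c (t : R) : R := rpart c w (Num.min t m).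

Lemma truncated_le0 m c t : t <= 0 -> truncated m c t = 0.
Proof. by move=> t0; rewrite /truncated rpart_le0// ge_min t0. Qed.

Lemma continuous_truncated m c : continuous (truncated m c).
Proof.
move=> t; apply: (@continuous_comp _ _ _ (fun t => Num.min t m) (rpart c w)).
  by apply: continuous_min; [exact: cvg_id|exact: cvg_cst].
exact: continuous_rpart.
Qed.

Lemma truncated_bound m c : exists C, forall t, `|truncated m c t| <= C.
Proof.
have [C [C0 HC]] := continuous_bounded_itv (@continuous_rpart _ c _ w0) 0 m.
exists C => t; have [t0|t0] := leP t 0; first by rewrite truncated_le0// normr0.
have [m0|m0] := leP m 0; first by rewrite /truncated rpart_le0 ?normr0// ge_min m0 orbT.
by apply: HC; rewrite ge_min lexx orbT le_min !ltW.
Qed.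

Lemma truncatedE m c t : t <= m -> truncated m c t = rpart c w t.
Proof. by move=> tm; rewrite /truncated min_l. Qed.

Lemma integrable_rpart_rho c : mu2.-integrable setT (fun x => (rpart c w (rho K x))%:E).
Proof.
have [C HC] := truncated_bound (rho_max K) c.
have := integrable_rho_comp (@truncated_le0 (rho_max K) c) (@continuous_truncated (rho_max K) c) HC cK vK K0.
by apply: eq_integrable => // x _; rewrite /= truncatedE// rho_le_max.
Qed.

Lemma rpart_rho_out c x : ~ K x -> rpart c w (rho K x) = 0.
Proof. by move=> nK; rewrite rho_out ?rpart_le0// => /interior_subset. Qed.

Lemma integral_rpart_body c :
  \int[mu2]_(x in K) rpart c w (rho K x) = \int[mu2]_x rpart c w (rho K x).
Proof.
rewrite Rintegral_mkcond; apply: eq_Rintegral => x _.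
rewrite patchE; case: ifPn => //; rewrite notin_setE => nK.
by rewrite rpart_rho_out.
Qed.

Let reE x : complex.Re (cpow (rho K x) w) = rpart 1 w (rho K x).
Proof. by rewrite /rpart mul1r. Qed.

Let imE x : complex.Im (cpow (rho K x) w) = rpart (0 +i* (-1)) w (rho K x).
Proof. by rewrite /rpart re_mul /= mul0r sub0r mulN1r opprK. Qed.

Lemma Z_convergent_body s : s - 2 = w -> Z_convergent K s.
Proof.
move=> sw; have mK := measurable_body cK vK K0.
split; rewrite sw.
  rewrite (_ : (fun x => _) = (fun x => (rpart 1 w (rho K x))%:E)).
    exact: integrableS (integrable_rpart_rho 1).
  by apply/funext => x; rewrite reE.
rewrite (_ : (fun x => _) = (fun x => (rpart (0 +i* (-1)) w (rho K x))%:E)).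
  exact: integrableS (integrable_rpart_rho (0 +i* (-1))).
by apply/funext => x; rewrite imE.
Qed.

Lemma re_Z c s : s - 2 = w ->
  complex.Re (c * Z K s) = \int[mu2]_x rpart c w (rho K x).
Proof.
move=> sw; rewrite re_mul /Z /cintegral /= sw.
under eq_Rintegral do rewrite reE.
under [X in _ - _ * X]eq_Rintegral do rewrite imE.
rewrite !integral_rpart_body.
have i1 := integrable_rpart_rho 1; have i2 := integrable_rpart_rho (0 +i* (-1)).
rewrite -(RintegralZl _ measurableT i1) -(RintegralZl _ measurableT i2) -RintegralB//.
- by apply: eq_Rintegral => x _; rewrite -reE -imE /rpart re_mul.
- exact: (integrableZl measurableT (complex.Re c) i1).
- exact: (integrableZl measurableT (complex.Im c) i2).
Qed.

End zeta_integral.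

Section series.
Variable R : realType.
Notation mu2 := (lebesgue_plane R).
Variable K : set (plane R).
Hypothesis cK : compact K.
Hypothesis vK : convex_set K.
Hypothesis K0 : K^° !=set0.
Variables (n : nat) (T : 'I_n -> gamma_triangle R).
Hypothesis HT : gamma_decomposition K T.
Local Notation m := (rho_max K).
Local Notation E1 i := (normal1 (T i)).
Local Notation E2 i := (normal2 (T i)).

Let Kne : K !=set0.
Proof. by have [x /interior_subset Kx] := K0; exists x. Qed.

Let m0 : 0 < m := rho_max_gt0 cK vK K0.

Definition quad_gap i q : R := gap K (qfst (E1 i) (E2 i) q) (qsnd (E1 i) (E2 i) q).

Lemma quad_gap_ge0 i q : 0 <= quad_gap i q.
Proof. exact: gap_ge0. Qed.

(** Gaps decrease down the tree from a root gap at most m, so the truncation does not affect the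
    weights either. The point 0 at which [lam] is evaluated is arbitrary. *)
Lemma quad_gap_le i k q : q \in tree k root_quad -> quad_gap i q <= m.
Proof.
have qE q' : quad_gap i q' = qgap (fun u => lam K u 0) (E1 i) (E2 i) q'.
  by rewrite /quad_gap (gap_lam K _ _ 0).
have : quad_gap i root_quad <= m.
  have [v vc _] := decomposition_corner cK vK K0 HT i.
  by rewrite /quad_gap qfst_root qsnd_root; exact: corner_gap_le vc.
have LD u u' : lam K (u + u') 0 <= lam K u 0 + lam K u' 0 by exact: lamD.
have LM u j : lam K (u *+ j) 0 = lam K u 0 *+ j by exact: lamMn.
elim: k root_quad => // k IH r rm; rewrite /= inE => /predU1P[->//|].
rewrite mem_cat => /orP[]; apply: IH; apply: le_trans rm; rewrite !qE.
  exact: (qgap_left LD LM).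
exact: (qgap_right LD LM).
Qed.

Lemma F_termE i s q : F_term (T i) s q = cpow (quad_gap i q) s.
Proof.
case: q => [[[a b] c] d]; rewrite /F_term (decomposition_f_Gamma cK vK K0 HT).
by [].
Qed.

Definition level_rpart c s k := \sum_(i < n) \sum_(q <- tree k root_quad) rpart c s (quad_gap i q).

(** The factor s (s - 1), put into the constant [c'], cancels the denominator (w + 1) (w + 2) of
    [weight_rpart] for w = s - 2. *)
Lemma level_rpart_cvg c s : 2 < complex.Re s ->
  level_rpart c s k @[k --> \oo] -->
  complex.Re (c * (s * (s - 1) * (Z (hat K) s - Z K s))).
Proof.
move=> s2; pose w := s - 2.
have w0 : 0 < complex.Re w by rewrite /w; case: (s) s2 => a b /= h; lra.
have s0 : s != 0.
  by apply/eqP => /(congr1 (@complex.Re R)) /=; move: s2; case: (s) => a b /= h1 h2; lra.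
have s1 : s - 1 != 0.
  by apply/eqP => /(congr1 (@complex.Re R)) /=; move: s2; case: (s) => a b /= h1 h2; lra.
have w1E : w + 1 = s - 1 by rewrite /w; ring.
have w2E : w + 2 = s by rewrite /w; ring.
pose c' := c * (s * (s - 1)).
have [C HC] := truncated_bound w0 m c'.
have := level_weight_cvg (@truncated_le0 _ w m c') (@continuous_truncated _ _ w0 m c') HC cK vK K0 HT.
have chat := compact_hat cK vK K0; have hat0 := interior_hat cK K0.
have -> : \int[mu2]_x truncated w m c' (rho (hat K) x) = complex.Re (c' * Z (hat K) s).
  rewrite (re_Z chat (@convex_hat _ K) hat0 w0)//.
  by apply: eq_Rintegral => x _; rewrite truncatedE// rho_hat_le_max.
have -> : \int[mu2]_x truncated w m c' (rho K x) = complex.Re (c' * Z K s).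
  rewrite (re_Z cK vK K0 w0)//.
  by apply: eq_Rintegral => x _; rewrite truncatedE// rho_le_max.
rewrite -raddfB -mulrBr /= /c' -[c * _ * _]mulrA.
have -> // : level_weight (truncated w m c') K T = level_rpart c s.
apply/funext => k; apply: eq_bigr => i _; apply: eq_big_seq => q qt.
have f0 := quad_gap_ge0 i q; have fm := quad_gap_le i qt.
transitivity (weight (rpart c' w) (quad_gap i q)).
  apply: eq_Rintegral => t; rewrite inE/= in_itv/= => /andP[_ tf].
  by rewrite truncatedE// (le_trans tf).
rewrite weight_rpart// w1E w2E /c'; congr rpart.
by field; rewrite s0 s1.
Qed.

Lemma rpart_dominated (c s : R[i]) t : `|complex.Re c| + `|complex.Im c| <= 1 ->
  `|rpart c s t| <= rpart 1 (complex.Re s)%:C t.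
Proof.
move=> c1; have [t0|t0] := leP t 0; first by rewrite !rpart_le0// normr0.
apply: le_trans (rpart_bound c s t0) _.
rewrite (rpartE 1)//= mul0r cos0 mul0r subr0 mulr1 mulr1.
by rewrite ler_piMl// powR_ge0.
Qed.

(** For the real exponent Re s all terms are nonnegative, and the level sums are bounded because
    they converge. *)
Lemma level_rpart_bounded s : 2 < complex.Re s -> exists B, forall i k,
  \sum_(q <- tree k root_quad) rpart 1 (complex.Re s)%:C (quad_gap i q) <= B.
Proof.
move=> s2; have cv := @level_rpart_cvg 1 (complex.Re s)%:C s2.
have /cvg_seq_bounded[M [_ HM]] : cvgn (level_rpart 1 (complex.Re s)%:C).
  by apply/cvg_ex; eexists; exact: cv.
have pos t : 0 <= rpart 1 (complex.Re s)%:C t.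
  by apply: le_trans (@rpart_dominated 0 s t _); rewrite ?normr_ge0//= normr0 addr0.
exists (M + 1) => i k; have := HM (M + 1) (ltr_pwDr ltr01 (lexx M)) k I.
apply: le_trans; apply: le_trans (ler_norm _).
rewrite /level_rpart (bigD1 i)//= lerDl.
by apply: sumr_ge0 => j _; apply: sumr_ge0 => q _.
Qed.

Lemma series_cvg i c s : 2 < complex.Re s -> `|complex.Re c| + `|complex.Im c| <= 1 ->
  summable unimodular_quadruples (fun q => (rpart c s (quad_gap i q))%:E) /\
  \sum_(q <- tree k root_quad) rpart c s (quad_gap i q) @[k --> \oo] -->
    rsum unimodular_quadruples (fun q => rpart c s (quad_gap i q)).
Proof.
move=> s2 c1; have [B HB] := level_rpart_bounded s2.
apply: (@rsum_exhaustion _ _ unimodular_quadruples (fun k => tree k root_quad) _ _ _ _ _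
  (fun q => rpart 1 (complex.Re s)%:C (quad_gap i q)) B).
- by move=> k; exact: uniq_tree.
- by move=> k q; exact: tree_unimodular.
- exact: tree_exhausts.
- by move=> k k'; exact: tree_le.
- by move=> q; exact: rpart_dominated.
- by move=> k; exact: HB.
Qed.

Let one_le1 : `|complex.Re (1 : R[i])| + `|complex.Im (1 : R[i])| <= 1.
Proof. by rewrite /= normr1 normr0 addr0. Qed.

Let conji_le1 : `|complex.Re (0 +i* (-1) : R[i])| + `|complex.Im (0 +i* (-1) : R[i])| <= 1.
Proof. by rewrite /= normrN1 normr0 add0r. Qed.

Let reE i s q : complex.Re (F_term (T i) s q) = rpart 1 s (quad_gap i q).
Proof. by rewrite F_termE /rpart mul1r. Qed.

Let imE i s q : complex.Im (F_term (T i) s q) = rpart (0 +i* (-1)) s (quad_gap i q).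
Proof. by rewrite F_termE /rpart re_mul /= mul0r sub0r mulN1r opprK. Qed.

Lemma F_convergent_decomposition i s : 2 < complex.Re s -> F_convergent (T i) s.
Proof.
move=> s2; split.
  rewrite (_ : (fun q => _) = (fun q => (rpart 1 s (quad_gap i q))%:E)).
    exact: (series_cvg i s2 one_le1).1.
  by apply/funext => q; rewrite reE.
rewrite (_ : (fun q => _) = (fun q => (rpart (0 +i* (-1)) s (quad_gap i q))%:E)).
  exact: (series_cvg i s2 conji_le1).1.
by apply/funext => q; rewrite imE.
Qed.

Lemma F_boundaryE s : 2 < complex.Re s ->
  F_boundary T s = s * (s - 1) * (Z (hat K) s - Z K s).
Proof.
move=> s2.
have sum_cvg c : `|complex.Re c| + `|complex.Im c| <= 1 ->
    \sum_(i < n) rsum unimodular_quadruples (fun q => rpart c s (quad_gap i q)) =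
    complex.Re (c * (s * (s - 1) * (Z (hat K) s - Z K s))).
  move=> c1; have h : level_rpart c s k @[k --> \oo] -->
      \sum_(i < n) rsum unimodular_quadruples (fun q => rpart c s (quad_gap i q)).
    apply: (@cvg_big R^o); first exact: add_continuous.
    by move=> i _; exact: (series_cvg i s2 c1).2.
  by rewrite -(cvg_lim (@Rhausdorff R) h) (cvg_lim (@Rhausdorff R) (@level_rpart_cvg c s s2)).
have imC (z : R[i]) : complex.Im z = complex.Re ((0 +i* (-1)) * z).
  by rewrite re_mul /= mul0r sub0r mulN1r opprK.
apply/eqP; rewrite eq_complex; apply/andP; split; apply/eqP.
  rewrite -[s * (s - 1) * _]mul1r -sum_cvg // /F_boundary raddf_sum /=.
  by apply: eq_bigr => i _; congr rsum; apply/funext => q; rewrite reE.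
rewrite [RHS]imC -sum_cvg // /F_boundary raddf_sum /=.
by apply: eq_bigr => i _; congr rsum; apply/funext => q; rewrite -imE.
Qed.

End series.

Section hat_form.
Variable R : realType.
Notation mu := (@lebesgue_measure R).
Notation mu2 := (lebesgue_plane R).

(** The integral of t^(s-2) (2 l + k (m - t)) over [0, m] is 2 l m^(s-1) / (s-1) + k m^s / (s
    (s-1)). *)
Lemma H_hat (K : set (plane R)) : compact K -> convex_set K -> K^° !=set0 ->
  exists (l : R) (k : int), forall s : R[i], 2 < complex.Re s ->
  H (hat K) s = H_form (rho_max K) l k s.
Proof.
move=> cK vK K0; have [l [k lkP]] := integral_rho_hat cK vK K0.
have m0 := rho_max_gt0 cK vK K0; set m := rho_max K in lkP m0 *.
exists l, k => s s2; pose w := s - 2.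
have w0 : 0 < complex.Re w by rewrite /w; case: (s) s2 => a b /= h; lra.
have s0 : s != 0.
  by apply/eqP => /(congr1 (@complex.Re R)) /=; move: s2; case: (s) => a b /= h1 h2; lra.
have s1 : s - 1 != 0.
  by apply/eqP => /(congr1 (@complex.Re R)) /=; move: s2; case: (s) => a b /= h1 h2; lra.
have w1E : w + 1 = s - 1 by rewrite /w; ring.
have w2E : w + 2 = s by rewrite /w; ring.
apply: eq_from_re => c; rewrite /H mulrA.
pose c' := c * (s * (s - 1)).
rewrite (re_Z (compact_hat cK vK K0) (@convex_hat _ K) (interior_hat cK K0) w0)// -/c'.
transitivity (\int[mu2]_x truncated w m c' (rho (hat K) x)).
  by apply: eq_Rintegral => x _; rewrite truncatedE// rho_hat_le_max.
rewrite lkP; [|by move=> t; exact: truncated_le0|exact: continuous_truncated].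
transitivity (\int[mu]_(t in `[0, m]) (2 * l * rpart c' w t + k%:~R * ((m - t) * rpart c' w t))).
  apply: eq_Rintegral => t; rewrite inE/= in_itv/= => /andP[_ tm].
  by rewrite truncatedE//; ring.
have mI : measurable (`[0, m]%classic : set (measurableTypeR R)) by exact: measurable_itv.
have cr := @continuous_rpart _ c' _ w0.
have i1 : mu.-integrable `[0, m] (EFin \o (rpart c' w)).
  apply: continuous_compact_integrable; first exact: segment_compact.
  exact: continuous_subspaceT.
have i2 : mu.-integrable `[0, m] (EFin \o (fun t => (m - t) * rpart c' w t)).
  apply: continuous_compact_integrable; first exact: segment_compact.
  apply: continuous_subspaceT => t; apply: cvgM; last exact: cr.
  by apply: cvgB; [exact: cvg_cst|exact: cvg_id].
rewrite RintegralD//; [|exact: (integrableZl mI (2 * l) i1)|exact: (integrableZl mI k%:~R i2)].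
rewrite (RintegralZl _ mI i1) (RintegralZl _ mI i2) integral_rpart ?ltW//.
rewrite -[\int[mu]_(t in _) _]/(weight (rpart c' w) m) weight_rpart ?ltW// w1E w2E.
have -> : c' / (s - 1) = c * s by rewrite /c'; field.
have -> : c' / ((s - 1) * s) = c by rewrite /c'; field; rewrite s0 s1.
have -> : rpart c s m = m * rpart c (s - 1) m by rewrite -rpart_succ subrK.
rewrite /rpart /H_form; set X := cpow m (s - 1).
have -> : c * (X * (2 * l%:C * s + k%:~R * m%:C)) =
    (2 * l)%:C * (c * s * X) + (k%:~R * m)%:C * (c * X).
  by rewrite !rmorphM /= rmorph_int; ring.
rewrite raddfD /= [in RHS]re_mul [X in _ = _ + X]re_mul /=; ring.
Qed.

End hat_form.

(** * Holomorphy *)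

Section holomorphy.
Variable R : realType.

Lemma re_le_normc (z : R[i]) (e : R) : `|z| <= e%:C ->
  `|complex.Re z| <= e /\ `|complex.Im z| <= e.
Proof.
case: z => a b; rewrite normc_def lecR /= => h.
have h' (x y : R) : `|x| <= Num.sqrt (x ^+ 2 + y ^+ 2).
  by rewrite -sqrtr_sqr ler_wsqrtr// lerDl sqr_ge0.
by split; apply: le_trans h; [exact: h'|rewrite addrC; exact: h'].
Qed.

Lemma normc_le_add (z : R[i]) : `|z| <= (`|complex.Re z| + `|complex.Im z|)%:C.
Proof.
case: z => a b; rewrite normc_def lecR /=.
have ab0 : 0 <= `|a| + `|b| by rewrite addr_ge0.
rewrite -[leRHS](ger0_norm ab0) -sqrtr_sqr ler_wsqrtr// sqrrD !real_normK ?num_real//.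
by rewrite addrAC lerDl mulrn_wge0// mulr_ge0.
Qed.

Lemma derive_remainder (g : R -> R) (a eps : R) : is_derive (0 : R) 1 g a -> 0 < eps ->
  exists2 d : R, 0 < d & forall u, `|u| <= d -> `|g u - g 0 - a * u| <= eps * `|u|.
Proof.
move=> [dg ga] eps0; have := dg; rewrite /derivable => /cvg_ex[L HL].
have LE : L = a by rewrite -ga /derive; apply/esym/(cvg_lim (@Rhausdorff R)).
rewrite LE in HL; move/cvgrPdist_le : HL => /(_ _ eps0).
case/nbhs_ballP => d /= d0 Hd; exists (d / 2); first by rewrite divr_gt0.
move=> u ud; have [->|u0] := eqVneq u 0.
  by rewrite mulr0 subr0 subrr !normr0 mulr0.
have := Hd u; rewrite /ball /= sub0r normrN => /(_ _ u0).
have h : `|u| < d by apply: le_lt_trans ud _; rewrite ltr_pdivrMr// ltr_pMr// ltr1n.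
move=> /(_ h); rewrite addr0 [u *: 1]mulr1 distrC => hu.
rewrite -(ler_pM2r (_ : 0 < `|u|^-1)) ?invr_gt0 ?normr_gt0// mulfK ?normr_eq0//.
rewrite -normfV -normrM; apply: le_trans hu.
by rewrite le_eqVlt; apply/orP; left; apply/eqP; congr `| _ |; rewrite /GRing.scale /=; field.
Qed.

Lemma cpowD (m : R) (z w : R[i]) : 0 < m -> cpow m (z + w) = cpow m z * cpow m w.
Proof.
move=> m0; rewrite /cpow m0; case: z w => a b [c d] /=.
rewrite powRD ?(gt_eqF m0) ?implybT// mulrDl cosD sinD.
by apply/eqP; rewrite eq_complex /=; apply/andP; split; apply/eqP; ring.
Qed.

Let cpow_parts (a p q b : R) (h : R[i]) :
  complex.Re (a%:C * (p +i* q) - 1 - b%:C * h) = a * p - 1 - b * complex.Re h /\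
  complex.Im (a%:C * (p +i* q) - 1 - b%:C * h) = a * q - b * complex.Im h.
Proof. by case: h => x y /=; split; ring. Qed.

(** Here E, C, S stand for exp u, cos v, sin v with u + i v = h ln m; the left side bounds the
    remainder of m^h at first order. *)
Let remainder_bound (E C S u v ep : R) : 0 <= ep -> `|u| <= 1 -> `|v| <= ep ->
  `|C| <= 1 -> `|S| <= 1 -> `|E - 1 - u| <= ep * `|u| -> `|C - 1| <= ep * `|v| ->
  `|S - v| <= ep * `|v| ->
  `|E * C - 1 - u| + `|E * S - v| <= 3 * ep * `|u| + 4 * ep * `|v|.
Proof.
move=> ep0 u1 ve C1 S1 H1 H2 H3.
have u2 : `|1 + u| <= 2 by apply: le_trans (ler_normD _ _) _; rewrite normr1; lra.
have b1 : `|E * C - 1 - u| <= ep * `|u| + 2 * (ep * `|v|).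
  have -> : E * C - 1 - u = (E - 1 - u) * C + (1 + u) * (C - 1) by ring.
  apply: le_trans (ler_normD _ _) _; rewrite !normrM lerD//.
    by rewrite -[leRHS]mulr1 ler_pM.
  by rewrite ler_pM.
have b2 : `|E * S - v| <= ep * `|u| + 2 * (ep * `|v|) + `|u| * ep.
  have -> : E * S - v = (E - 1 - u) * S + (1 + u) * (S - v) + u * v by ring.
  apply: le_trans (ler_normD _ _) _; rewrite lerD//; last by rewrite normrM ler_wpM2l.
  apply: le_trans (ler_normD _ _) _; rewrite !normrM lerD//.
    by rewrite -[leRHS]mulr1 ler_pM.
  by rewrite ler_pM.
by lra.
Qed.

Lemma cpow_derivative0 (m : R) : 0 < m ->
  h^-1 * (cpow m h - 1) @[h --> (0 : R[i]^o)^'] --> ((ln m)%:C : R[i]^o).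
Proof.
move=> m0; set la := ln m; apply: (@cvgrPdist_le R[i] R[i]^o _ _ _ _ _).2 => eps.
case: eps => e i0; rewrite ltcE /= => /andP[/eqP -> e0].
(* The coefficients 3 and 4 of [remainder_bound] add up to 7 < 8, and |u|, |v| are at most |h| (|ln
   m| + 1). *)
pose ep := e / (8 * (`|la| + 1)).
have la1 : 0 < `|la| + 1 by rewrite ltr_wpDl.
have ep0 : 0 < ep by rewrite divr_gt0// mulr_gt0.
have [d1 d10 H1] := derive_remainder (is_derive_expR 0) ep0.
have [d2 d20 H2] := derive_remainder (is_derive_cos 0) ep0.
have [d3 d30 H3] := derive_remainder (is_derive_sin 0) ep0.
rewrite expR0 in H1; rewrite cos0 sin0 in H2; rewrite sin0 cos0 in H3.
pose d := Num.min (Num.min 1 ep) (Num.min d1 (Num.min d2 d3)).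
have d0 : 0 < d by rewrite !lt_min ltr01 ep0 d10 d20 d30.
have dla0 : (0 : R[i]) < (d / (`|la| + 1))%:C by rewrite ltcR divr_gt0.
near=> h.
have h0 : h != 0 by near: h; exact: (@nbhs_dnbhs_neq R[i]^o).
have hd : `|h| <= (d / (`|la| + 1))%:C by near: h; exact: (@dnbhs0_le _ R[i]^o).
have -> : la%:C - h^-1 * (cpow m h - 1) = - (h^-1 * (cpow m h - 1 - la%:C * h)).
  by field.
rewrite normrN normrM normfV mulrC ler_pdivrMr ?normr_gt0//.
have [hx hy] := re_le_normc hd.
rewrite [`|h|]normc_def; set nh := Num.sqrt _.
have hn : `|h| <= nh%:C by rewrite normc_def.
have [hx' hy'] := re_le_normc hn.
rewrite (_ : e +i* 0 = e%:C)// -rmorphM /=.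
apply: le_trans (normc_le_add _) _; rewrite lecR.
rewrite /cpow m0 /powR (gt_eqF m0) -/la.
set x := complex.Re h in hx hx' *; set y := complex.Im h in hy hy' *.
have [-> ->] := cpow_parts (expR (x * la)) (cos (y * la)) (sin (y * la)) la h.
rewrite -/x -/y ![la * _]mulrC.
have small z : `|z| <= d / (`|la| + 1) -> `|z * la| <= d.
  rewrite ler_pdivlMr// => hz; rewrite normrM; apply: le_trans hz.
  by rewrite ler_wpM2l// lerDl.
have := small _ hx; have := small _ hy; rewrite !le_min.
move=> /andP[/andP[_ ve] /andP[_ /andP[vd2 vd3]]] /andP[/andP[u1 _] /andP[ud1 _]].
have := H1 _ ud1; have := H2 _ vd2; have := H3 _ vd3.
rewrite !mul1r oppr0 mul0r !subr0 addr0 => h3 h2 h1.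
apply: le_trans (remainder_bound (ltW ep0) u1 ve (cos_max _) (sin_max _) h1 h2 h3) _.
have nla z : `|z| <= nh -> ep * `|z * la| <= ep * (nh * (`|la| + 1)).
  by move=> hz; apply: (ler_wpM2l (ltW ep0)); rewrite normrM ler_pM// lerDl.
have -> : e * nh = 8 * (ep * (nh * (`|la| + 1))) by rewrite /ep; field; rewrite gt_eqF.
have := nla _ hx'; have := nla _ hy'.
have : 0 <= ep * (nh * (`|la| + 1)).
  by rewrite mulr_ge0 ?(ltW ep0)// mulr_ge0 ?(ltW la1)// (le_trans _ hx').
by lra.
Unshelve. all: end_near. Qed.

Lemma holomorphic_cpow (m : R) (s : R[i]) : 0 < m ->
  derivable ((fun z => cpow m (z - 1)) : R[i]^o -> R[i]^o) s 1.
Proof.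
move=> m0; apply/cvg_ex; exists (cpow m (s - 1) * (ln m)%:C).
pose q (h : R[i]^o) : R[i]^o := cpow m (s - 1) * (h^-1 * (cpow m h - 1)).
have cq : q h @[h --> (0 : R[i]^o)^'] --> (cpow m (s - 1) * (ln m)%:C : R[i]^o).
  by apply: (@cvgM R[i]); [exact: cvg_cst|exact: cpow_derivative0].
apply: cvg_trans (near_eq_cvg (f := q) _) cq; apply: nearW => h /=.
rewrite [h *: 1]mulr1 /GRing.scale /= -addrA cpowD// /q.
by ring.
Qed.

Lemma holomorphic_H_form (m l : R) (k : int) (s : R[i]) : 0 < m ->
  holomorphic_at (H_form m l k) s.
Proof.
move=> m0; rewrite /holomorphic_at.
have := derivableM (@holomorphic_cpow m s m0)
  (derivableD (derivableM (@derivable_cst R[i] R[i]^o R[i]^o (2 * l%:C) s 1) (@derivable_id R[i] R[i]^o s 1))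
     (@derivable_cst R[i] R[i]^o R[i]^o (k%:~R * m%:C) s 1)).
exact.
Qed.

Lemma near_re_gt (s : R[i]) (a : R) : a < complex.Re s ->
  \forall z \near (s : R[i]^o), a < complex.Re z.
Proof.
move=> as_; have d0 : (0 : R[i]) < ((complex.Re s - a) / 2)%:C.
  by rewrite ltcR divr_gt0// subr_gt0.
apply/nbhs_ballP; exists ((complex.Re s - a) / 2)%:C => //= z.
rewrite /ball /= => /ltW/re_le_normc[+ _]; rewrite ler_norml raddfB /= => /andP[_ h].
by lra.
Qed.

End holomorphy.

Theorem theorem1 (R : realType) :
  exists (l : set (plane R) -> R) (k : set (plane R) -> int),
  forall Omega : set (plane R),
    compact Omega -> convex_set Omega -> Omega^° !=set0 ->
    let Omega' := minimal_model Omega in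
    let H' := H_form (rho_max Omega') (l Omega') (k Omega') in
    [/\ exists (n : nat) (T : 'I_n -> gamma_triangle R),
          gamma_decomposition Omega T,
        forall s : R[i], holomorphic_at H' s &
        forall s : R[i], 2 < complex.Re s ->
          [/\ Z_convergent Omega s, Z_convergent Omega' s,
              holomorphic_at (H Omega') s, H Omega' s = H' s &
              forall (n : nat) (T : 'I_n -> gamma_triangle R),
                gamma_decomposition Omega T ->
                (forall i, F_convergent (T i) s) /\
                s * (s - 1) * Z Omega s = - F_boundary T s + H Omega' s]].
Proof.
(* The constants must depend on the model only, although they are computed from a body K. So they
   are chosen for each set A, from some K of which A is the model, and as (0, 0) if there is none;
   bodies with the same model then share them. *)
have hat_data (A : set (plane R)) : exists lk : R * int,
    (exists K : set (plane R), [/\ compact K, convex_set K, K^° !=set0 & A = hat K]) ->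
    forall s, 2 < complex.Re s -> H A s = H_form (rho_max A) lk.1 lk.2 s.
  have [[K [cK vK K0 ->]]|no] := pselect (exists K : set (plane R),
      [/\ compact K, convex_set K, K^° !=set0 & A = hat K]); last by exists (0, 0).
  have [l [k lk]] := H_hat cK vK K0; exists (l, k) => _ s s2.
  by rewrite rho_max_hat// lk.
have [lk lkP] := choice hat_data.
exists (fun A => (lk A).1), (fun A => (lk A).2) => K cK vK K0 Omega' H'.
have OE : Omega' = hat K by exact: minimal_modelE.
have HE s : 2 < complex.Re s -> H Omega' s = H' s.
  by apply: lkP; exists K.
have m0 : 0 < rho_max Omega' by rewrite OE rho_max_hat//; exact: rho_max_gt0.
have holH s : holomorphic_at H' s by exact: holomorphic_H_form.
split => // [|s s2]; first exact: exists_decomposition.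
have w0 : 0 < complex.Re (s - 2) by case: (s) s2 => a b /= h; lra.
have chat := compact_hat cK vK K0; have hat0 := interior_hat cK K0.
split.
- exact: (Z_convergent_body cK vK K0 w0).
- by rewrite OE; exact: (Z_convergent_body chat (@convex_hat _ K) hat0 w0).
(* The half-plane Re z > 2 is open, so both functions agree near s. *)
- apply: (near_eq_derivable (f := H' : R[i]^o -> R[i]^o)); last exact: holH.
  by apply: filterS (near_re_gt s2) => z /HE ->.
- exact: HE.
move=> n T HT; split; first by move=> i; exact: (F_convergent_decomposition cK vK K0 HT i s2).
by rewrite (F_boundaryE cK vK K0 HT s2) OE /H; move: (s * (s - 1)) => a; rewrite mulrBr opprB subrK.
Qed.
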